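(* Let $K$ be a $C_4$-quartic field, $K_2$ its unique quadratic subfield, $\Delta_2$ the discriminant of $K_2$, and $\mathcal{N}$ the absolute norm of the relative discriminant of $K/K_2$. (a) If $2$ is unramified in $K$, then the combinatorial type of the shape of $K$ is a truncated octahedron. Specifically, the shape is that of a body-centered tetragonal lattice with side ratio $\left(|\Delta_2|/\mathcal{N}\right)^{1/4}\le 1$. This ratio equals $1$ (a body-centered cubic lattice) if and only if $\Delta_K$ is a cube, i.e.\ if and only if no primes other than those ramified in $K_2$ ramify in $K/K_2$. (b) If $2$ ramifies in $K$, then the combinatorial type of the shape of $K$ is a cuboid. Specifically, the shape is that of a primitive tetragonal lattice with side ratio $\left(4|\Delta_2|/\mathcal{N}\right)^{1/4}\le 1$. The shape is that of a primitive cubic lattice if and only if $\Delta_K=2^{11}\delta$ with $\delta$ an odd cube, i.e.\ if and only if $2$ ramifies in $K_2$ and no primes other than those ramified in $K_2$ ramify in $K/K_2$.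
   Context: A $C_4$-quartic field is a cyclic quartic extension of $\mathbf{Q}$. Shape of a number field $K$ of degree $n$: the class, under orthogonal transformations and scalings by nonzero reals, of the lattice $j(\mathcal{O}_K^\perp)$, where $j:K\to\mathbf{C}^n$, $\alpha\mapsto(\sigma_i(\alpha))_i$ is the Minkowski embedding with inner product $\sum x_i\overline{y_i}$, and $\mathcal{O}_K^\perp=\{n\alpha-\mathrm{tr}(\alpha):\alpha\in\mathcal{O}_K\}$. For $a,c>0$, the primitive tetragonal lattice with base side $a$ and height $c$ is $\mathbf{Z}(a,0,0)+\mathbf{Z}(0,a,0)+\mathbf{Z}(0,0,c)$; the body-centered tetragonal lattice is this plus $\mathbf{Z}(a/2,a/2,c/2)$; the side ratio is $c/a$; the cubic cases are $c=a$. The combinatorial type of a rank-3 lattice is the combinatorial type of its Voronoi cell (points at least as close to $0$ as to any other lattice point). *)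

(* Defs.v *)
From HB Require Import structures.
From mathcomp Require Import all_boot all_order all_algebra all_fingroup.
From mathcomp Require Import all_solvable all_field.
From mathcomp Require Import finmap.
From mathcomp Require Import all_classical all_reals all_analysis.
From mathcomp Require Import complex.

Set Implicit Arguments.
Unset Strict Implicit.
Unset Printing Implicit Defensive.

Import Order.TTheory GRing.Theory Num.Theory.
Local Open Scope classical_set_scope.
Local Open Scope ring_scope.

Section NumberFields.
Variable K : splittingFieldType rat.
Implicit Types (E F : {subfield K}) (I J P Q : set K).

Definition C4_quartic :=
  [/\ \dim {:K} = 4%N, galois 1%AS {:K}%AS & cyclic 'Gal({:K}%AS / 1%AS)].

Definition ring_of_integers E : set K :=
  [set x | x \in E /\ integralOver (intr : int -> K) x].

Definition integral_basis E (b : (\dim E).-tuple K) :=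
  [/\ basis_of E b,
      forall i, ring_of_integers E (tnth b i) &
      forall x, ring_of_integers E x ->
        exists c : 'I_(\dim E) -> int, x = \sum_i (c i)%:~R * tnth b i].

(* Traces are [galTrace], i.e. sums over the Galois group: they are the field
   traces for Galois extensions, the only ones in which they are used here.
   The value of [disc E] does not depend on the integral basis. *)
Definition disc E : int :=
  xget 0 [set d : int | exists2 b : (\dim E).-tuple K, integral_basis b &
    d%:~R = \det (\matrix_(i, j) galTrace 1%AS E (tnth b i * tnth b j))].

Definition is_ideal E I :=
  [/\ I `<=` ring_of_integers E, I 0,
      forall x y, I x -> I y -> I (x + y) &
      forall a x, ring_of_integers E a -> I x -> I (a * x)].

Definition prime_ideal E P :=
  [/\ is_ideal E P, ~ P 1 &
      forall x y, ring_of_integers E x -> ring_of_integers E y ->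
        P (x * y) -> P x \/ P y].

Definition ideal_gen E (S : set K) : set K :=
  [set x | exists (n : nat) (a s : 'I_n -> K),
     (forall i, ring_of_integers E (a i) /\ S (s i)) /\
     x = \sum_i a i * s i].

Definition ideal_mul E I J : set K :=
  ideal_gen E [set z | exists x y, [/\ I x, J y & z = x * y]].

(* Index of I in the ring of integers: the number of cosets x + I. *)
Definition absnorm E I : nat :=
  #|` fset_set [set [set y | I (y - x)] | x in ring_of_integers E]|.

(* The ideal of O_F generated by the discriminants of the bases of E/F
   contained in O_E; families that are not bases only contribute 0. *)
Definition rel_disc F E : set K :=
  ideal_gen F [set d | exists2 b : 'I_(\dim_F E) -> K,
    forall i, ring_of_integers E (b i) &
    d = \det (\matrix_(i, j) galTrace F E (b i * b j))].

(* For a nonzero prime P of O_F: some prime Q of O_E over P has ramification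
   index e(Q|P) >= 2, i.e. Q^2 contains (equivalently, divides) P O_E. *)
Definition prime_ramifies F E P :=
  exists2 Q, prime_ideal E Q & ideal_gen E P `<=` ideal_mul E Q Q.

Definition ramifies F E (p : nat) :=
  exists P, [/\ prime_ideal F P, P p%:R & prime_ramifies F E P].

End NumberFields.

Section Lattices.
Variable R : realType.

Definition rspan (V : lmodType R) (S : set V) : set V :=
  [set x | exists (n : nat) (c : 'I_n -> R) (v : 'I_n -> V),
     (forall i, S (v i)) /\ x = \sum_i c i *: v i].

(* Equality of the classes of L and M under linear isometries and nonzero real
   scalings; ipV and ipW are the inner products of the ambient spaces. *)
Definition same_shape (V W : lmodType R) (ipV : V -> V -> R)
    (ipW : W -> W -> R) (L : set V) (M : set W) :=
  exists (f : {linear V -> W}) (s : R),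
    [/\ s != 0,
        forall x y, rspan L x -> rspan L y -> ipW (f x) (f y) = ipV x y &
        M = [set s *: f x | x in L]].

Definition voronoi_cell (V : lmodType R) (ip : V -> V -> R) (L : set V) :
    set V :=
  [set x | rspan L x /\ forall y, L y -> ip x x <= ip (x - y) (x - y)].

(* Includes the empty face (l = 0, b = 1) and P itself (l = 0, b = 0). *)
Definition face (V : lmodType R) (P F : set V) :=
  exists (l : {scalar V}) (b : R),
    (forall x, P x -> l x <= b) /\ F = [set x | P x /\ l x = b].

(* Combinatorial equivalence of polytopes: isomorphic face lattices. *)
Definition same_combinatorial_type (V W : lmodType R) (P : set V) (Q : set W) :=
  exists2 phi : set V -> set W, set_bij (face P) (face Q) phi &
    forall F G, face P F -> face P G -> (F `<=` G <-> phi F `<=` phi G).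

Definition dot3 (x y : 'rV[R]_3) : R := \sum_i x 0 i * y 0 i.

Definition row3 (x y z : R) : 'rV[R]_3 := \row_i [:: x; y; z]`_i.

Definition primitive_tetragonal (a c : R) : set 'rV[R]_3 :=
  [set v | exists m n k : int,
     v = m%:~R *: row3 a 0 0 + n%:~R *: row3 0 a 0 + k%:~R *: row3 0 0 c].

Definition body_centered_tetragonal (a c : R) : set 'rV[R]_3 :=
  [set v | exists2 w, primitive_tetragonal a c w &
     exists k : int, v = w + k%:~R *: row3 (a / 2) (a / 2) (c / 2)].

(* The octahedron |x| + |y| + |z| <= 3 truncated at one third of its edges;
   its vertices are the permutations of (0, +-1, +-2). *)
Definition truncated_octahedron : set 'rV[R]_3 :=
  [set x | \sum_i `|x 0 i| <= 3 /\ forall i, `|x 0 i| <= 2].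

(* All cuboids have the same combinatorial type. *)
Definition cuboid : set 'rV[R]_3 := [set x | forall i, `|x 0 i| <= 1].

(* C^n as a real vector space, with the real part of the Hermitian product;
   on the real span of the image of j that product is already real. *)
Definition Cn (n : nat) : lmodType R := {ffun 'I_n -> Rcomplex R}.

Definition hdot (n : nat) (x y : Cn n) : R :=
  complex.Re (\sum_i (x i : R[i]) * conjc (y i : R[i])).

Section Minkowski.
Variable K : splittingFieldType rat.
Local Notation n := (\dim {:K}).
Variable sigma : 'I_n -> {rmorphism K -> R[i]}.

Definition enumerates_embeddings :=
  (forall i j, sigma i =1 sigma j -> i = j) /\
  (forall tau : {rmorphism K -> R[i]}, exists i, tau =1 sigma i).

Definition minkowski (x : K) : Cn n := [ffun i => sigma i x : Rcomplex R].

Definition perp_lattice : set (Cn n) :=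
  [set minkowski (x *+ n - galTrace 1%AS {:K}%AS x)
     | x in ring_of_integers {:K}%AS].

Definition shape_combinatorial_type (P : set 'rV[R]_3) :=
  same_combinatorial_type (voronoi_cell (@hdot n) perp_lattice) P.

Definition shape_is (M : set 'rV[R]_3) :=
  same_shape (@hdot n) dot3 perp_lattice M.

Definition shape_is_primitive_tetragonal (r : R) :=
  exists a c : R,
    [/\ 0 < a, 0 < c, c / a = r & shape_is (primitive_tetragonal a c)].

Definition shape_is_body_centered_tetragonal (r : R) :=
  exists a c : R,
    [/\ 0 < a, 0 < c, c / a = r & shape_is (body_centered_tetragonal a c)].

Definition shape_is_primitive_cubic :=
  exists2 a : R, 0 < a & shape_is (primitive_tetragonal a a).

Definition shape_is_body_centered_cubic :=
  exists2 a : R, 0 < a & shape_is (body_centered_tetragonal a a).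

End Minkowski.
End Lattices.

(* Main.v *)
(* Let s generate the Galois group, and let d generate the lattice of the
   integers y of K2 with s y = - y. The integers y of K with s (s y) = - y form a
   Z[i]-module, with i acting as s; taking al of least square norm al^2 + (s al)^2
   in it, the Euclidean algorithm shows that al and s al span this module. This
   gives D = d^2 = B^2 + C^2 and al^2 + (s al)^2 = A D, where A is square-free up
   to a factor 2 and prime to D at the odd primes.
   Every integer is half an element of O_K2 plus a half-integral combination of al
   and s al. A study modulo 4 leaves two cases: either O_K is the direct sum of
   O_K2 and Z al + Z (s al) (exactly when 2 ramifies in K), or D and A are odd,
   A + C = 1 mod 4, and O_K contains (1 + A B d + 2 al) / 4. The orthogonal vectors
   d, al, s al have lengths 2 sqrt D, sqrt (2 |A| D), sqrt (2 |A| D), so that in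
   these two cases the projection of O_K is a primitive, respectively
   body-centered, tetragonal lattice; the discriminants follow from the same bases.
   As for the Voronoi cells, the face lattice of a polyhedron only depends on which
   sets of inequalities are exactly saturated at some point. For body-centered
   lattices of side ratio at most 1 these sets do not depend on the ratio, the
   cell in an octant being a cube truncated by one plane. *)

Require Import Defs.
From HB Require Import structures.
From mathcomp Require Import all_boot all_order all_algebra all_fingroup.
From mathcomp Require Import all_solvable all_field.
From mathcomp Require Import finmap.
From mathcomp Require Import all_classical all_reals all_analysis.
From mathcomp Require Import complex.
From mathcomp Require Import ring lra zify.

Set Implicit Arguments.
Unset Strict Implicit.
Unset Printing Implicit Defensive.

Import Order.TTheory GRing.Theory Num.Theory.
Local Open Scope classical_set_scope.
Local Open Scope ring_scope.

(** * Combinatorial types of polyhedra *)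

Section CombinatorialTypes.
Variable R : realType.
Implicit Types V W U : lmodType R.

(** The integers with [s (s y) = - y] form a lattice on a line over Q(i), on which [y^2 + (s y)^2]
    is a fixed integer times the norm of Q(i); so a Euclidean descent finds [al], whether K is real
    or not. Since [s d = - d], multiplication by [d] is conjugate linear there: it sends [z al] to
    [(B + C i) conj(z) al], and applying it twice yields [D = B^2 + C^2]. The later arithmetic takes
    place in the integers [A], [B], [C], [D]. Ramification is defined by ideals, and over Q both
    directions go through one criterion: [p] ramifies when it lies in the square of a prime ideal.
    If [p] is prime to the discriminant, the integers modulo [p] have no nilpotents, and this is
    impossible. To show that [p] ramifies, an integer that [p] divides exactly once is exhibited in
    the square: [D = d^2], [A D = al^2 + (s al)^2], or a combination built on [al + s al]. The cubic
    cases also need that a shape determines its side ratio; this is read off from lengths and angles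
    of short vectors, the two lattices being compared through common preimages. *)

Lemma same_combinatorial_type_trans V W U
    (P : set V) (Q : set W) (S : set U) :
  same_combinatorial_type P Q -> same_combinatorial_type Q S ->
  same_combinatorial_type P S.
Proof.
move=> [f [ff fi fs] fP] [g [gf gi gs] gP].
exists (g \o f); last first.
  by move=> F G hF hG; rewrite fP // gP //; apply: ff.
split=> [F /ff /gf //|F G /set_mem hF /set_mem hG /= /gi|F /gs[G /fs[H hH <-] <-]].
- by rewrite !inE => /(_ (ff _ hF) (ff _ hG)) /fi; apply; rewrite inE.
- by exists H.
Qed.

Lemma same_combinatorial_type_inv V W (P : set V) (Q : set W)
    (phi : set V -> set W) (psi : set W -> set V) :
    (forall F, face P F -> face Q (phi F)) ->
    (forall F, face Q F -> face P (psi F)) ->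
    (forall F, face P F -> psi (phi F) = F) ->
    (forall F, face Q F -> phi (psi F) = F) ->
    {homo phi : F G / F `<=` G} -> {homo psi : F G / F `<=` G} ->
  same_combinatorial_type P Q.
Proof.
move=> phif psif phiK psiK phiS psiS; exists phi.
  split=> [F /phif //|F G|F hF].
  - by rewrite !inE => hF hG e; rewrite -(phiK F) // e phiK.
  - by exists (psi F); [exact: psif|exact: psiK].
move=> F G hF hG; split=> [/phiS //|/psiS]; by rewrite !phiK.
Qed.

(** The maps are inverse only on the two sets: the cell of the shape spans a 3-dimensional subspace
    of [Cn], so there is no isomorphism of the ambient spaces. A supporting form of a face is
    transported by composing it with the other map. *)
Lemma same_combinatorial_type_linear V W (f : {linear V -> W})
    (g : {linear W -> V}) (P : set V) (Q : set W) :
    (forall x, P x -> Q (f x)) -> (forall y, Q y -> P (g y)) ->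
    (forall x, P x -> g (f x) = x) -> (forall y, Q y -> f (g y) = y) ->
  same_combinatorial_type P Q.
Proof.
move=> fQ gP gf fg.
have faceS (T : lmodType R) (A F : set T) : face A F -> F `<=` A.
  by case=> l [b [_ ->]] x [].
apply: (@same_combinatorial_type_inv _ _ _ _ (image^~ f) (image^~ g)).
- move=> F [l [b [lb ->]]].
  exists (l \o g : {scalar W}), b; split=> [y /gP /lb //|].
  apply/seteqP; split=> [_ [x [Px lx] <-]|y [Qy ly]].
    by split; [exact: fQ|rewrite /= gf].
  by exists (g y); rewrite ?fg//; split => //; exact: gP.
- move=> F [l [b [lb ->]]].
  exists (l \o f : {scalar V}), b; split=> [y /fQ /lb //|].
  apply/seteqP; split=> [_ [x [Px lx] <-]|y [Qy ly]].
    by split; [exact: gP|rewrite /= fg].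
  by exists (f y); rewrite ?gf//; split => //; exact: fQ.
- move=> F /faceS FP; apply/seteqP; split=> [_ [_ [x Fx <-] <-]|x Fx].
    by rewrite gf //; exact: FP.
  by exists (f x); [exists x|rewrite gf //; exact: FP].
- move=> F /faceS FP; apply/seteqP; split=> [_ [_ [x Fx <-] <-]|x Fx].
    by rewrite fg //; exact: FP.
  by exists (g x); [exists x|rewrite fg //; exact: FP].
- by move=> F G; exact: image_subset.
- by move=> F G; exact: image_subset.
Qed.

Section Polyhedra.
Variables (V : lmodType R) (I : finType) (l : I -> {scalar V}) (b : I -> R).

Definition polyhedron : set V := [set x | forall k, l k x <= b k].

Definition active (x : V) : {set I} := [set k | l k x == b k].

Definition sum_form (S : {set I}) (x : V) : R := \sum_(k in S) l k x.

Fact sum_form_is_scalar S : scalar (sum_form S).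
Proof.
move=> a x y; rewrite /sum_form /= mulr_sumr -big_split /=.
by apply: eq_bigr => k _; rewrite linearP.
Qed.

HB.instance Definition _ S :=
  GRing.isLinear.Build R V R _ (sum_form S) (sum_form_is_scalar S).

(** The sum of the forms in [S] reaches the sum of their bounds only where each form reaches its own
    bound. *)
Lemma face_active_superset (S : {set I}) :
  face polyhedron [set x | polyhedron x /\ S \subset active x].
Proof.
exists (sum_form S : {scalar V}), (\sum_(k in S) b k).
split=> [x Px|]; first by apply: ler_sum => k _; exact: Px.
apply/seteqP; split=> x /= [Px Sx]; split=> //.
  by apply: eq_bigr => k /(fintype.subsetP Sx); rewrite inE => /eqP.
apply/fintype.subsetP => k kS; rewrite inE.
have /eqP := Sx; rewrite -subr_eq0 /sum_form -sumrB.
rewrite -oppr_eq0 -sumrN psumr_eq0 => [/allP /(_ k)|i _].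
  by rewrite mem_index_enum kS oppr_eq0 subr_eq0; apply.
by rewrite oppr_ge0 subr_le0; exact: Px.
Qed.

(* Leaving [x] slightly, away from [y], keeps all inactive constraints. *)
Lemma polyhedron_extend x y : polyhedron x -> polyhedron y ->
  active x \subset active y ->
  exists2 e : R, 0 < e & polyhedron (x + e *: (x - y)).
Proof.
move=> Px Py xy.
(* Division by zero gives 0, so active constraints do not contribute to [s]; for the others [s]
   exceeds every ratio that limits the step length. *)
pose c k := `|l k x - l k y| / (b k - l k x).
have c0 k : 0 <= c k by rewrite divr_ge0 // subr_ge0; exact: Px.
pose s := 1 + \sum_k c k.
have s0 : 0 < s by rewrite ltr_pwDl // sumr_ge0.
exists s^-1; first by rewrite invr_gt0.
move=> k; rewrite linearD linearZ linearB /=.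
have [kx|kx] := boolP (k \in active x).
  have := fintype.subsetP xy k kx; move: kx; rewrite !inE => /eqP -> /eqP ->.
  by rewrite subrr mulr0 addr0.
have bk : 0 < b k - l k x.
  rewrite subr_gt0 lt_neqAle; apply/andP; split; last exact: Px.
  by move: kx; rewrite inE.
rewrite -lerBrDl -(ler_pM2l s0) mulrA divff ?gt_eqF // mul1r.
apply: le_trans (ler_norm _) _.
rewrite -ler_pdivrMr //.
rewrite -/(c k) /s (bigD1 k) //= addrCA lerDl addr_ge0 // sumr_ge0 //.
Qed.

(** A point [x] of [F] with the fewest active constraints is a relative interior point, and its
    active set describes [F]. The midpoint of [x] and any [y] in [F] has its active set in both, so
    by minimality [active x] is contained in [active y]. Conversely, if it is, the segment from [y]
    to [x] can be prolonged beyond [x], and a form that is maximal at [x] cannot be smaller at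
    [y]. *)
Lemma face_activeP F x0 : face polyhedron F -> F x0 ->
  exists S : {set I}, F = [set x | polyhedron x /\ S \subset active x].
Proof.
move=> [f [c [fc FE]]] Fx0.
have [n [x [Fx nx]] minn] : exists2 n, (exists x, F x /\ #|active x| = n) &
    forall y, F y -> (n <= #|active y|)%N.
  pose P n := `[< exists x, F x /\ #|active x| = n >].
  have exP : exists n, P n by exists #|active x0|; apply/asboolP; exists x0.
  have [n /asboolP Pn minn] := ex_minnP exP.
  by exists n => // y Fy; apply: minn; apply/asboolP; exists y.
have [Px fx] : polyhedron x /\ f x = c by move: Fx; rewrite FE.
exists (active x); apply/seteqP; split=> y.
  move=> Fy; have [Py fy] : polyhedron y /\ f y = c by move: Fy; rewrite FE.
  split=> //.
  pose z := (2^-1 : R) *: (x + y).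
  have lz k : l k z = 2^-1 * (l k x + l k y) by rewrite linearZ linearD.
  have Fz : F z.
    rewrite FE; split=> [k|]; last by rewrite linearZ linearD /= fx fy; lra.
    by rewrite lz; have := Px k; have := Py k; lra.
  have zx : active z \subset active x :&: active y.
    apply/fintype.subsetP => k; rewrite !inE lz => /eqP e.
    have := Px k; have := Py k => py px.
    by apply/andP; split; apply/eqP; lra.
  have /eqP <- : active z == active x.
    rewrite eqEcard (fintype.subset_trans zx) ?subsetIl //= nx; exact: minn.
  exact: fintype.subset_trans zx (finset.subsetIr _ _).
move=> [Py xy]; rewrite FE; split=> //.
have [e e0 Pe] := polyhedron_extend Px Py xy.
apply/eqP; rewrite eq_le fc //=.
have := fc _ Pe; rewrite linearD linearZ linearB /= fx gerDl.
by rewrite pmulr_rle0 // subr_le0.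
Qed.

Lemma face_active_closed F x y : face polyhedron F -> F x -> polyhedron y ->
  active x \subset active y -> F y.
Proof.
move=> hF Fx Py xy; have [S FE] := face_activeP hF Fx.
move: Fx; rewrite FE => -[_ Sx]; split=> //; exact: fintype.subset_trans xy.
Qed.

End Polyhedra.

Definition face_transfer (V W : lmodType R) (I : finType) (l : I -> {scalar V})
    (l' : I -> {scalar W}) (b b' : I -> R) (F : set V) : set W :=
  [set y | polyhedron l' b' y /\ exists2 x, F x & active l b x = active l' b' y].

Section FaceTransfer.
Variables (I : finType) (V W : lmodType R).
Variables (l : I -> {scalar V}) (l' : I -> {scalar W}) (b b' : I -> R).
Hypothesis VW : forall x, polyhedron l b x ->
  exists2 y, polyhedron l' b' y & active l b x = active l' b' y.
Hypothesis WV : forall y, polyhedron l' b' y ->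
  exists2 x, polyhedron l b x & active l b x = active l' b' y.

Lemma face_face_transfer F : face (polyhedron l b) F ->
  face (polyhedron l' b') (face_transfer l l' b b' F).
Proof.
move=> hF; have [[x Fx]|F0] := pselect (exists x, F x).
  have [S FE] := face_activeP hF Fx.
  suff -> : face_transfer l l' b b' F =
      [set y | polyhedron l' b' y /\ S \subset active l' b' y].
    exact: face_active_superset.
  apply/seteqP; split=> y [Qy]; first by rewrite FE => -[z [_ Sz] zy]; split=> //; rewrite -zy.
  move=> Sy; split=> //; have [z Pz zy] := WV Qy.
  by exists z => //; rewrite FE; split=> //; rewrite zy.
(* The empty face has no point from which an active set could be read off; it is cut out by the zero
   form with bound 1. *)
suff -> : face_transfer l l' b b' F = set0.
  exists (\0 : {scalar W}), 1; split=> [x _|]; first by rewrite /= ler01.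
  by apply/seteqP; split=> // y [_ /= /eqP]; rewrite eq_sym oner_eq0.
by apply/seteqP; split=> // y [_ [x Fx]]; case: F0; exists x.
Qed.

(** With a point, a face contains every point of the polyhedron with the same active set. *)
Lemma face_transferK F : face (polyhedron l b) F ->
  face_transfer l' l b' b (face_transfer l l' b b' F) = F.
Proof.
move=> hF; apply/seteqP; split=> x.
  move=> [Px [y [Qy [z Fz zy]] yx]].
  by apply: face_active_closed hF Fz Px _; rewrite zy yx.
move=> Fx; have Px : polyhedron l b x.
  by case: hF => f [c [_ FE]]; move: Fx; rewrite FE => -[].
split=> //; have [y Qy xy] := VW Px.
by exists y; [split=> //; exists x|].
Qed.

End FaceTransfer.

(* The face lattice of a polyhedron is determined by the sets of constraints
   that are simultaneously and exactly active at some point. *)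
Lemma same_combinatorial_type_active (I : finType) (V W : lmodType R)
    (l : I -> {scalar V}) (l' : I -> {scalar W}) (b b' : I -> R) :
    (forall x, polyhedron l b x ->
      exists2 y, polyhedron l' b' y & active l b x = active l' b' y) ->
    (forall y, polyhedron l' b' y ->
      exists2 x, polyhedron l b x & active l b x = active l' b' y) ->
  same_combinatorial_type (polyhedron l b) (polyhedron l' b').
Proof.
move=> VW WV.
have VW' x : polyhedron l b x ->
    exists2 y, polyhedron l' b' y & active l' b' y = active l b x.
  by move=> /VW[y]; exists y.
have WV' x : polyhedron l' b' x ->
    exists2 y, polyhedron l b y & active l' b' x = active l b y.
  by move=> /WV[y]; exists y.
apply: (@same_combinatorial_type_inv _ _ _ _ (face_transfer l l' b b')
  (face_transfer l' l b' b)).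
- exact: face_face_transfer.
- exact: face_face_transfer.
- exact: face_transferK.
- exact: face_transferK.
- by move=> F G FG y [Qy [x /FG Gx xy]]; split=> //; exists x.
- by move=> F G FG y [Qy [x /FG Gx xy]]; split=> //; exists x.
Qed.

End CombinatorialTypes.

(** * Voronoi cells of tetragonal lattices *)

Section TetragonalCells.
Variable R : realType.
Implicit Types (x y v w : 'rV[R]_3) (a c p q r rho : R).

Lemma ord3P (P : 'I_3 -> Prop) : P 0 -> P 1 -> P 2%:R -> forall i, P i.
Proof.
move=> P0 P1 P2 i.
have : i \in [:: 0; 1; 2%:R] by case: i => -[|[|[|]]].
by rewrite !inE => /or3P[] /eqP ->.
Qed.

Lemma sum_ord3 (F : 'I_3 -> R) : \sum_i F i = F 0 + F 1 + F 2%:R.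
Proof.
rewrite !big_ord_recl big_ord0 addr0 addrA.
by congr (F _ + F _ + F _); apply/val_inj.
Qed.

Lemma dot3E x y :
  dot3 x y = x 0 0 * y 0 0 + x 0 1 * y 0 1 + x 0 2%:R * y 0 2%:R.
Proof. exact: sum_ord3. Qed.

Lemma row3E p q r :
  ((row3 p q r 0 0 = p) * (row3 p q r 0 1 = q) * (row3 p q r 0 2%:R = r))%type.
Proof. by rewrite /row3 !mxE. Qed.

Lemma row3P x y :
  x 0 0 = y 0 0 -> x 0 1 = y 0 1 -> x 0 2%:R = y 0 2%:R -> x = y.
Proof. by move=> *; apply/rowP; apply: ord3P. Qed.

Lemma row3D p q r p' q' r' :
  row3 p q r + row3 p' q' r' = row3 (p + p') (q + q') (r + r').
Proof. by apply: row3P; rewrite mxE !row3E. Qed.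

Lemma row3Z k p q r : k *: row3 p q r = row3 (k * p) (k * q) (k * r).
Proof. by apply: row3P; rewrite mxE !row3E. Qed.

Lemma primitive_tetragonalP a c v : primitive_tetragonal a c v <->
  exists m n k : int, v = row3 (m%:~R * a) (n%:~R * a) (k%:~R * c).
Proof.
have E (m n k : int) : m%:~R *: row3 a 0 0 + n%:~R *: row3 0 a 0 +
    k%:~R *: row3 0 0 c = row3 (m%:~R * a) (n%:~R * a) (k%:~R * c).
  by rewrite !row3Z !row3D; congr row3; ring.
by split=> -[m [n [k ->]]]; exists m, n, k; rewrite E.
Qed.

Lemma body_centered_tetragonalP a c v : body_centered_tetragonal a c v <->
  exists m n l k : int, v = row3 ((2 * m + k)%:~R * (a / 2))
    ((2 * n + k)%:~R * (a / 2)) ((2 * l + k)%:~R * (c / 2)).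
Proof.
have E (m n l k : int) : row3 (m%:~R * a) (n%:~R * a) (l%:~R * c) +
    k%:~R *: row3 (a / 2) (a / 2) (c / 2) =
    row3 ((2 * m + k)%:~R * (a / 2)) ((2 * n + k)%:~R * (a / 2))
      ((2 * l + k)%:~R * (c / 2)).
  by rewrite row3Z row3D !rmorphD !rmorphM /=; congr row3; field.
split=> [[w /primitive_tetragonalP[m [n [l ->]]] [k ->]]|[m [n [l [k ->]]]]].
  by exists m, n, l, k.
exists (row3 (m%:~R * a) (n%:~R * a) (l%:~R * c)); last by exists k.
by apply/primitive_tetragonalP; exists m, n, l.
Qed.

Definition scale3 p q r (x : 'rV[R]_3) : 'rV[R]_3 :=
  row3 (p * x 0 0) (q * x 0 1) (r * x 0 2%:R).

Fact scale3_is_linear p q r : linear (scale3 p q r).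
Proof. by move=> k x y; apply: row3P; rewrite !mxE /=; ring. Qed.

HB.instance Definition _ p q r := GRing.isLinear.Build R 'rV[R]_3 'rV[R]_3 _
  (scale3 p q r) (scale3_is_linear p q r).

Lemma scale3K p q r x : p != 0 -> q != 0 -> r != 0 ->
  scale3 p q r (scale3 p^-1 q^-1 r^-1 x) = x.
Proof. by move=> *; apply: row3P; rewrite !row3E mulVKf. Qed.

Definition form3 p q r (x : 'rV[R]_3) : R :=
  p * x 0 0 + q * x 0 1 + r * x 0 2%:R.

Fact form3_is_scalar p q r : scalar (form3 p q r).
Proof. by move=> k x y; rewrite /form3 !mxE; ring. Qed.

HB.instance Definition _ p q r := GRing.isLinear.Build R 'rV[R]_3 R _
  (form3 p q r) (form3_is_scalar p q r).

(** Settles the span condition in [voronoi_cell]: the lattice has full rank. *)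
Lemma rspan_tetragonal a c (M : set 'rV[R]_3) x : a != 0 -> c != 0 ->
  primitive_tetragonal a c `<=` M -> rspan M x.
Proof.
move=> a0 c0 PM.
pose e (i : 'I_3) : 'rV[R]_3 := [:: row3 a 0 0; row3 0 a 0; row3 0 0 c]`_i.
exists 3%N, (fun i => x 0 i / [:: a; a; c]`_i), e; split=> [i|].
  apply: PM; apply/primitive_tetragonalP.
  by elim/ord3P: i; [exists 1, 0, 0|exists 0, 1, 0|exists 0, 0, 1];
    rewrite !(mul1r, mul0r).
rewrite !big_ord_recl big_ord0 addr0 /e /= !row3Z !row3D !(mulr0, addr0, add0r).
rewrite !divfK //; apply: row3P; rewrite row3E //.
all: by congr (x 0 _); apply/val_inj.
Qed.

Lemma primitive_sub_body_centered a c :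
  primitive_tetragonal a c `<=` body_centered_tetragonal a c.
Proof. by move=> v Pv; exists v => //; exists 0; rewrite scale0r addr0. Qed.

(* Nonnegative points of the two cells in the same relative position with
   respect to the coordinate planes, the planes [x_i = 2] and the plane
   truncating the octant. *)
Definition same_position (t h : R) :=
  [\/ t = 0 /\ h = 0, t = 2 /\ h = 2 | 0 < t < 2 /\ 0 < h < 2].

(** This is where side ratios at most 1 matter: as long as [rho <= 1], the combinations of positions
    that reach the truncating plane, and those that stay below it, do not depend on [rho]. *)
Lemma octant_position rho rho' (t1 t2 t3 : R) :
  0 < rho <= 1 -> 0 < rho' <= 1 ->
  0 <= t1 <= 2 -> 0 <= t2 <= 2 -> 0 <= t3 <= 2 -> t1 + t2 + rho * t3 <= 2 + rho ->
  exists h1 h2 h3, [/\ same_position t1 h1, same_position t2 h2,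
    same_position t3 h3, h1 + h2 + rho' * h3 <= 2 + rho' &
    t1 + t2 + rho * t3 = 2 + rho <-> h1 + h2 + rho' * h3 = 2 + rho'].
Proof.
move=> r0 r'0 t10 t20 t30 le.
have cases (t : R) : 0 <= t <= 2 -> [\/ t = 0, t = 2 | 0 < t < 2].
  move=> /andP[]; rewrite le_eqVlt => /predU1P[<-|gt0]; first by constructor 1.
  by rewrite le_eqVlt => /predU1P[->|lt2];
    [constructor 2|constructor 3; rewrite gt0].
have p3 : [\/ t3 = 0 /\ rho * t3 = 0, t3 = 2 /\ rho * t3 = 2 * rho |
    0 < t3 < 2 /\ 0 < rho * t3 < 2 * rho].
  case: (cases _ t30) => e3; [constructor 1|constructor 2|constructor 3].
  - by rewrite e3 mulr0.
  - by rewrite e3 mulrC.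
  - by split=> //; nra.
have [tight|loose] := eqVneq (t1 + t2 + rho * t3) (2 + rho); last first.
  have {le}lt : t1 + t2 + rho * t3 < 2 + rho by rewrite lt_neqAle loose.
  (* Off the truncating plane, intermediate coordinates can be given any small value: the extreme
     coordinates of a loose point leave enough room below the plane of the other cell. *)
  have pick (t d : R) : 0 <= t <= 2 -> 0 < d < 2 ->
      exists2 h, same_position t h & [\/ t = 0 /\ h = 0, t = 2 /\ h = 2 |
        0 < t < 2 /\ h = d].
    move=> /cases[] t0 d0.
    - by exists 0; constructor 1.
    - by exists 2; constructor 2.
    - by exists d; constructor 3.
  have [|h1 ? c1] := pick t1 (rho' / 4) t10; first lra.
  have [|h2 ? c2] := pick t2 (rho' / 4) t20; first lra.
  have [|h3 ? c3] := pick t3 4^-1 t30; first lra.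
  exists h1, h2, h3; suff : h1 + h2 + rho' * h3 < 2 + rho' by split=> //; lra.
  clear loose t10 t20 t30 cases pick; move: (rho * t3) p3 lt => P p3 lt.
  case: c1 => -[e1 ->]; case: c2 => -[e2 ->]; case: c3 => -[e3 ->];
    case: p3 => -[e3' e4]; lra.
suff [h1 [h2 [h3 [? ? ? e]]]] : exists h1 h2 h3, [/\ same_position t1 h1,
    same_position t2 h2, same_position t3 h3 & h1 + h2 + rho' * h3 = 2 + rho'].
  by exists h1, h2, h3; split=> //; rewrite e.
case: (cases _ t10) => e1; case: (cases _ t20) => e2; case: p3 => -[e3 e4].
all: try lra.
(* The thirteen combinations that can meet the plane, each with a point of the other cell lying on
   its own plane. *)
all: [> exists 0, 2, 1
  |exists 0, (2 - rho'), 2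
  |exists 0, (2 - rho' / 2), (3 / 2)
  |exists 2, 0, 1
  |exists 2, rho', 0
  |exists 2, (rho' / 2), 2^-1
  |exists (2 - rho'), 0, 2
  |exists (2 - rho' / 2), 0, (3 / 2)
  |exists rho', 2, 0
  |exists (rho' / 2), 2, 2^-1
  |exists (1 + rho' / 2), (1 + rho' / 2), 0
  |exists ((2 - rho') / 2), ((2 - rho') / 2), 2
  |exists (1 + rho' / 4), (1 + rho' / 4), 2^-1].
all: clear -e1 e2 e3 r'0; by split; try lra; by [constructor 1|constructor 2|constructor 3; lra].
Qed.

(** The Voronoi cell of the body-centered lattice in coordinates scaled by [4 / a], [4 / a] and
    [4 / c], with [rho] the square of the side ratio. The bounds 2 come from the lattice vectors on
    the axes, the last inequality from the eight vectors to the centers; [rho = 1] gives the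
    truncated octahedron. *)
Definition bct_cell rho : set 'rV[R]_3 :=
  [set x | [/\ `|x 0 0| <= 2, `|x 0 1| <= 2, `|x 0 2%:R| <= 2 &
    `|x 0 0| + `|x 0 1| + rho * `|x 0 2%:R| <= 2 + rho]].

Definition bct_form rho (k : (bool * 'I_3) + (bool * bool * bool)) :
    {scalar 'rV[R]_3} :=
  match k with
  | inl (s, i) => form3 ((-1) ^+ s *+ (i == 0)) ((-1) ^+ s *+ (i == 1))
      ((-1) ^+ s *+ (i == 2%:R))
  | inr (s1, s2, s3) => form3 ((-1) ^+ s1) ((-1) ^+ s2) (rho * (-1) ^+ s3)
  end.

Definition bct_bound rho (k : (bool * 'I_3) + (bool * bool * bool)) : R :=
  if k is inl _ then 2 else 2 + rho.

Lemma bct_form_inl rho s i x : bct_form rho (inl (s, i)) x = (-1) ^+ s * x 0 i.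
Proof.
by elim/ord3P: i; rewrite /= /form3 /= !(mulr1n, mulr0n, mul0r, addr0, add0r).
Qed.

Lemma ler_sign (s : bool) (t : R) : (-1) ^+ s * t <= `|t|.
Proof. by case: s; rewrite ?expr1 ?expr0; case: (ger0P t) => ?; lra. Qed.

Lemma bct_cell_polyhedron rho : 0 <= rho ->
  bct_cell rho = polyhedron (bct_form rho) (bct_bound rho).
Proof.
move=> r0; apply/seteqP; split=> x.
  move=> [x0 x1 x2 xs] [[s i]|[[s1 s2] s3]].
    rewrite bct_form_inl /=; apply: le_trans (ler_sign _ _) _.
    by elim/ord3P: i.
  apply: le_trans xs; rewrite /= /form3 -mulrA.
  by rewrite !lerD ?ler_wpM2l ?ler_sign.
move=> Px.
have H i : `|x 0 i| <= 2.
  have := Px (inl (false, i)); have := Px (inl (true, i)).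
  by rewrite !bct_form_inl /= expr1 expr0; case: (ger0P (x 0 i)) => ?; lra.
split=> //.
have := Px (inr (x 0 0 < 0, x 0 1 < 0, x 0 2%:R < 0)).
rewrite /= /form3 -mulrA.
by rewrite -!normrEsign ?num_real.
Qed.

End TetragonalCells.

Section TetragonalVoronoi.
Variable R : realType.
Implicit Types (x y v w : 'rV[R]_3) (a c p q r rho : R).

Lemma same_position_sign (t h : R) : same_position `|t| h ->
  [/\ `|Num.sg t * h| = h,
      forall s : bool, ((-1) ^+ s * t == 2) = ((-1) ^+ s * (Num.sg t * h) == 2) &
      forall s : bool, ((-1) ^+ s * t == `|t|) = ((-1) ^+ s * (Num.sg t * h) == h)].
Proof.
case: (ltrgt0P t) => [t0|t0|->] th.
- rewrite gtr0_sg // mul1r; have h0 : 0 < h by case: th => -[]; lra.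
  split=> [|[]|[]]; rewrite ?gtr0_norm // ?expr1 ?expr0;
    by apply/eqP/eqP; case: th => -[]; lra.
- rewrite ltr0_sg // mulN1r; have h0 : 0 < h by case: th => -[]; lra.
  split=> [|[]|[]]; rewrite ?normrN ?gtr0_norm // ?expr1 ?expr0;
    by apply/eqP/eqP; case: th => -[]; lra.
- have h0 : h = 0 by case: th => -[]; lra.
  by rewrite h0 sgr0 mul0r normr0; split=> // s; rewrite mulr0.
Qed.

(** A signed form is at most the sum of absolute values, so it is saturated only if that sum is and
    all signs agree. This separates the position in the octant from the choice of octant. *)
Lemma bct_form_inr_active rho x s1 s2 s3 : 0 < rho -> bct_cell rho x ->
  (bct_form rho (inr (s1, s2, s3)) x == 2 + rho) =
  [&& `|x 0 0| + `|x 0 1| + rho * `|x 0 2%:R| == 2 + rho,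
     (-1) ^+ s1 * x 0 0 == `|x 0 0|, (-1) ^+ s2 * x 0 1 == `|x 0 1| &
     (-1) ^+ s3 * x 0 2%:R == `|x 0 2%:R|].
Proof.
move=> r0 [_ _ _ xs]; rewrite /= /form3 -mulrA.
have := ler_sign s1 (x 0 0); have := ler_sign s2 (x 0 1).
have := ler_sign s3 (x 0 2%:R); rewrite -(ler_pM2l r0).
move: (_ * x 0 0) (_ * x 0 1) (_ * x 0 2%:R) => u v w lw lv lu.
apply/eqP/and4P => [e|[/eqP<- /eqP-> /eqP-> /eqP->] //].
split; apply/eqP; try lra.
by apply: (mulfI (lt0r_neq0 r0)); lra.
Qed.

Lemma bct_cell_same_active rho rho' x : 0 < rho <= 1 -> 0 < rho' <= 1 ->
    bct_cell rho x ->
  exists2 y, bct_cell rho' y & active (bct_form rho) (bct_bound rho) x =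
                               active (bct_form rho') (bct_bound rho') y.
Proof.
move=> r01 r'01 Px; have [x0 x1 x2 xs] := Px.
have [||||||h0 [h1 [h2 [p0 p1 p2 hs tight]]]] := @octant_position R rho rho'
  `|x 0 0| `|x 0 1| `|x 0 2%:R|; rewrite ?normr_ge0 //.
have [a0 b0 c0] := same_position_sign p0.
have [a1 b1 c1] := same_position_sign p1.
have [a2 b2 c2] := same_position_sign p2.
have le2 (t h : R) : same_position t h -> h <= 2 by case=> -[t0 h0']; lra.
have [/andP[r0 _] /andP[r'0 _]] := (r01, r'01).
(* The point found in the positive octant is reflected into the octant of [x]; a coordinate that
   vanishes in [x] has position 0, in agreement with [Num.sg 0 = 0]. *)
pose y := row3 (Num.sg (x 0 0) * h0) (Num.sg (x 0 1) * h1)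
  (Num.sg (x 0 2%:R) * h2).
have Py : bct_cell rho' y.
  by rewrite /bct_cell /= !row3E a0 a1 a2; split=> //;
    [exact: le2 p0|exact: le2 p1|exact: le2 p2].
exists y => //; apply/setP => -[[s i]|[[s1 s2] s3]]; rewrite !inE.
  by rewrite !bct_form_inl /=; elim/ord3P: i; rewrite row3E.
rewrite !bct_form_inr_active // !row3E a0 a1 a2 c0 c1 c2.
by congr (_ && _); apply/idP/idP => /eqP /tight /eqP.
Qed.

Lemma bct_cell_truncated_octahedron rho : 0 < rho <= 1 ->
  same_combinatorial_type (bct_cell rho) (@truncated_octahedron R).
Proof.
move=> r01; have /andP[r0 _] := r01.
have -> : @truncated_octahedron R = bct_cell 1.
  apply/seteqP; split=> x; rewrite /truncated_octahedron /bct_cell /= sum_ord3.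
    rewrite mul1r => -[xs x2]; split=> //; lra.
  by move=> [x0 x1 x2 xs]; split; [lra|exact: ord3P].
have one : 0 < (1 : R) <= 1 by rewrite ltr01 lexx.
rewrite !bct_cell_polyhedron ?ler01 ?(ltW r0) //.
apply: same_combinatorial_type_active => x.
  by rewrite -bct_cell_polyhedron ?ltW // -bct_cell_polyhedron //;
    exact: bct_cell_same_active.
rewrite -!bct_cell_polyhedron ?ler01 ?ltW // => Px.
by have [y Py xy] := bct_cell_same_active one r01 Px; exists y.
Qed.

(** The inequality for a lattice vector is the sum of one inequality per coordinate, so the six
    vectors along the axes imply all the others. *)
Lemma voronoi_primitive a c x : 0 < a -> 0 < c ->
  voronoi_cell (@dot3 R) (primitive_tetragonal a c) x <->
  [/\ `|x 0 0| <= a / 2, `|x 0 1| <= a / 2 & `|x 0 2%:R| <= c / 2].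
Proof.
move=> a0 c0; split.
  move=> [_ H].
  have H' (m n k : int) := H _ (proj2 (primitive_tetragonalP a c _)
    (ex_intro _ m (ex_intro _ n (ex_intro _ k erefl)))).
  have := (H' 1 0 0, H' (- 1) 0 0, H' 0 1 0, H' 0 (- 1) 0, H' 0 0 1, H' 0 0 (- 1)).
  rewrite !dot3E !mxE /= !rmorphN !rmorph1 !rmorph0 /=.
  move=> [[[[[h1 h2] h3] h4] h5] h6]; rewrite !ler_norml.
  by split; apply/andP; split; nra.
move=> [x0 x1 x2]; split.
  apply: rspan_tetragonal; last by move=> ?; exact.
    by rewrite gt_eqF.
  by rewrite gt_eqF.
move=> _ /primitive_tetragonalP[m [n [k ->]]].
have le1 (t b : R) (z : int) : 0 < b -> `|t| <= b / 2 ->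
    t * t <= (t - z%:~R * b) * (t - z%:~R * b).
  move=> b0 tb; suff le : 2 * (t * z%:~R) <= z%:~R * z%:~R * b.
    have -> : (t - z%:~R * b) * (t - z%:~R * b) =
      t * t + b * (z%:~R * z%:~R * b - 2 * (t * z%:~R)) by ring.
    by rewrite lerDl mulr_ge0 ?subr_ge0 // ltW.
  apply: le_trans (ler_norm _) _; rewrite !normrM.
  have -> : z%:~R * z%:~R = `|z%:~R : R| * `|z%:~R : R| :> R.
    by rewrite -normrM ger0_norm // -expr2 sqr_ge0.
  have [->|z0] := eqVneq z 0; first by rewrite normr0 !(mulr0, mul0r).
  have : 1 <= `|z%:~R : R| by rewrite -intr_norm ler1z; lia.
  rewrite (ger0_norm (ler0n _ 2)); move: (`|_|) (`|t|) tb => w u tb w1.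
  have bw : 0 <= b * w by apply: mulr_ge0; lra.
  have : b * w <= b * w * w by rewrite ler_peMr.
  have : u * w <= b / 2 * w by apply: ler_wpM2r => //; lra.
  by lra.
by rewrite !dot3E !mxE /= !lerD //; exact: le1.
Qed.

Lemma voronoi_body_centered a c x : 0 < a -> 0 < c ->
  voronoi_cell (@dot3 R) (body_centered_tetragonal a c) x <->
  bct_cell ((c / a) ^+ 2) (scale3 (4 / a) (4 / a) (4 / c) x).
Proof.
move=> a0 c0; rewrite /bct_cell /= !row3E.
set t0 := 4 / a * x 0 0; set t1 := 4 / a * x 0 1; set t2 := 4 / c * x 0 2%:R.
set rho := (c / a) ^+ 2.
have rhoE : c ^+ 2 = rho * a ^+ 2 by rewrite /rho; field; rewrite gt_eqF.
have rho0 : 0 < rho by rewrite exprn_gt0 // divr_gt0.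
(* In scaled coordinates the comparison with a lattice vector becomes linear, with its doubled
   coordinates [m], [n], [k] as coefficients and weight [rho] on the third axis. *)
have key (m n k : int) : dot3 x x <=
    dot3 (x - row3 (m%:~R * (a / 2)) (n%:~R * (a / 2)) (k%:~R * (c / 2)))
      (x - row3 (m%:~R * (a / 2)) (n%:~R * (a / 2)) (k%:~R * (c / 2))) <->
    m%:~R * t0 + n%:~R * t1 + rho * (k%:~R * t2) <=
    m%:~R ^+ 2 + n%:~R ^+ 2 + rho * k%:~R ^+ 2.
  rewrite -subr_ge0 -[X in _ <-> is_true X]subr_ge0.
  set u := (X in 0 <= X <-> _); set v := (X in _ <-> is_true (0 <= X)).
  have -> : u = a ^+ 2 / 4 * v.
    rewrite /u /v /t0 /t1 /t2 /rho !dot3E !mxE /=; field.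
    by rewrite !gt_eqF.
  by rewrite pmulr_rge0 // divr_gt0 // exprn_gt0.
split.
  move=> [_ H].
  have H' (m n l k : int) := proj1 (key _ _ _)
    (H _ (proj2 (body_centered_tetragonalP a c _) (ex_intro _ m (ex_intro _ n
      (ex_intro _ l (ex_intro _ k erefl)))))).
  pose z (s : bool) : int := if s then - 1 else 0.
  have sgE (s : bool) : (2 * z s + 1)%:~R = (-1) ^+ s :> R.
    by case: s; rewrite /z /= ?expr1 ?expr0 // rmorphD.
  have Hs (s1 s2 s3 : bool) : (-1) ^+ s1 * t0 + (-1) ^+ s2 * t1 +
      rho * ((-1) ^+ s3 * t2) <= 2 + rho.
    have := H' (z s1) (z s2) (z s3) 1.
    by rewrite !sgE !sqrr_sign mulr1.
  have := (H' 1 0 0 0, H' (- 1) 0 0 0, H' 0 1 0 0, H' 0 (- 1) 0 0,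
    H' 0 0 1 0, H' 0 0 (- 1) 0).
  rewrite !addr0 !mulr0 !mulr1 !mulrN1 !rmorphN !rmorph0 /=.
  move=> [[[[[h1 h2] h3] h4] h5] h6]; split; rewrite ?ler_norml.
  - by apply/andP; split; lra.
  - by apply/andP; split; lra.
  - by apply/andP; split; nra.
  by have := Hs (t0 < 0) (t1 < 0) (t2 < 0); rewrite -!normrEsign ?num_real.
move=> [x0 x1 x2 xs]; split.
  by apply: (@rspan_tetragonal R a c); rewrite ?gt_eqF //;
    exact: primitive_sub_body_centered.
move=> _ /body_centered_tetragonalP[m [n [l [k ->]]]]; apply/key.
have norm_le (z : int) (t : R) : z%:~R * t <= `|z%:~R : R| * `|t|.
  by rewrite -normrM ler_norm.
have sq (z : int) : z%:~R ^+ 2 = `|z%:~R : R| ^+ 2.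
  by rewrite real_normK // num_real.
have even_le (z : int) (t : R) : `|t| <= 2 -> (2 %| z)%Z ->
    z%:~R * t <= z%:~R ^+ 2.
  move=> t2' /dvdzP[w ->]; apply: le_trans (norm_le _ _) _; rewrite sq.
  have [->|w0] := eqVneq w 0; first by rewrite mul0r normr0 mul0r expr0n.
  have : 2 <= `|(w * 2)%:~R : R| by rewrite -intr_norm (ler_int _ 2); lia.
  by move: (`|_|) (`|t|) t2' => p q; nra.
have odd_le (z : int) (t : R) : `|t| <= 2 -> z != 0 ->
    z%:~R * t <= z%:~R ^+ 2 + `|t| - 1.
  move=> t2' z0; have := norm_le z t; rewrite sq.
  have : 1 <= `|z%:~R : R| by rewrite -intr_norm ler1z; lia.
  by move: (`|_|) (`|t|) t2' => p q; nra.
(* The doubled coordinates all have the parity of [k]. Even ones satisfy the inequality one axis at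
   a time. Odd ones are nonzero and miss it by at most [|t| - 1] each, which the truncating
   inequality compensates. *)
have [k2|k2] := boolP (2 %| k)%Z.
  have ev (z : int) : (2 %| 2 * z + k)%Z by move: k2 => /dvdzP[q ->]; apply/dvdzP; exists (z + q); ring.
  by apply: lerD; [apply: lerD; exact: even_le|rewrite ler_pM2l //; exact: even_le].
have nz (z : int) : 2 * z + k != 0 by apply: contra k2 => /eqP e; lia.
have := odd_le _ _ x0 (nz m); have := odd_le _ _ x1 (nz n).
have := odd_le _ _ x2 (nz l); rewrite -(ler_pM2l rho0).
move: (_%:~R * t0) (_%:~R * t1) (_%:~R * t2) => u v w.
move: (_ ^+ 2) (_ ^+ 2) (_ ^+ 2) => p q r; lra.
Qed.

End TetragonalVoronoi.

(** * Shapes of tetragonal lattices and uniqueness of the side ratio *)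

Section TetragonalShapes.
Variables (R : realType) (V : lmodType R) (ip : V -> V -> R).
Implicit Types (a b c : R) (L : set V) (M : set 'rV[R]_3).

Section Isometry.
Variables (f : {linear V -> 'rV[R]_3}) (g : {linear 'rV[R]_3 -> V}).
Hypothesis gK : cancel g f.
Hypothesis ipg : forall v w, ip (g v) (g w) = dot3 v w.

Lemma rspan_image M x : rspan (g @` M) x <-> exists2 v, rspan M v & x = g v.
Proof.
split.
  move=> [n [c [v [vM ->]]]].
  exists (\sum_i c i *: f (v i)).
    by exists n, c, (fun i => f (v i)); split=> // i; case: (vM i) => w Mw <-;
      rewrite gK.
  rewrite linear_sum; apply: eq_bigr => i _; rewrite linearZ /=.
  by case: (vM i) => w _ <-; rewrite gK.
move=> [v [n [c [w [wM ->]]]] ->].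
exists n, c, (g \o w); split=> [i|]; first by exists (w i).
by rewrite linear_sum; apply: eq_bigr => i _; rewrite linearZ.
Qed.

Lemma same_shape_image M : same_shape ip (@dot3 R) (g @` M) M.
Proof.
exists f, 1; split=> [|x y /rspan_image[v _ ->] /rspan_image[w _ ->]|].
- exact: oner_neq0.
- by rewrite !gK ipg.
apply/seteqP; split=> [v Mv|_ [_ [v Mv <-] <-]]; last by rewrite gK scale1r.
by exists (g v); [exists v|rewrite gK scale1r].
Qed.

Lemma voronoi_cell_image M :
  same_combinatorial_type (voronoi_cell ip (g @` M)) (voronoi_cell (@dot3 R) M).
Proof.
apply: (same_combinatorial_type_linear (f := f) (g := g)).
- move=> _ [/rspan_image[v Mv ->] H]; rewrite gK; split=> // w Mw.
  by rewrite -!ipg linearB; apply: H; exists w.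
- move=> v [Mv H]; split; first by apply/rspan_image; exists v.
  by move=> _ [w Mw <-]; rewrite -linearB !ipg; exact: H.
- by move=> _ [/rspan_image[v _ ->] _]; rewrite gK.
- by move=> v _; rewrite gK.
Qed.

Lemma primitive_tetragonal_cell a c : 0 < a -> 0 < c ->
  same_combinatorial_type (voronoi_cell ip (g @` primitive_tetragonal a c))
    (@cuboid R).
Proof.
move=> a0 c0; apply: same_combinatorial_type_trans (voronoi_cell_image _) _.
have a2 : 2 / a != 0 by rewrite gt_eqF ?divr_gt0.
have c2 : 2 / c != 0 by rewrite gt_eqF ?divr_gt0.
have nrm b t : 0 < b -> (`|t| <= b / 2) = (`|2 / b * t| <= 1).
  move=> b0; rewrite normrM gtr0_norm ?divr_gt0 //.
  by rewrite mulrAC ler_pdivrMr // mul1r ler_pdivlMr // mulrC.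
apply: (same_combinatorial_type_linear
    (f := scale3 (2 / a) (2 / a) (2 / c))
    (g := scale3 (2 / a)^-1 (2 / a)^-1 (2 / c)^-1)).
- move=> x /voronoi_primitive -/(_ a0 c0)[].
  by rewrite !nrm // => *; apply: ord3P; rewrite row3E.
- move=> y Hy; apply/voronoi_primitive => //; rewrite !nrm // !row3E.
  by rewrite !mulVKf //; split; exact: Hy.
- by move=> x _; rewrite -[in RHS](@scale3K R (2 / a)^-1 (2 / a)^-1 (2 / c)^-1 x)
    ?invr_eq0 // !invrK.
- by move=> x _; exact: scale3K.
Qed.

Lemma body_centered_tetragonal_cell a c : 0 < c -> c <= a ->
  same_combinatorial_type (voronoi_cell ip (g @` body_centered_tetragonal a c))
    (@truncated_octahedron R).
Proof.
move=> c0 ca; have a0 : 0 < a := lt_le_trans c0 ca.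
apply: same_combinatorial_type_trans (voronoi_cell_image _) _.
have rho : 0 < (c / a) ^+ 2 <= 1.
  rewrite exprn_gt0 ?divr_gt0 //=; apply: exprn_ile1.
    by rewrite divr_ge0 // ltW.
  by rewrite ler_pdivrMr // mul1r.
apply: same_combinatorial_type_trans (bct_cell_truncated_octahedron rho).
have a4 : 4 / a != 0 by rewrite gt_eqF ?divr_gt0.
have c4 : 4 / c != 0 by rewrite gt_eqF ?divr_gt0.
have sK x : scale3 (4 / a)^-1 (4 / a)^-1 (4 / c)^-1
    (scale3 (4 / a) (4 / a) (4 / c) x) = x.
  by rewrite -[in RHS](@scale3K R (4 / a)^-1 (4 / a)^-1 (4 / c)^-1 x)
    ?invr_eq0 // !invrK.
apply: (same_combinatorial_type_linear
    (f := scale3 (4 / a) (4 / a) (4 / c))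
    (g := scale3 (4 / a)^-1 (4 / a)^-1 (4 / c)^-1)).
- by move=> x /voronoi_body_centered; exact.
- by move=> y Hy; apply/voronoi_body_centered => //; rewrite [scale3 _ _ _ _]scale3K.
- by move=> x _; exact: sK.
- by move=> x _; exact: scale3K.
Qed.

End Isometry.

(** Vectors of [M] and [M'] are compared through a common preimage in [L]. Pairs are transported,
    and not just single vectors, so that orthogonality can be compared as well as length. *)
Lemma same_shape_similar L M M' :
    same_shape ip (@dot3 R) L M -> same_shape ip (@dot3 R) L M' ->
  exists2 t : R, 0 < t &
    (forall v w, M v -> M w -> exists v' w', [/\ M' v', M' w',
       dot3 v v = t * dot3 v' v', dot3 w w = t * dot3 w' w' &
       dot3 v w = t * dot3 v' w']) /\
    (forall v w, M' v -> M' w -> exists v' w', [/\ M v', M w',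
       dot3 v' v' = t * dot3 v v, dot3 w' w' = t * dot3 w w &
       dot3 v' w' = t * dot3 v w]).
Proof.
have dotZ (s : R) (v w : 'rV[R]_3) : dot3 (s *: v) (s *: w) = s ^+ 2 * dot3 v w.
  by rewrite !dot3E !mxE; ring.
have LS x : L x -> rspan L x.
  move=> Lx; exists 1%N, (fun _ => 1), (fun _ => x).
  by rewrite big_ord1 scale1r.
move=> [f [s [s0 fip ->]]] [h [r [r0 hip ->]]].
exists ((s / r) ^+ 2); first by rewrite exprn_even_gt0 //= mulf_neq0 ?invr_eq0.
have E x y : L x -> L y -> dot3 (s *: f x) (s *: f y) =
    (s / r) ^+ 2 * dot3 (r *: h x) (r *: h y).
  move=> /LS Lx /LS Ly; rewrite !dotZ fip // hip // exprMn exprVn mulrA.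
  by rewrite mulfVK // expf_neq0.
split=> _ _ [x Lx <-] [y Ly <-].
  by exists (r *: h x), (r *: h y); split; try exact: E; [exists x|exists y].
by exists (s *: f x), (s *: f y); split; try exact: E; [exists x|exists y].
Qed.

(** If [c < a], all shortest vectors of the first lattice lie on one axis, whereas a cubic lattice
    has two orthogonal shortest vectors. *)
Lemma primitive_cubic_ratio L a c b : 0 < a -> 0 < c -> c <= a -> 0 < b ->
  same_shape ip (@dot3 R) L (primitive_tetragonal a c) ->
  same_shape ip (@dot3 R) L (primitive_tetragonal b b) -> c = a.
Proof.
move=> a0 c0 ca b0 shL shL'.
have [t t0 [toB toA]] := same_shape_similar shL shL'.
have sq0 (z : int) : 0 <= z%:~R ^+ 2 :> R by rewrite sqr_ge0.
have sq1 (z : int) : z != 0 -> 1 <= z%:~R ^+ 2 :> R.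
  by move=> z0; rewrite -rmorphXn /= ler1z; nia.
apply/eqP; rewrite eq_le ca /= leNgt; apply/negP => lt_ca.
have b2c : t * b ^+ 2 <= c ^+ 2.
  have Pc : primitive_tetragonal a c (row3 0 0 c).
    by apply/primitive_tetragonalP; exists 0, 0, 1; rewrite !mul0r mul1r.
  have [_ [_ [/primitive_tetragonalP[m [n [k ->]]] _ E _ _]]] := toB _ _ Pc Pc.
  move: E; rewrite !dot3E !row3E => E.
  have {E}E : c ^+ 2 = t * b ^+ 2 * (m ^+ 2 + n ^+ 2 + k ^+ 2)%:~R.
    by rewrite !rmorphD !rmorphXn /=; lra.
  rewrite E; apply: ler_peMr; first by rewrite mulr_ge0 ?sqr_ge0 ?ltW.
  rewrite ler1z.
  rewrite -gtz0_ge1 lt_neqAle !addr_ge0 ?sqr_ge0 // andbT.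
  apply: contraTneq (exprn_gt0 2 c0) => e.
  by rewrite E -e mulr0 ltxx.
have P1 : primitive_tetragonal b b (row3 b 0 0).
  by apply/primitive_tetragonalP; exists 1, 0, 0; rewrite !mul0r mul1r.
have P2 : primitive_tetragonal b b (row3 0 b 0).
  by apply/primitive_tetragonalP; exists 0, 1, 0; rewrite !mul0r mul1r.
have [_ [_ [/primitive_tetragonalP[m [n [k ->]]]
  /primitive_tetragonalP[m' [n' [k' ->]]] E E' E0]]] := toA _ _ P1 P2.
have axis (x y z : int) :
    (x%:~R * a) ^+ 2 + (y%:~R * a) ^+ 2 + (z%:~R * c) ^+ 2 = t * b ^+ 2 ->
    x = 0 /\ y = 0.
  have lt2 : c ^+ 2 < a ^+ 2 by rewrite ltr_pXn2r // nnegrE ltW.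
  move=> e; split; apply/eqP; apply/negP => /negP /sq1 x1.
    have := sq0 y; have := sq0 z; nra.
  have := sq0 x; have := sq0 z; nra.
have [e1 e2] : m = 0 /\ n = 0.
  by apply: (axis m n k); move: E; rewrite !dot3E !row3E; lra.
have [e1' e2'] : m' = 0 /\ n' = 0.
  by apply: (axis m' n' k'); move: E'; rewrite !dot3E !row3E; lra.
move: E E' E0; rewrite {}e1 {}e2 {}e1' {}e2' !dot3E !row3E.
rewrite !(mul0r, mulr0, add0r, addr0) => E E' /eqP.
have b20 : 0 < t * (b * b) by rewrite !mulr_gt0.
rewrite !mulf_eq0 (gt_eqF c0) !orbF => /orP[]/eqP e.
  by move: b20; rewrite -E e !mul0r ltxx.
by move: b20; rewrite -E' e !mul0r ltxx.
Qed.

(** In the unit [u], a quarter of the scaled squared side, the norms of the cubic lattice are sums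
    of three squares of equal parity, so nonzero ones are integers at least 3. Hence [c^2], [a^2]
    and [(2 a^2 + c^2) / 4] are multiples [j0], [j1], [j2] of [u], and the other lattice must also
    represent the cubic minimum [3 u]; no [j0 < j1] allows this. *)
Lemma body_centered_cubic_ratio L a c b : 0 < a -> 0 < c -> c <= a -> 0 < b ->
  same_shape ip (@dot3 R) L (body_centered_tetragonal a c) ->
  same_shape ip (@dot3 R) L (body_centered_tetragonal b b) -> c = a.
Proof.
move=> a0 c0 ca b0 shL shL'.
have [t t0 [toB toA]] := same_shape_similar shL shL'.
apply/eqP; rewrite eq_le ca /= leNgt; apply/negP => lt_ca.
have lt2 : c ^+ 2 < a ^+ 2 by rewrite ltr_pXn2r // nnegrE ltW.
have t'0 : 0 < t * b ^+ 2 / 4 by rewrite divr_gt0 // mulr_gt0 // exprn_gt0.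
pose u := t * b ^+ 2 / 4; rewrite -/u in t'0.
have norms v : body_centered_tetragonal a c v -> dot3 v v != 0 ->
    exists2 j : int, 3 <= j & dot3 v v = u * j%:~R.
  move=> Mv; have [_ [_ [/body_centered_tetragonalP[m [n [l [k ->]]]] _ E _ _]]]
    := toB _ _ Mv Mv; move: E; rewrite [in RHS]dot3E !row3E => E.
  set j : int := (2 * m + k) ^+ 2 + (2 * n + k) ^+ 2 + (2 * l + k) ^+ 2.
  have {}E : dot3 v v = u * j%:~R.
    by rewrite E /u /j !rmorphD !rmorphXn /=; field.
  rewrite E mulf_eq0 gt_eqF //= intr_eq0 => j0; exists j => //.
  move: j0; rewrite /j; have [kev|kodd] := boolP (2 %| k)%Z.
    case/dvdzP: kev => q ->.
    have -> : (2 * m + q * 2) ^+ 2 + (2 * n + q * 2) ^+ 2 + (2 * l + q * 2) ^+ 2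
      = 4 * ((m + q) ^+ 2 + (n + q) ^+ 2 + (l + q) ^+ 2) by ring.
    have := sqr_ge0 (m + q); have := sqr_ge0 (n + q); have := sqr_ge0 (l + q).
    by lia.
  have sq1 (z : int) : 1 <= (2 * z + k) ^+ 2.
    have : 2 * z + k != 0 by apply: contra kodd => /eqP ?; lia.
    by nia.
  by have := sq1 m; have := sq1 n; have := sq1 l; lia.
have nz (x : R) : 0 < x -> x != 0 by move=> /gt_eqF ->.
have [j0 j03 E0] : exists2 j : int, 3 <= j & c ^+ 2 = u * j%:~R.
  have := norms (row3 0 0 c); rewrite dot3E !row3E !mul0r !add0r -expr2.
  apply; last by rewrite nz ?exprn_gt0.
  apply/primitive_sub_body_centered/primitive_tetragonalP.
  by exists 0, 0, 1; rewrite !mul0r mul1r.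
have [j1 j13 E1] : exists2 j : int, 3 <= j & a ^+ 2 = u * j%:~R.
  have := norms (row3 a 0 0); rewrite dot3E !row3E !mul0r !addr0 -expr2.
  apply; last by rewrite nz ?exprn_gt0.
  apply/primitive_sub_body_centered/primitive_tetragonalP.
  by exists 1, 0, 0; rewrite !mul0r mul1r.
have [j2 j23 E2] : exists2 j : int, 3 <= j &
    (2 * a ^+ 2 + c ^+ 2) / 4 = u * j%:~R.
  have := norms (row3 (a / 2) (a / 2) (c / 2)); rewrite dot3E !row3E.
  have -> : a / 2 * (a / 2) + a / 2 * (a / 2) + c / 2 * (c / 2) =
    (2 * a ^+ 2 + c ^+ 2) / 4 by field.
  apply; last by rewrite nz // divr_gt0 // addr_gt0 ?mulr_gt0 ?exprn_gt0.
  by apply/body_centered_tetragonalP; exists 0, 0, 0, 1; rewrite !mulr0 !mul1r.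
have j01 : j0 < j1.
  by move: lt2; rewrite E0 E1 ltr_pM2l // ltr_int.
have jE : 2 * j1 + j0 = 4 * j2.
  apply/eqP; rewrite -(eqr_int R) !rmorphD !rmorphM /=; apply/eqP.
  by apply: (mulfI (nz _ t'0)); lra.
have P1 : body_centered_tetragonal b b (row3 (b / 2) (b / 2) (b / 2)).
  by apply/body_centered_tetragonalP; exists 0, 0, 0, 1; rewrite !mulr0 !mul1r.
have [_ [_ [/body_centered_tetragonalP[m [n [l [k ->]]]] _ E _ _]]] :=
  toA _ _ P1 P1.
move: E; rewrite !dot3E !row3E => E.
(* The equation for a vector of norm [3 u], multiplied by 4 to clear the half coordinates: hence the
   12. *)
have toint (x y z : int) : x%:~R * (a / 2) * (x%:~R * (a / 2)) +
    y%:~R * (a / 2) * (y%:~R * (a / 2)) + z%:~R * (c / 2) * (z%:~R * (c / 2)) =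
    t * (b / 2 * (b / 2) + b / 2 * (b / 2) + b / 2 * (b / 2)) ->
    j1 * (x ^+ 2 + y ^+ 2) + j0 * z ^+ 2 = 12.
  move=> e; apply/eqP; rewrite -(eqr_int R); apply/eqP.
  have -> : (j1 * (x ^+ 2 + y ^+ 2) + j0 * z ^+ 2)%:~R =
      j1%:~R * (x%:~R ^+ 2 + y%:~R ^+ 2) + j0%:~R * z%:~R ^+ 2 :> R.
    by rewrite rmorphD !rmorphM rmorphD !rmorphXn.
  apply: (mulfI (nz _ t'0)); rewrite mulrDr !mulrA -E0 -E1.
  have -> : u * 12%:~R = 4 * (t * (b / 2 * (b / 2) + b / 2 * (b / 2) +
    b / 2 * (b / 2))) by rewrite -[12%:~R]/(12 : R) /u; field.
  by rewrite -e; field.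
have {}E := toint _ _ _ E.
have [kev|kodd] := boolP (2 %| k)%Z.
  case/dvdzP: kev E => q ->.
  have -> : j1 * ((2 * m + q * 2) ^+ 2 + (2 * n + q * 2) ^+ 2) +
      j0 * (2 * l + q * 2) ^+ 2 = 4 * (j1 * ((m + q) ^+ 2 + (n + q) ^+ 2) +
      j0 * (l + q) ^+ 2) by ring.
  have := sqr_ge0 (m + q); have := sqr_ge0 (n + q); have := sqr_ge0 (l + q).
  move: (_ ^+ 2) (_ ^+ 2) (_ ^+ 2) => x y z x0 y0 z0 E.
  (* This forces [j0 = 3], which contradicts [2 * j1 + j0 = 4 * j2] modulo 2. *)
  have {}E : j1 * (x + y) + j0 * z = 3 by lia.
  have xy0 : x + y = 0 by clear -E x0 y0 z0 j03 j01; nia.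
  have z1 : z = 1 by clear -E z0 xy0 j03; nia.
  by rewrite xy0 z1 in E; lia.
have sq1 (z : int) : 1 <= (2 * z + k) ^+ 2.
  have : 2 * z + k != 0 by apply: contra kodd => /eqP ?; lia.
  by nia.
have := sq1 m; have := sq1 n; have := sq1 l; move: E.
move: (_ ^+ 2) (_ ^+ 2) (_ ^+ 2) => x y z E x1 y1 z1.
(* Then [j2 = 3] and [2 * j1 + j0 = 12], so [j0] is even and at least 4, and [j1 <= 4] contradicts
   [j0 < j1]. *)
have : 2 * j1 + j0 <= 12 by nia.
by lia.
Qed.

End TetragonalShapes.

(** * Integers and ideals *)

Section RingOfIntegers.
Variable K : splittingFieldType rat.
Implicit Types (E F : {subfield K}) (I J P Q : set K) (x y z : K).

Lemma integers_int E (n : int) : ring_of_integers E n%:~R.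
Proof.
by split; [exact: rpred_int|exact: (integral_id (intr : {rmorphism int -> K}))].
Qed.

Lemma integers_nat E (n : nat) : ring_of_integers E n%:R.
Proof. exact: (integers_int E n). Qed.

Lemma integersD E x y :
  ring_of_integers E x -> ring_of_integers E y -> ring_of_integers E (x + y).
Proof.
by move=> [xE xi] [yE yi]; split; [exact: rpredD|exact: integral_add].
Qed.

Lemma integersB E x y :
  ring_of_integers E x -> ring_of_integers E y -> ring_of_integers E (x - y).
Proof.
by move=> [xE xi] [yE yi]; split; [exact: rpredB|exact: integral_sub].
Qed.

Lemma integersM E x y :
  ring_of_integers E x -> ring_of_integers E y -> ring_of_integers E (x * y).
Proof.
by move=> [xE xi] [yE yi]; split; [exact: rpredM|exact: integral_mul].
Qed.

Lemma integersX E x n : ring_of_integers E x -> ring_of_integers E (x ^+ n).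
Proof.
move=> xE; elim: n => [|n IH]; first exact: (integers_int E 1).
by rewrite exprS; exact: integersM.
Qed.

Lemma integers_sum E (T : Type) (r : seq T) (P : pred T) (f : T -> K) :
  (forall i, P i -> ring_of_integers E (f i)) ->
  ring_of_integers E (\sum_(i <- r | P i) f i).
Proof.
by move=> H; apply: big_ind => //; [exact: (integers_int E 0)|exact: integersD].
Qed.

Lemma integersS E F x : (E <= F)%VS ->
  ring_of_integers E x -> ring_of_integers F x.
Proof. by move=> /subvP EF [xE xi]; split=> //; exact: EF. Qed.

Lemma integers_rmorph E (s : {rmorphism K -> K}) x :
  s x \in E -> ring_of_integers {:K}%AS x -> ring_of_integers E (s x).
Proof.
move=> sE [_ xi]; split=> //.
have [p mp px] := xi; exists p => //.
suff <- : map_poly (s \o intr) p = map_poly intr p :> {poly K}.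
  by rewrite map_poly_comp rmorph_root.
by apply: eq_map_poly => n /=; rewrite rmorph_int.
Qed.

Lemma intr_algE (n : int) : n%:~R = (n%:~R : rat)%:A :> K.
Proof. by rewrite -in_algE rmorph_int. Qed.

Lemma intr_splitting_inj : injective (intr : int -> K).
Proof.
move=> m n; rewrite !intr_algE -!in_algE => /fmorph_inj /eqP.
by rewrite eqr_int => /eqP.
Qed.

Lemma intr_splitting_eq0 (n : int) : (n%:~R == 0 :> K) = (n == 0).
Proof. by rewrite -(inj_eq intr_splitting_inj). Qed.

(** The monic equation is pulled back to [rat] and sent from there to [algC], where rational
    algebraic integers are integers. *)
Lemma integers_rat x : integralOver (intr : int -> K) x -> x \in 1%AS ->
  exists n : int, x = n%:~R.
Proof.
move=> [p mp px] /vlineP[q xE].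
have {}px : root (map_poly intr p) q.
  rewrite -(fmorph_root (in_alg K)) -map_poly_comp.
  suff <- : map_poly intr p = map_poly (in_alg K \o intr) p by rewrite /= -xE.
  by apply: eq_map_poly => n; rewrite /= intr_algE.
have : (ratr q : algC) \in Num.int.
  apply: Cint_rat_Aint; first exact: Crat_rat.
  apply: (@root_monic_Aint (map_poly intr p)).
  - rewrite -(fmorph_root (ratr : rat -> algC)) -map_poly_comp in px.
    by rewrite (eq_map_poly (g := intr)) // in px => n; rewrite /= ratr_int.
  - exact: monic_map.
  - by apply/polyOverP => i; rewrite coef_map intr_int.
move=> /intrP[n]; rewrite -(ratr_int _ n) => /fmorph_inj qE.
by exists n; rewrite xE qE -intr_algE.
Qed.

Lemma integers_galTrace E x : galois 1%AS E -> ring_of_integers E x ->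
  exists n : int, galTrace 1%AS E x = n%:~R.
Proof.
move=> gE [xE xi]; apply: integers_rat; last exact: mem_galTrace.
suff [] : ring_of_integers E (galTrace 1%AS E x) by [].
apply: integers_sum => g _; apply: integers_rmorph; first exact: memv_gal.
by split=> //; rewrite memvf.
Qed.

Lemma is_ideal_int E I : is_ideal E I -> I 0.
Proof. by case. Qed.

Lemma ideal_sum E I (T : Type) {r : seq T} (P : pred T) (f : T -> K) :
  is_ideal E I -> (forall i, P i -> I (f i)) -> I (\sum_(i <- r | P i) f i).
Proof. by move=> [_ I0 ID _] H; apply: big_ind. Qed.

Lemma idealN E I x : is_ideal E I -> I x -> I (- x).
Proof.
move=> [_ _ _ IM] Ix; rewrite -mulN1r; apply: IM => //.
exact: (integers_int E (- 1)).
Qed.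

Lemma idealB E I x y : is_ideal E I -> I x -> I y -> I (x - y).
Proof.
by move=> HI Ix Iy; have [_ _ ID _] := HI; apply: ID => //; exact: idealN HI Iy.
Qed.

Lemma ideal_coprime E I (m n : int) : is_ideal E I -> coprimez m n ->
  I m%:~R -> I n%:~R -> I 1.
Proof.
move=> HI /coprimezP[[u v] /= e] Im In; have [_ _ ID IM] := HI.
rewrite -[1]/(1%:~R) -e rmorphD !rmorphM /=.
by apply: ID; apply: IM => //; exact: integers_int.
Qed.

Lemma ideal_gen_incl E S : S `<=` ideal_gen E S.
Proof.
move=> x Sx; exists 1%N, (fun _ => 1), (fun _ => x).
by rewrite big_ord1 mul1r; split=> // _; split=> //; exact: (integers_int E 1).
Qed.

Lemma ideal_gen_sub E S I : is_ideal E I -> S `<=` I -> ideal_gen E S `<=` I.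
Proof.
move=> HI SI x [n [a [s [H ->]]]]; apply: (ideal_sum HI) => i _.
by have [_ _ _ IM] := HI; have [ai si] := H i; apply: IM => //; exact: SI.
Qed.

Lemma is_ideal_gen E S : S `<=` ring_of_integers E -> is_ideal E (ideal_gen E S).
Proof.
move=> SE; split.
- move=> x [n [a [s [H ->]]]]; apply: integers_sum => i _.
  by have [ai si] := H i; apply: integersM => //; exact: SE.
- by exists 0%N, (fun _ => 0), (fun _ => 0); rewrite big_ord0; split=> // -[].
- move=> x y [n [a [s [H ->]]]] [m [b [t [G ->]]]].
  pose join (f : 'I_n -> K) (g : 'I_m -> K) (i : 'I_(n + m)) :=
    match fintype.split i with inl i => f i | inr i => g i end.
  exists (n + m)%N, (join a b), (join s t); split=> [i|].
    by rewrite /join; case: (fintype.split i).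
  rewrite big_split_ord /=; congr (_ + _); apply: eq_bigr => i _.
    by rewrite /join -[lshift m i]/(unsplit (inl i)) unsplitK.
  by rewrite /join -[rshift n i]/(unsplit (inr i)) unsplitK.
- move=> c x cE [n [a [s [H ->]]]].
  exists n, (fun i => c * a i), s; split=> [i|].
    by have [ai si] := H i; split=> //; exact: integersM.
  by rewrite mulr_sumr; apply: eq_bigr => i _; rewrite mulrA.
Qed.

Lemma ideal_mul_ideal E I J : is_ideal E I -> is_ideal E J ->
  is_ideal E (ideal_mul E I J).
Proof.
move=> [IE _ _ _] [JE _ _ _]; apply: is_ideal_gen => _ [x [y [Ix Jy ->]]].
by apply: integersM; [exact: IE|exact: JE].
Qed.

Lemma ideal_mul_incl E I J x y : I x -> J y -> ideal_mul E I J (x * y).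
Proof. by move=> Ix Jy; apply: ideal_gen_incl; exists x, y. Qed.

Lemma prime_ideal_pow E P x n : prime_ideal E P -> ring_of_integers E x ->
  P (x ^+ n) -> P x.
Proof.
move=> [_ P1 PM] xE; elim: n => [/P1 //|n IH]; rewrite exprS.
by move=> /(PM _ _ xE (integersX n xE))[].
Qed.

Lemma prime_ideal_restrict E F P : (E <= F)%VS -> prime_ideal F P ->
  prime_ideal E (P `&` ring_of_integers E).
Proof.
move=> EF [[PF P0 PD PM] P1 PP]; split.
- split=> [x []//||x y [Px xE] [Py yE]|a x aE [Px xE]].
  + by split=> //; exact: (integers_int E 0).
  + by split; [exact: PD|exact: integersD].
  + by split; [apply: PM => //; exact: integersS aE|exact: integersM].
- by case.
- move=> x y xE yE [/PP]; case/(_ (integersS EF xE) (integersS EF yE)) => ? _.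
    by left.
  by right.
Qed.

(** Zorn's lemma gives an ideal [P] maximal among those that contain [I] but not 1. If [x] and [y]
    are outside [P], then 1 lies in [P + (x)] and in [P + (y)]; multiplying the two expressions puts
    1 in [P] as soon as [x * y] is there. *)
Lemma exists_prime_ideal E I : is_ideal E I -> ~ I 1 ->
  exists2 P, prime_ideal E P & I `<=` P.
Proof.
move=> HI I1.
pose good (J : set K) := J = set0 \/ [/\ is_ideal E J, I `<=` J & ~ J 1].
have [|P [[P0|[HP IP P1]] maxP]] := @Zorn_bigcup K good.
- move=> C Cgood Ctot.
  have [[J CJ [x Jx]]|none] := pselect (exists2 J, C J & exists x, J x);
    last first.
    left; apply/seteqP; split=> // x [J CJ Jx]; case: none; exists J => //.
    by exists x.
  have gd M : C M -> forall z, M z -> [/\ is_ideal E M, I `<=` M & ~ M 1].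
    by move=> CM z Mz; case: (Cgood M CM) => // M0; move: Mz; rewrite M0.
  have [HJ IJ J1] := gd J CJ x Jx.
  right; split.
  + split.
    * by move=> y [M CM My]; have [[ME _ _ _] _ _] := gd M CM y My; exact: ME.
    * by exists J => //; exact: is_ideal_int HJ.
    * move=> y z [M CM My] [N CN Nz].
      have [[_ _ MD _] _ _] := gd M CM y My; have [[_ _ ND _] _ _] := gd N CN z Nz.
      have [MN|NM] := Ctot _ _ CM CN.
        by exists N => //; apply: ND => //; exact: MN.
      by exists M => //; apply: MD => //; exact: NM.
    * move=> a y aE [M CM My]; have [[_ _ _ MM] _ _] := gd M CM y My.
      by exists M => //; exact: MM.
  + by move=> y Iy; exists J => //; exact: IJ.
  + by move=> [M CM M1]; have [_ _] := gd M CM 1 M1.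
- exfalso; apply: (maxP I); last by right; split.
  by rewrite P0; split=> // /(_ 0 (is_ideal_int HI)).
- exists P => //; split=> // x y xE yE Pxy.
  apply: contrapT => /not_orP[nPx nPy].
  have [PE P0 PD PM] := HP.
  pose adjoin z := [set w | exists a b, [/\ P a, ring_of_integers E b & w = a + b * z]].
  have adj z : ring_of_integers E z -> ~ P z -> adjoin z 1.
    move=> zE nPz; apply: contrapT => n1; apply: (maxP (adjoin z)).
      split=> [w Pw|sub].
        exists w, 0; rewrite mul0r addr0; split=> //; exact: (integers_int E 0).
      apply/nPz/sub; exists 0, 1; rewrite mul1r add0r; split=> //.
      exact: (integers_int E 1).
    right; split=> // [|w Iw].
    + split.
      * move=> _ [a [b [Pa bE ->]]]; apply: integersD; first exact: PE.
        exact: integersM.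
      * exists 0, 0; rewrite mul0r addr0; split=> //; exact: (integers_int E 0).
      * move=> _ _ [a [b [Pa bE ->]]] [a' [b' [Pa' bE' ->]]].
        exists (a + a'), (b + b'); split; [exact: PD|exact: integersD|ring].
      * move=> c _ cE [a [b [Pa bE ->]]].
        exists (c * a), (c * b); split; [exact: PM|exact: integersM|ring].
    + exists w, 0; rewrite mul0r addr0; split=> //; last exact: (integers_int E 0).
      exact: IP.
  have [a [b [Pa bE e]]] := adj x xE nPx.
  have [a' [b' [Pa' bE' e']]] := adj y yE nPy.
  apply: P1; rewrite -[1]mulr1 {1}e e'.
  have -> : (a + b * x) * (a' + b' * y) =
    (a' + b' * y) * a + ((b * x) * a' + (b * b') * (x * y)) by ring.
  apply: (PD); last apply: (PD); apply: (PM) => //.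
  + by rewrite -e'; exact: (integers_int E 1).
  + exact: integersM.
  + exact: integersM.
Qed.

End RingOfIntegers.

(** * Gram matrices and ramification *)

(** Two integral bases give determinants that are square multiples of each other; this makes [disc]
    independent of the basis. *)
Lemma mutual_square_multiples (d d' m m' : int) :
  d' = m ^+ 2 * d -> d = m' ^+ 2 * d' -> d' = d.
Proof.
move=> e1 e2; have [d0|d0] := eqVneq d 0; first by rewrite e1 d0 mulr0.
have : (m * m') ^+ 2 = 1 by apply: (mulIf d0); rewrite mul1r [RHS]e2 e1; ring.
move/eqP; rewrite sqrf_eq1 => mm'.
have /eqP : absz (m * m') = 1%N by case/orP: mm' => /eqP ->.
rewrite abszM muln_eq1 => /andP[/eqP m1 _].
have [mE|mE] : m = 1 \/ m = - 1 by lia.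
  by rewrite e1 mE expr1n mul1r.
by rewrite e1 mE sqrrN expr1n mul1r.
Qed.

Section GramMatrices.
Variable K : splittingFieldType rat.
Implicit Types (E F : {subfield K}) (I J P Q : set K) (x y z : K).

Definition gram E (b : (\dim E).-tuple K) : 'M[K]_(\dim E) :=
  \matrix_(i, j) galTrace 1%AS E (tnth b i * tnth b j).

Lemma gram_int E (b : (\dim E).-tuple K) : galois 1%AS E -> integral_basis b ->
  exists M : 'M[int]_(\dim E), gram b = map_mx intr M.
Proof.
move=> gE [_ bE _].
have H i j : exists n : int, galTrace 1%AS E (tnth b i * tnth b j) = n%:~R.
  by apply: integers_galTrace => //; apply: integersM.
have /choice[f Hf] := fun ij => H ij.1 ij.2.
exists (\matrix_(i, j) f (i, j)); apply/matrixP => i j.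
by rewrite !mxE (Hf (i, j)).
Qed.

Lemma galTrace_lin_int E (n : int) x :
  galTrace 1%AS E (n%:~R * x) = n%:~R * galTrace 1%AS E x.
Proof. by rewrite mulrzl raddfMz mulrzl. Qed.

Lemma gram_change E (c c' : (\dim E).-tuple K) (N : 'M[int]_(\dim E)) :
    (forall i, tnth c' i = \sum_j (N i j)%:~R * tnth c j) ->
  \det (gram c') = (\det N)%:~R ^+ 2 * \det (gram c).
Proof.
move=> HN; rewrite -det_map_mx.
have -> : gram c' = map_mx intr N *m gram c *m (map_mx intr N)^T.
  apply/matrixP => i j; rewrite !mxE HN HN mulr_suml raddf_sum /=.
  under [RHS]eq_bigr => k _ do rewrite !mxE.
  under [RHS]eq_bigr => k _ do rewrite mulr_suml.
  rewrite [RHS]exchange_big /=; apply: eq_bigr => k _.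
  rewrite mulr_sumr raddf_sum /=; apply: eq_bigr => l _.
  by rewrite !mxE mulrACA -rmorphM /= galTrace_lin_int rmorphM /= mulrAC.
by rewrite !det_mulmx det_tr mulrAC expr2.
Qed.

Lemma disc_eq E (b : (\dim E).-tuple K) (d : int) : galois 1%AS E ->
  integral_basis b -> d%:~R = \det (gram b) -> disc E = d.
Proof.
move=> gE Hb Hd; rewrite /disc; case: xgetP => [d' d'E [b' Hb' Hd']|H].
  have [[_ bE bS] [_ bE' bS']] := (Hb, Hb').
  have coords (c c' : (\dim E).-tuple K) : integral_basis c -> integral_basis c' ->
      exists M : 'M[int]_(\dim E),
        forall i, tnth c' i = \sum_j (M i j)%:~R * tnth c j.
    move=> [_ _ cS] [_ cE' _].
    have /choice[f Hf] := fun i => cS _ (cE' i).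
    by exists (\matrix_(i, j) f i j) => i; rewrite Hf; apply: eq_bigr => j _; rewrite mxE.
  have [M HM] := coords _ _ Hb Hb'; have [M' HM'] := coords _ _ Hb' Hb.
  have e1 : d' = \det M ^+ 2 * d.
    apply: (@intr_splitting_inj K); rewrite rmorphM rmorphXn /= Hd.
    by rewrite Hd' -(gram_change HM).
  have e2 : d = \det M' ^+ 2 * d'.
    apply: (@intr_splitting_inj K); rewrite rmorphM rmorphXn /= Hd'.
    by rewrite Hd -(gram_change HM').
  exact: mutual_square_multiples e1 e2.
by case: (H d); exists b.
Qed.

Section PrimeToDiscriminant.
Variables (E : {subfield K}) (b : (\dim E).-tuple K) (d : int) (p : nat).
Hypotheses (galE : galois 1%AS E) (Eb : integral_basis b).
Hypotheses (dE : d%:~R = \det (gram b)) (p_pr : prime p).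
Hypothesis pd : coprimez p d.

Lemma dvd_of_trace y : ring_of_integers E y ->
    (forall z, ring_of_integers E z ->
      exists t : int, galTrace 1%AS E (y * z) = (p%:Z * t)%:~R) ->
  exists2 w, ring_of_integers E w & y = p%:R * w.
Proof.
move=> yE Hy; have [_ bE bS] := Eb; have [M ME] := gram_int galE Eb.
have [c yc] := bS y yE.
have /choice[t Ht] := fun i => Hy _ (bE i).
pose cv := \row_i c i; pose tv := \row_i t i.
have cM : cv *m M = p%:Z *: tv.
  apply/rowP => j; apply: (@intr_splitting_inj K).
  rewrite !mxE -Ht rmorph_sum yc mulr_suml raddf_sum /=; apply: eq_bigr => i _.
  rewrite !mxE rmorphM /= -mulrA galTrace_lin_int; congr (_ * _).
  by move/matrixP: ME => /(_ i j); rewrite !mxE => ->.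
have detM : \det M = d.
  by apply: (@intr_splitting_inj K); rewrite dE ME -det_map_mx.
have cd : d *: cv = p%:Z *: (tv *m \adj M).
  by rewrite scalemxAl -cM -mulmxA mul_mx_adj mul_mx_scalar detM.
have pc i : (p%:Z %| c i)%Z.
  have : (p%:Z %| d * c i)%Z.
    by move/rowP: cd => /(_ i); rewrite !mxE => ->; rewrite dvdz_mulr.
  by rewrite Gauss_dvdzr.
exists (\sum_i (c i %/ p%:Z)%Z%:~R * tnth b i).
  by apply: integers_sum => i _; apply: integersM => //; exact: integers_int.
rewrite yc mulr_sumr; apply: eq_bigr => i _; rewrite mulrA; congr (_ * _).
by rewrite -[p%:R]/(p%:Z%:~R) -rmorphM /= mulrC divzK.
Qed.

Variable Q : set K.
Hypotheses (primeQ : prime_ideal E Q) (Qp : Q p%:R).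

Lemma prime_ideal_int (n : int) : Q n%:~R -> (p%:Z %| n)%Z.
Proof.
move=> Qn; apply: contrapT => /negP pn; case: primeQ => HQ Q1 _; apply: Q1.
apply: (ideal_coprime (m := p%:Z) (n := n) HQ) => //.
by rewrite /coprimez -[gcdz _ _]/((gcdn `|p%:Z| `|n|)%:Z) eqz_nat -/(coprime _ _) prime_coprime.
Qed.

(* The trace of a nilpotent of O_E / p O_E vanishes. *)
Lemma reduced_mod_prime y m : ring_of_integers E y ->
    (exists2 w, ring_of_integers E w & y ^+ m = p%:R * w) ->
  exists2 w, ring_of_integers E w & y = p%:R * w.
Proof.
move=> yE [w wE yw]; apply: dvd_of_trace => // z zE.
have [t Ht] : exists t : int, galTrace 1%AS E (y * z) = t%:~R.
  by apply: integers_galTrace => //; exact: integersM.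
rewrite Ht; suff /dvdzP[u ->] : (p%:Z %| t)%Z by exists u; rewrite mulrC.
have [HQ _ _] := primeQ.
apply: prime_ideal_int; rewrite -Ht /galTrace; apply: (ideal_sum HQ) => g _.
have gint (x : K) : ring_of_integers E x -> ring_of_integers E (g x).
  move=> [xE xi]; apply: integers_rmorph; first exact: memv_gal.
  by split=> //; rewrite memvf.
apply: (prime_ideal_pow (n := m) primeQ); first exact/gint/integersM.
have -> : g (y * z) ^+ m = (g w * g z ^+ m) * p%:R.
  by rewrite -rmorphXn exprMn yw !rmorphM rmorphXn rmorph_nat /=; ring.
have [_ _ _ QM] := HQ; apply: QM => //.
by apply: integersM; [exact: gint|apply/integersX/gint].
Qed.

(** Pigeonhole on the coordinates modulo [p]. The gap of the exponents is written [n.+1] because a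
    positive power of an element of an ideal is needed next. *)
Lemma powers_collide x : ring_of_integers E x ->
  exists m n : nat, exists2 w, ring_of_integers E w &
    x ^+ m - x ^+ (m + n.+1) = p%:R * w.
Proof.
move=> xE; have [_ bE bS] := Eb.
have /choice[c Hc] := fun k => bS _ (integersX k xE).
have p0 : (0 < p)%N := prime_gt0 p_pr.
have ltp (z : int) : (`|(z %% p%:Z)%Z| < p)%N.
  have := ltz_pmod z (p0 : 0 < p%:Z); have := modz_ge0 z (lt0r_neq0 (p0 : 0 < p%:Z)).
  by lia.
pose T := {ffun 'I_(\dim E) -> 'I_p}.
pose h (k : 'I_#|T|.+1) : T := [ffun i => Ordinal (ltp (c k i))].
have [k [l [kl hkl]]] : exists k l : 'I_#|T|.+1, (k < l)%N /\ h k = h l.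
  have /injectivePn[k [l kl hkl]] : ~~ injectiveb h.
    apply/negP => /injectiveP /leq_card; rewrite card_ord ltnn //.
  have [lt|lt|e] := ltngtP k l; last by case/eqP: kl; exact: val_inj.
    by exists k, l.
  by exists l, k.
have pdv i : (p%:Z %| c k i - c l i)%Z.
  have := congr1 (fun f : T => val (f i)) hkl; rewrite !ffunE /= => e.
  rewrite -eqz_mod_dvd; apply/eqP.
  have m0 (z : int) : (0 <= z %% p%:Z)%Z by apply: modz_ge0; lia.
  by have := m0 (c k i); have := m0 (c l i); lia.
exists k, (l - k.+1)%N.
exists (\sum_i ((c k i - c l i) %/ p%:Z)%Z%:~R * tnth b i).
  by apply: integers_sum => i _; apply: integersM => //; exact: integers_int.
have -> : (k + (l - k.+1).+1)%N = l by lia.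
rewrite !Hc -sumrB mulr_sumr; apply: eq_bigr => i _.
rewrite mulrA -[p%:R]/(p%:Z%:~R) -rmorphM /= [p%:Z * _]mulrC divzK //.
by rewrite rmorphB /= mulrBl.
Qed.

(* Modulo p the ring O_E is finite and reduced, so [q] is killed by [1 - e]
   for some power [e] of [q]. *)
Lemma unramified_unit q : Q q -> exists2 e, Q e &
  exists2 w, ring_of_integers E w & q * (1 - e) = p%:R * w.
Proof.
move=> Qq; have [[QE _ _ QM] _ _] := primeQ; have qE := QE _ Qq.
have [m [n [w wE Hw]]] := powers_collide qE.
have eE : ring_of_integers E (1 - q ^+ n.+1).
  by apply: integersB; [exact: (integers_int E 1)|exact: integersX].
exists (q ^+ n.+1); first by rewrite exprSr; apply: QM => //; exact: integersX.
(* Since [p] divides [q^m (1 - e)], it divides the power [m.+1] of [q (1 - e)]. *)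
apply: (@reduced_mod_prime _ m.+1); first exact: integersM.
exists (w * (q * (1 - q ^+ n.+1) ^+ m)).
  by apply: integersM => //; apply: integersM => //; exact: integersX.
rewrite mulrA -Hw exprMn exprS exprS exprD; ring.
Qed.

(** Suppose [p] is the sum of [a_i x_i y_i] with [x_i] and [y_i] in [Q]. Some [1 - e_i], with [e_i]
    in [Q], makes [a_i x_i] divisible by [p]; let [u] be the product of these factors. Dividing the
    equation for [p u] by [p] writes [u] as a combination of the [y_i], so [u] is in [Q] although it
    is 1 modulo [Q]. *)
Lemma unramified_not_square : ~ ideal_mul E Q Q p%:R.
Proof.
move=> [n [a [s [H pE]]]]; have [HQ Q1 _] := primeQ.
have [QE Q0 QD QM] := HQ.
have /choice[xy Hxy] : forall i, exists xy : K * K,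
    [/\ Q xy.1, Q xy.2 & s i = xy.1 * xy.2].
  by move=> i; have [_ [x [y [Qx Qy ->]]]] := H i; exists (x, y).
have Qq i : Q (a i * (xy i).1).
  by have [ai _] := H i; have [Qx _ _] := Hxy i; exact: QM.
have /choice[e He] : forall i, exists e, Q e /\
    exists2 w, ring_of_integers E w & (a i * (xy i).1) * (1 - e) = p%:R * w.
  by move=> i; have [e Qe Hw] := unramified_unit (Qq i); exists e.
pose u := \prod_i (1 - e i).
have one_e i : ring_of_integers E (1 - e i).
  by apply: integersB; [exact: (integers_int E 1)|apply/QE; case: (He i)].
have Qu : Q (1 - u).
  suff [] : ring_of_integers E u /\ Q (1 - u) by [].
  apply: (big_ind (fun v => ring_of_integers E v /\ Q (1 - v))) => //.
  + by split; [exact: (integers_int E 1)|rewrite subrr].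
  + move=> v w [vE Qv] [wE Qw]; split; first exact: integersM.
    have -> : 1 - v * w = (1 - w) + w * (1 - v) by ring.
    by apply: QD => //; exact: QM.
  + by move=> i _; split=> //; rewrite opprB addrC subrK; case: (He i).
have uq i : exists2 w, ring_of_integers E w & a i * (xy i).1 * u = p%:R * w.
  have [_ [w wE Hw]] := He i.
  exists (w * \prod_(j | j != i) (1 - e j)); last first.
    by rewrite /u (bigD1 i) //= [RHS]mulrA -Hw -[RHS]mulrA.
  apply: integersM => //; apply: (big_ind (ring_of_integers E)) => //.
  + exact: (integers_int E 1).
  + by move=> ? ? ? ?; exact: integersM.
have /choice[w Hw] : forall i, exists w, ring_of_integers E w /\
    a i * (xy i).1 * u = p%:R * w by move=> i; have [w] := uq i; exists w.
have p0 : p%:R != 0 :> K.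
  by rewrite -[p%:R]/(p%:Z%:~R) intr_splitting_eq0 eqz_nat -lt0n prime_gt0.
have uE : u = \sum_i w i * (xy i).2.
  apply: (mulfI p0); rewrite {1}pE mulr_suml mulr_sumr; apply: eq_bigr => i _.
  have [_ _ ->] := Hxy i; have [_ e'] := Hw i.
  by rewrite mulrA [RHS]mulrA -e'; ring.
apply: Q1; rewrite -[1](subrK u); apply: QD => //.
rewrite uE; apply: (ideal_sum HQ) => i _; apply: QM; first by case: (Hw i).
by case: (Hxy i).
Qed.

End PrimeToDiscriminant.

Lemma ideal_mul_sub E Q : prime_ideal E Q -> ideal_mul E Q Q `<=` Q.
Proof.
move=> [HQ _ _]; have [QE _ _ QM] := HQ.
by apply: (ideal_gen_sub HQ) => _ [x [y [Qx Qy ->]]]; apply: QM => //; exact: QE.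
Qed.

Lemma ramifies_square_mem F E p : ramifies F E p ->
  exists2 Q, prime_ideal E Q & ideal_mul E Q Q p%:R.
Proof.
by move=> [P [_ Pp [Q HQ PQ]]]; exists Q => //; apply/PQ/ideal_gen_incl.
Qed.

Lemma unramified_disc E (b : (\dim E).-tuple K) (d : int) (p : nat) :
  galois 1%AS E -> integral_basis b -> d%:~R = \det (gram b) -> prime p ->
  coprimez p d -> ~ ramifies 1%AS E p.
Proof.
move=> gE Hb Hd pp pd /ramifies_square_mem[Q HQ Qp].
by apply: (unramified_not_square gE Hb Hd pp pd HQ) => //; exact: ideal_mul_sub Qp.
Qed.

(** The rational integers in [Q] are the multiples of [p], so the prime below [Q] is generated by
    [p], and [p] is the only element to test. *)
Lemma square_mem_ramifies E Q (p : nat) : prime p -> prime_ideal E Q ->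
  ideal_mul E Q Q p%:R -> ramifies 1%AS E p.
Proof.
move=> pp HQ QQp; have Qp := ideal_mul_sub HQ QQp.
exists (Q `&` ring_of_integers 1%AS); split.
- exact: prime_ideal_restrict (sub1v _) HQ.
- by split=> //; exact: integers_nat.
exists Q => //; have [HQi _ _] := HQ.
have HQQ := ideal_mul_ideal HQi HQi.
apply: (ideal_gen_sub HQQ) => x [Qx [x1 xi]].
have [n xE] := integers_rat xi x1; rewrite xE in Qx *.
have /dvdzP[m ->] := prime_ideal_int pp HQ Qp Qx.
rewrite rmorphM /=; have [_ _ _ QM] := HQQ; apply: QM => //.
exact: integers_int.
Qed.

Lemma ramifies_trans F E (p : nat) : prime p -> ramifies F E p -> ramifies 1%AS E p.
Proof. by move=> pp /ramifies_square_mem[Q HQ]; exact: square_mem_ramifies. Qed.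

(* [p] being unramified in [F], [P = P^2 + p O_F] for the prime [P] of [F]
   below [Q]. *)
Lemma square_mem_ramifies_rel F E (b : (\dim F).-tuple K) (d : int) Q (p : nat) :
  (F <= E)%VS -> galois 1%AS F -> integral_basis b -> d%:~R = \det (gram b) ->
  prime p -> coprimez p d -> prime_ideal E Q -> ideal_mul E Q Q p%:R ->
  ramifies F E p.
Proof.
move=> FE gF Hb Hd pp pd HQ QQp; have Qp := ideal_mul_sub HQ QQp.
have HP := prime_ideal_restrict FE HQ.
exists (Q `&` ring_of_integers F); split=> //.
  by split=> //; exact: integers_nat.
exists Q => //; have [HQi _ _] := HQ.
have HQQ := ideal_mul_ideal HQi HQi; have [_ _ QQD QQM] := HQQ.
apply: (ideal_gen_sub HQQ) => x Px.
have [|e [Qe eF] [w wF ew]] := unramified_unit gF Hb Hd pp pd HP _ Px.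
  by split=> //; exact: integers_nat.
have -> : x = x * e + w * p%:R by rewrite [w * _]mulrC -ew; ring.
apply: QQD; first by apply: ideal_mul_incl => //; case: Px.
by apply: QQM => //; exact: integersS wF.
Qed.

End GramMatrices.

Section AbsNorm.
Variable K : splittingFieldType rat.

(* The cosets are represented by [i + j w] with [0 <= i < M], [0 <= j < m]. *)
Lemma absnorm_lattice (E : {subfield K}) (I : set K) (w : K) (M m : nat) :
    (0 < M)%N -> (0 < m)%N ->
    (forall x, ring_of_integers E x <-> exists u v : int, x = u%:~R + v%:~R * w) ->
    (forall u v : int, u%:~R + v%:~R * w = 0 -> u = 0 /\ v = 0) ->
    (forall x, I x <-> exists u v : int, x = (M%:Z * u)%:~R + (m%:Z * v)%:~R * w) ->
  absnorm E I = (M * m)%N.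
Proof.
move=> M0 m0 OE free IE.
have I_dvd (u v : int) : I (u%:~R + v%:~R * w) <-> (M%:Z %| u)%Z /\ (m%:Z %| v)%Z.
  rewrite IE; split=> [[u' [v' e]]|[/dvdzP[u' ->] /dvdzP[v' ->]]].
    have [] := free (u - M%:Z * u') (v - m%:Z * v').
      by rewrite !rmorphB /= mulrBl addrACA -opprD e subrr.
    by move=> /subr0_eq -> /subr0_eq ->; rewrite !dvdz_mulr.
  by exists u', v'; rewrite ![_ * _%:Z]mulrC.
have IB x y : I x -> I y -> I (x - y).
  move=> /IE[u [v ->]] /IE[u' [v' ->]]; apply/IE; exists (u - u'), (v - v').
  by rewrite !mulrBr !rmorphB /=; ring.
pose coset x : set K := [set y | I (y - x)].
have coset_eq x y : I (x - y) -> coset x = coset y.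
  move=> xy; apply/seteqP; split=> z; rewrite /coset /= => zx.
    have -> : z - y = (z - x) - (0 - (x - y)) by ring.
    by apply: (IB) => //; apply: (IB) => //; rewrite -(subrr (x - y)); exact: IB.
  have -> : z - x = (z - y) - (x - y) by ring.
  exact: IB.
have I0 : I 0 by apply/IE; exists 0, 0; rewrite !mulr0 mul0r addr0.
pose F (t : 'I_M * 'I_m) := coset ((t.1 : nat)%:Z%:~R + (t.2 : nat)%:Z%:~R * w).
have Finj : injective F.
  move=> [i j] [i' j'] /seteqP[/(_ ((i : nat)%:Z%:~R + (j : nat)%:Z%:~R * w)) + _].
  rewrite /F /coset /= subrr => /(_ I0).
  have -> : (i : nat)%:Z%:~R + (j : nat)%:Z%:~R * w -
      ((i' : nat)%:Z%:~R + (j' : nat)%:Z%:~R * w) =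
      ((i : nat)%:Z - (i' : nat)%:Z)%:~R + ((j : nat)%:Z - (j' : nat)%:Z)%:~R * w.
    by rewrite !rmorphB /=; ring.
  move=> /I_dvd[]; rewrite -!eqz_mod_dvd !modz_small ?lez_nat ?ltz_nat ?ltn_ord //.
  by move=> /eqP[ii] /eqP[jj]; congr (_, _); exact: val_inj.
rewrite /absnorm; set S := (X in fset_set X).
have -> : S =
    [set` [fset F t | t in [set: 'I_M * 'I_m]%SET]%fset].
  rewrite /S; apply/seteqP; split=> [_ [x /OE[u [v ->]] <-]|X /= /imfsetP[[i j] _ ->]].
    have ltm (z : int) (q : nat) : (0 < q)%N -> (`|(z %% q%:Z)%Z| < q)%N.
      move=> q0; have := ltz_pmod z (q0 : 0 < q%:Z).
      by have := modz_ge0 z (lt0r_neq0 (q0 : 0 < q%:Z)); lia.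
    apply/imfsetP; exists (Ordinal (ltm u M M0), Ordinal (ltm v m m0)).
      by rewrite inE.
    apply: coset_eq => /=.
    rewrite !gez0_abs ?modz_ge0 ?lt0r_neq0 //.
    have -> : u%:~R + v%:~R * w - ((u %% M)%Z%:~R + (v %% m)%Z%:~R * w) =
        (u - (u %% M)%Z)%:~R + (v - (v %% m)%Z)%:~R * w.
      by rewrite !rmorphB /=; ring.
    by apply/I_dvd; rewrite -!eqz_mod_dvd !modz_mod.
  by exists ((i : nat)%:Z%:~R + (j : nat)%:Z%:~R * w) => //; apply/OE; exists i, j.
rewrite set_fsetK card_imfset //= -cardE cardsT card_prod !card_ord //.
Qed.

End AbsNorm.

(** * The cyclic quartic field and its ring of integers *)

(** Presents the Galois group as a single ring morphism [s] with explicit traces, so that later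
    identities are computations with iterates of [s]. *)
Record quartic_generator (K : splittingFieldType rat) (K2 : {subfield K})
    (s : {rmorphism K -> K}) : Prop := QuarticGenerator {
  gen_galois : galois 1%AS {:K}%AS;
  gen_dim : \dim {:K} = 4%N;
  gen_galois2 : galois 1%AS K2;
  gen_dim2 : \dim K2 = 2%N;
  gen_order : forall x, s (s (s (s x))) = x;
  gen_fix : forall x, s x = x -> x \in 1%AS;
  gen_fix2 : forall x, (x \in K2) = (s (s x) == x);
  gen_trace : forall x,
    galTrace 1%AS {:K}%AS x = x + s x + s (s x) + s (s (s x));
  gen_trace2 : forall x, x \in K2 -> galTrace 1%AS K2 x = x + s x;
  gen_trace_rel : forall x, galTrace K2 {:K}%AS x = x + s (s x) }.

Lemma big_cycle (gT : finGroupType) (R : nmodType) (g : gT) (F : gT -> R) :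
  \sum_(x in <[g]>%g) F x = \sum_(i < #[g]%g) F (g ^+ i)%g.
Proof.
rewrite (eq_bigl (mem (traject (mul g) 1%g #[g]%g))); last exact: cycle_traject.
rewrite -big_uniq; last first.
  apply/card_uniqP; rewrite size_traject -(eq_card (cycle_traject g)) //.
rewrite (big_nth 1%g) size_traject big_mkord; apply: eq_bigr => i _.
rewrite nth_traject //; congr F; elim: (i : nat) => //= n ->.
by rewrite expgS.
Qed.

Lemma exists_quartic_generator (K : splittingFieldType rat) (K2 : {subfield K}) :
  C4_quartic K -> \dim K2 = 2%N -> exists s, quartic_generator K2 s.
Proof.
move=> [dimK galK cycK] dimK2.
have galK2 : galois K2 {:K} by apply: galoisS galK; rewrite sub1v subvf.
have cardG : #|'Gal({:K} / 1%AS)%g| = 4%N.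
  by rewrite -(galois_dim galK) dimK dimv1.
have cardG2 : #|'Gal({:K} / K2)%g| = 2%N by rewrite -(galois_dim galK2) dimK dimK2.
have /cyclicP[g gE] := cycK.
have og : #[g]%g = 4%N by rewrite orderE -gE.
have galS2 : 'Gal({:K} / K2)%g \subset 'Gal({:K} / 1%AS)%g by exact/galS/sub1v.
have og2 : #[(g ^+ 2)%g]%g = 2%N by rewrite orderXdiv og.
(* A cyclic group has only one subgroup of order 2. *)
have g2E : ('Gal({:K} / K2) = <[g ^+ 2]>)%g.
  have sub : (<[g ^+ 2]> \subset 'Gal({:K} / 1%AS))%g by rewrite gE cycleX.
  by apply/eqP; rewrite (eq_subG_cyclic cycK galS2 sub) cardG2 -orderE og2.
have gM (n : nat) x : (g ^+ n)%g x = iter n g x.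
  elim: n x => [|n IH] x; first by rewrite expg0 gal_id.
  by rewrite expgSr galM ?memvf // IH.
have gK : iter 4 g =1 id by move=> x; rewrite -gM -og expg_order gal_id.
have nK2 : galois 1%AS K2.
  rewrite -(galois_fixedField galK2).
  apply: (@normal_fixedField_galois _ _ _ _ galK 'Gal({:K} / K2)%G).
  rewrite /normal galS2 /=; apply: cents_norm; apply: sub_abelian_cent galS2.
  by rewrite gE; exact: cycle_abelian.
have fix2 x : (x \in K2) = (g (g x) == x).
  rewrite -[in LHS](galois_fixedField galK2 : fixedField _ = K2 :> {vspace K}).
  apply/fixedFieldP/eqP => [|H|e y]; first exact: memvf.
    by rewrite -[g (g x)](gM 2%N) H // g2E cycle_id.
  by rewrite g2E cycle2g // !inE => /orP[]/eqP ->; rewrite ?gal_id ?gM.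
exists (gal_repr g : {rmorphism K -> K}); split=> //.
- move=> x gx.
  suff : x \in fixedField 'Gal({:K} / 1%AS)%g by rewrite (galois_fixedField galK).
  apply/fixedFieldP; first exact: memvf.
  move=> h; rewrite gE => /cycleP[i ->]; rewrite gM.
  by elim: i => //= i ->.
- by move=> x; rewrite /galTrace gE big_cycle og !big_ord_recl big_ord0 addr0 !gM /= !addrA.
- move=> x xK2.
  have cardG1 : #|'Gal(K2 / 1%AS)%g| = 2%N by rewrite -(galois_dim nK2) dimK2 dimv1.
  have sK2 : (1%AS <= K2 <= {:K}%AS)%VS by rewrite sub1v subvf.
  have [_ _ nrm] := and3P nK2.
  pose h := normalField_cast K2 g.
  have gin : g \in 'Gal({:K} / 1%AS)%g by rewrite gE cycle_id.
  have hE := @normalField_cast_eq _ _ _ _ _ sK2 nrm _ gin.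
  have hin : h \in 'Gal(K2 / 1%AS)%g.
    rewrite -(normalField_img galK sK2 nrm).
    apply/morphimP; exists g => //.
  (* If [g] restricted to the identity, [K2] would be fixed by the whole group. *)
  have h1 : h != 1%g.
    apply/negP => /eqP h1; suff : (K2 <= 1)%VS.
      by move=> /dimvS; rewrite dimK2 dimv1.
    apply/subvP => y yK2.
    suff : y \in fixedField 'Gal({:K} / 1%AS)%g by rewrite (galois_fixedField galK).
    apply/fixedFieldP; first exact: memvf.
    have gy : g y = y by rewrite -hE // -/h h1 gal_id.
    by move=> k; rewrite gE => /cycleP[i ->]; rewrite gM; elim: i => //= i ->.
  have galE : 'Gal(K2 / 1%AS)%g = [set 1%g; h]%SET.
    apply/esym/eqP; rewrite eqEcard cardG1 cards2 eq_sym h1 andbT.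
    by apply/fintype.subsetP => y; rewrite !inE => /orP[]/eqP ->.
  rewrite /galTrace galE (big_setD1 1%g) ?inE ?eqxx //= gal_id; congr (_ + _).
  rewrite (big_pred1 h) ?hE // => y; rewrite !inE.
  by have [->|] := eqVneq y h; rewrite ?h1 ?orbT // orbF andNb.
- by move=> x; rewrite /galTrace g2E big_cycle og2 !big_ord_recl big_ord0 addr0 -!expgM !gM.
Qed.

Lemma det_mx22 (R : comNzRingType) (M : 'M[R]_2) :
  \det M = M 0 0 * M 1 1 - M 0 1 * M 1 0.
Proof.
rewrite (expand_det_row _ 0) !big_ord_recl big_ord0 addr0 /cofactor !det_mx11.
rewrite !mxE /= expr0 expr1 mul1r mulN1r mulrN.
by congr (_ * M _ _ - M _ _ * M _ _); apply/val_inj.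
Qed.

Lemma det_block_diag (R : comNzRingType) (M : 'M[R]_(2 + 2)) :
  ursubmx M = 0 -> \det M = \det (ulsubmx M) * \det (drsubmx M).
Proof. by move=> M0; rewrite -[M in LHS]submxK M0 det_lblock. Qed.

(** * Integral bases given by explicit families *)

Section IntegralBasis.
Variable K : splittingFieldType rat.
Implicit Types (E : {subfield K}).

Lemma rat_algE (q : rat) : q%:A = (numq q)%:~R / (denq q)%:~R :> K.
Proof.
by rewrite -[q in LHS]divq_num_den -in_algE fmorph_div !rmorph_int.
Qed.

Lemma int_free_free n (t : n.-tuple K) :
  (forall c : 'I_n -> int, \sum_i (c i)%:~R * tnth t i = 0 -> forall i, c i = 0) ->
  free t.
Proof.
move=> H; apply/freeP => k k0 i.
(* [c i] is [k i] times the product of all denominators. *)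
pose c (i : 'I_n) : int := numq (k i) * \prod_(j < n | j != i) denq (k j).
have Hc : forall i, c i = 0.
  apply: H; pose N : int := \prod_(j < n) denq (k j).
  have cE j : (c j)%:~R * tnth t j = N%:~R * (k j *: t`_j).
    rewrite (tnth_nth 0) -mulr_algl mulrA; congr (_ * _).
    rewrite /c [N](bigD1 j) //= !rmorphM /= mulrAC; congr (_ * _).
    rewrite rat_algE.
    by rewrite [RHS]mulrC divfK // intr_splitting_eq0 denq_eq0.
  under eq_bigr => j _ do rewrite cE.
  by rewrite -mulr_sumr k0 mulr0.
have /eqP := Hc i; rewrite /c mulf_eq0 numq_eq0 => /orP[/eqP //|].
by apply: contraTeq => _; apply/prodf_neq0 => j _; exact: denq_neq0.
Qed.

Lemma integral_basis_tcast E n (t : n.-tuple K) (e : n = \dim E) :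
    (forall c : 'I_n -> int, \sum_i (c i)%:~R * tnth t i = 0 -> forall i, c i = 0) ->
    (forall i, ring_of_integers E (tnth t i)) ->
    (forall x, ring_of_integers E x -> exists c : 'I_n -> int,
      x = \sum_i (c i)%:~R * tnth t i) ->
  integral_basis (tcast e t).
Proof.
move=> H1 H2 H3; subst n; split=> //=.
rewrite basisEfree (int_free_free H1) size_tuple leqnn andbT /=.
by apply/span_subvP => x /tnthP[i ->]; case: (H2 i).
Qed.

Lemma det_gram_tcast E n (t : n.-tuple K) (e : n = \dim E) :
  \det (gram (tcast e t)) =
  \det (\matrix_(i < n, j < n) galTrace 1%AS E (tnth t i * tnth t j)).
Proof. by subst n. Qed.

Lemma integral_basis2 E (e : 2 = \dim E) (x0 x1 : K) :
    (forall u v : int, u%:~R * x0 + v%:~R * x1 = 0 -> u = 0 /\ v = 0) ->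
    (forall x, ring_of_integers E x <-> exists u v : int,
      x = u%:~R * x0 + v%:~R * x1) ->
  integral_basis (tcast e [tuple x0; x1]).
Proof.
have sumE (c : 'I_2 -> int) : \sum_i (c i)%:~R * tnth [tuple x0; x1] i =
    (c 0)%:~R * x0 + (c 1)%:~R * x1.
  rewrite !big_ord_recl big_ord0 addr0 !(tnth_nth 0) /=.
  by congr (_ + (c _)%:~R * _); apply/val_inj.
move=> H1 H2; apply: integral_basis_tcast => [c|i|x /H2[u [v ->]]].
- rewrite sumE => /H1[c0 c1] i.
  have : i \in [:: 0; 1] by case: i => -[|[]].
  by rewrite !inE => /orP[]/eqP ->.
- have : i \in [:: 0; 1] by case: i => -[|[]].
  rewrite !inE => /orP[]/eqP ->; rewrite (tnth_nth 0) /=; apply/H2.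
    by exists 1, 0; rewrite mul1r mul0r addr0.
  by exists 0, 1; rewrite mul1r mul0r add0r.
- by exists (fun i => [:: u; v]`_i); rewrite sumE.
Qed.

Lemma integral_basis4 E (e : 4 = \dim E) (x0 x1 x2 x3 : K) :
    (forall u v m n : int, u%:~R * x0 + v%:~R * x1 + m%:~R * x2 + n%:~R * x3 = 0 ->
      [/\ u = 0, v = 0, m = 0 & n = 0]) ->
    (forall x, ring_of_integers E x <-> exists u v m n : int,
      x = u%:~R * x0 + v%:~R * x1 + m%:~R * x2 + n%:~R * x3) ->
  integral_basis (tcast e [tuple x0; x1; x2; x3]).
Proof.
have sumE (c : 'I_4 -> int) : \sum_i (c i)%:~R * tnth [tuple x0; x1; x2; x3] i =
    (c 0)%:~R * x0 + (c 1)%:~R * x1 + (c 2%:R)%:~R * x2 + (c 3%:R)%:~R * x3.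
  rewrite !big_ord_recl big_ord0 addr0 !(tnth_nth 0) /= !addrA.
  by congr (_ + (c _)%:~R * _ + (c _)%:~R * _ + (c _)%:~R * _); apply/val_inj.
have mem4 (i : 'I_4) : i \in [:: 0; 1; 2%:R; 3%:R] by case: i => -[|[|[|[]]]].
move=> H1 H2; apply: integral_basis_tcast => [c|i|x /H2[u [v [m [n ->]]]]].
- rewrite sumE => /H1[c0 c1 c2 c3] i.
  by have := mem4 i; rewrite !inE => /or4P[]/eqP ->.
- have := mem4 i; rewrite !inE => /or4P[]/eqP ->; rewrite (tnth_nth 0) /=; apply/H2.
  + by exists 1, 0, 0, 0; rewrite !mul1r !mul0r !addr0.
  + by exists 0, 1, 0, 0; rewrite !mul1r !mul0r !addr0 add0r.
  + by exists 0, 0, 1, 0; rewrite !mul1r !mul0r !addr0 add0r.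
  + by exists 0, 0, 0, 1; rewrite !mul1r !mul0r !add0r.
- by exists (fun i => [:: u; v; m; n]`_i); rewrite sumE.
Qed.

End IntegralBasis.

(** * Integers of K, rounding, and the generator [d] *)

Section MinimalElements.
Variables (K : splittingFieldType rat) (K2 : {subfield K}).
Variable s : {rmorphism K -> K}.
Hypothesis gen : quartic_generator K2 s.
Implicit Types x y z : K.

Local Notation OK := (ring_of_integers {:K}%AS).
Local Notation O2 := (ring_of_integers K2).

Lemma natr_splitting_neq0 (n : nat) : n.+1%:R != 0 :> K.
Proof. by rewrite (intr_splitting_eq0 K n.+1%:Z). Qed.

Lemma integers_gen x : OK x -> OK (s x).
Proof. by apply: integers_rmorph; exact: memvf. Qed.

Lemma integers_quadraticP x : O2 x <-> OK x /\ s (s x) = x.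
Proof.
split=> [[xK2 xi]|[[_ xi] /eqP xs]]; last by split=> //; rewrite (gen_fix2 gen).
by split; [split=> //; exact: memvf|apply/eqP; rewrite -(gen_fix2 gen)].
Qed.

Lemma integers_fixed x : OK x -> s x = x -> exists n : int, x = n%:~R.
Proof. by move=> [_ xi] /(gen_fix gen) x1; exact: integers_rat. Qed.

Lemma rat_fixed x : s x = x -> exists q : rat, x = q%:A.
Proof. by move=> /(gen_fix gen) /vlineP. Qed.

Lemma integers_sqrt x : OK (x ^+ 2) -> OK x.
Proof.
move=> [_ xi]; split; first exact: memvf.
apply: (integral_root_monic (p := 'X^2 - (x ^+ 2)%:P)).
- by apply: monicXnsubC.
- by rewrite /root !hornerE subrr.
apply/integral_poly => i; rewrite coefB coefXn coefC.
have n0 := integral_nat (intr : {rmorphism int -> K}) 0.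
have n1 := integral_nat (intr : {rmorphism int -> K}) 1.
case: i => [|[|[|i]]] /=; rewrite ?subr0 ?sub0r //.
by apply: integral_opp.
Qed.

Lemma integers_quadratic_root x b c :
  OK b -> OK c -> x ^+ 2 - b * x + c = 0 -> OK x.
Proof.
move=> [_ bi] [_ ci] e; split; first exact: memvf.
apply: (integral_root_monic (p := 'X^2 - (b *: 'X - c%:P))).
- apply/monicP; rewrite lead_coefDl ?lead_coefXn // size_polyXn size_polyN.
  rewrite ltnS; apply: leq_trans (size_polyD _ _) _; rewrite geq_max size_polyN.
  by rewrite (leq_trans (size_scale_leq _ _)) ?size_polyX //
    (leq_trans (size_polyC_leq1 _)).
- by rewrite /root !hornerE; apply/eqP; rewrite -[RHS]e; ring.
apply/integral_poly => i; rewrite !coefB coefXn coefZ coefX coefC.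
have n0 := integral_nat (intr : {rmorphism int -> K}) 0.
have n1 := integral_nat (intr : {rmorphism int -> K}) 1.
case: i => [|[|[|i]]] /=; rewrite ?mulr0 ?mulr1 ?subr0 ?sub0r //.
  by rewrite opprK.
by apply: integral_opp.
Qed.

(** Rounding to the nearest integer. The bound 1/4 suits a descent with two coordinates as well,
    whose errors then add up to at most 1/2. *)
Lemma exists_round (q : rat) : exists m : int, (q - m%:~R) ^+ 2 <= 1 / 4.
Proof.
exists (Num.floor (q + 1 / 2)).
have := floor_le (q + 1 / 2); have := floorD1_gt (q + 1 / 2).
rewrite rmorphD /=; move: (Num.floor _)%:~R => m lt1 lt2.
have [a0 b0] : 0 <= q - m + 1 / 2 /\ 0 <= 1 / 2 - (q - m) by split; lra.
by have := mulr_ge0 a0 b0; rewrite expr2; lra.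
Qed.

(** Any two nonzero elements with [s y = - y] have a rational ratio. Taking [d] with [|d^2|] least,
    rounding [y / d] leaves a remainder of smaller square, hence zero. *)
Lemma exists_minimal_quadratic : exists (d : K) (D : int),
  [/\ OK d, s d = - d, d != 0, d ^+ 2 = D%:~R &
      forall y, OK y -> s y = - y -> exists m : int, y = m%:~R * d].
Proof.
have sqr_rat y : s y = - y -> exists q : rat, y ^+ 2 = q%:A.
  by move=> sy; apply: rat_fixed; rewrite rmorphXn sy sqrrN.
pose good (n : nat) := exists y (m : int),
  [/\ OK y, s y = - y, y != 0, y ^+ 2 = m%:~R & `|m|%N = n].
have [n0 good0] : exists n, good n.
  have [x [xK2 x0]] : exists x, x \in K2 /\ s x != x.
    apply: contrapT => none.
    have : (K2 <= 1)%VS.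
      apply/subvP => x xK2; apply: (gen_fix gen); apply: contrapT => /eqP nx.
      by apply: none; exists x.
    by move=> /dimvS; rewrite (gen_dim2 gen) dimv1.
  have ssx : s (s x) = x by apply/eqP; rewrite -(gen_fix2 gen).
  pose y := x - s x.
  have sy : s y = - y by rewrite /y rmorphB ssx opprB.
  have y0 : y != 0 by rewrite subr_eq0 eq_sym.
  have [q Hq] := sqr_rat y sy.
  (* Multiplying [y] by the denominator of [y^2] makes the square an integer. *)
  pose z := (denq q)%:~R * y.
  have zE : z ^+ 2 = (denq q * numq q)%:~R.
    rewrite /z exprMn Hq -[in q%:A](divq_num_den q) intr_algE [RHS]intr_algE.
    rewrite -!in_algE -rmorphXn -rmorphM; congr (in_alg K _).
    by rewrite rmorphM /=; field; rewrite intr_eq0 denq_eq0.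
  exists (absz (denq q * numq q)), z, (denq q * numq q); split=> //.
  - by apply: integers_sqrt; rewrite zE; exact: integers_int.
  - by rewrite /z rmorphM rmorph_int sy mulrN.
  - by rewrite mulf_neq0 // intr_splitting_eq0 denq_eq0.
pose P n := `[< good n >].
have exP : exists n, P n by exists n0; apply/asboolP.
have [n /asboolP [d [D [dO sd d0 dD nE]]] minn] := ex_minnP exP.
exists d, D; split=> // y yO sy.
have [q Hq] : exists q : rat, y / d = q%:A.
  by apply: rat_fixed; rewrite fmorph_div sy sd invrN mulrNN.
have yE : y = q%:A * d by rewrite -Hq divfK.
have [m qm] := exists_round q.
exists m; apply/eqP; rewrite -subr_eq0; apply/negP => /negP y'0.
pose y' := y - m%:~R * d.
have y'O : OK y' by apply: integersB => //; apply: integersM => //; exact: integers_int.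
have sy' : s y' = - y' by rewrite /y' rmorphB rmorphM rmorph_int sy sd /=; ring.
have [k kE] : exists k : int, y' ^+ 2 = k%:~R.
  by apply: integers_fixed; [exact: integersX|rewrite rmorphXn sy' sqrrN].
have : P `|k|%N by apply/asboolP; exists y', k.
move=> /minn; rewrite -nE => le.
have kq : k%:~R = (q - m%:~R) ^+ 2 * D%:~R :> rat.
  apply: (fmorph_inj (in_alg K)).
  rewrite rmorphM rmorphXn rmorphB !rmorph_int -kE -dD /y' yE.
  by rewrite -exprMn mulrBl.
have D0 : D != 0.
  by rewrite -(intr_splitting_eq0 K) -dD expf_neq0.
have k2 : `|k|%:~R = (q - m%:~R) ^+ 2 * `|D|%:~R :> rat.
  by rewrite !intr_norm kq normrM ger0_norm ?sqr_ge0.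
have : `|D|%:~R <= `|k|%:~R :> rat by rewrite ler_int; lia.
have : 0 < `|D|%:~R :> rat by rewrite ltr0z normr_gt0.
by rewrite k2; move: (_ ^+ 2) qm => t qm; nra.
Qed.

End MinimalElements.

(* [d ^+ 2 = D], where [D] is the square-free kernel of the quadratic subfield, and [al]
   generates, over [Z[s]], the integers [y] such that [s (s y) = - y]. *)
Record quartic_data (K : splittingFieldType rat) (s : {rmorphism K -> K})
    (d al : K) (D A B C : int) : Prop := QuarticData {
  qd_d_int : ring_of_integers {:K}%AS d;
  qd_al_int : ring_of_integers {:K}%AS al;
  qd_d_neq0 : d != 0;
  qd_al_neq0 : al != 0;
  qd_sd : s d = - d;
  qd_ssal : s (s al) = - al;
  qd_dd : d ^+ 2 = D%:~R;
  qd_sum : al ^+ 2 + s al ^+ 2 = (A * D)%:~R;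
  qd_diff : al ^+ 2 - s al ^+ 2 = (A * B)%:~R * d;
  qd_prod : 2 * (al * s al) = (A * C)%:~R * d;
  qd_dal : d * al = B%:~R * al + C%:~R * s al;
  qd_DE : D = B ^+ 2 + C ^+ 2;
  qd_coprime : coprimez B C;
  qd_A_neq0 : A != 0;
  qd_D_gt0 : 0 < D;
  qd_free : forall m n : int, m%:~R * al + n%:~R * s al = 0 -> m = 0 /\ n = 0;
  qd_min2 : forall y, ring_of_integers {:K}%AS y -> s y = - y ->
    exists m : int, y = m%:~R * d;
  qd_min4 : forall y, ring_of_integers {:K}%AS y -> s (s y) = - y ->
    exists m n : int, y = m%:~R * al + n%:~R * s al }.

(** * The generator [al] and the integers [A], [B], [C], [D] *)

Section QuarticData.
Variables (K : splittingFieldType rat) (K2 : {subfield K}).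
Variable s : {rmorphism K -> K}.
Hypothesis gen : quartic_generator K2 s.
Implicit Types x y z : K.

Local Notation OK := (ring_of_integers {:K}%AS).

Definition sqnorm y : K := y ^+ 2 + s y ^+ 2.

Lemma exists_quartic_data : exists d al D A B C, quartic_data s d al D A B C.
Proof.
have [d [D [dO sd d0 dD dmin]]] := exists_minimal_quadratic gen.
have D0 : D != 0.
  by rewrite -(intr_splitting_eq0 K) -dD expf_neq0.
have nrm_int y : OK y -> s (s y) = - y -> exists k : int, sqnorm y = k%:~R.
  move=> yO sy; apply: integers_fixed; first exact: gen.
    apply: integersD; apply: integersX => //; exact: integers_gen.
  by rewrite /sqnorm rmorphD !rmorphXn sy sqrrN addrC.
have rel y : OK y -> s (s y) = - y -> exists b c : int,
    y ^+ 2 - s y ^+ 2 = b%:~R * d /\ y * s y = c%:~R * d.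
  move=> yO sy.
  have [||b bE] := dmin (y ^+ 2 - s y ^+ 2).
  - by apply: integersB; apply: integersX => //; exact: integers_gen.
  - by rewrite rmorphB !rmorphXn sy sqrrN opprB.
  have [||c cE] := dmin (y * s y).
  - by apply: integersM => //; exact: integers_gen.
  - by rewrite rmorphM sy mulrN mulrC.
  by exists b, c.
(* The form [sqnorm] is anisotropic: its square is [(y^2 - (s y)^2)^2 + 4 (y s y)^2], which is
   [D (b^2 + 4 c^2)]. *)
have nrm0 y : OK y -> s (s y) = - y -> sqnorm y = 0 -> y = 0.
  move=> yO sy y0; have [b [c [bE cE]]] := rel y yO sy.
  have e : (D * (b ^+ 2 + 4 * c ^+ 2))%:~R = 0 :> K.
    rewrite rmorphM rmorphD rmorphM !rmorphXn /= -dD.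
    have -> : d ^+ 2 * (b%:~R ^+ 2 + 4%:~R * c%:~R ^+ 2) =
      (b%:~R * d) ^+ 2 + 4 * (c%:~R * d) ^+ 2 by ring.
    rewrite -bE -cE -[RHS](mulr0 (sqnorm y)) -[in RHS]y0 /sqnorm; ring.
  move/eqP: e; rewrite intr_splitting_eq0 mulf_eq0 (negPf D0) /= => /eqP e.
  have c0 : c = 0.
    by have := sqr_ge0 b; have := sqr_ge0 c; nia.
  move/eqP: cE; rewrite c0 mul0r mulf_eq0 fmorph_eq0 orbb => /eqP //.
pose good (n : nat) := exists y (m : int),
  [/\ OK y, s (s y) = - y, y != 0, sqnorm y = m%:~R & `|m|%N = n].
have [n0 good0] : exists n, good n.
  have [x x0] : exists x, s (s x) != x.
    apply: contrapT => none.
    have : ({:K}%AS <= K2)%VS.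
      apply/subvP => x _; rewrite (gen_fix2 gen); apply: contrapT => nx.
      by apply: none; exists x; apply/negP.
    by move=> /dimvS; rewrite (gen_dim2 gen) (gen_dim gen).
  pose y := x - s (s x).
  have sy : s (s y) = - y by rewrite /y !rmorphB (gen_order gen) opprB.
  have y0 : y != 0 by rewrite subr_eq0 eq_sym.
  pose z := y ^+ 2.
  have ssz : s (s z) = z by rewrite !rmorphXn sy sqrrN.
  have [p pE] : exists p : rat, z + s z = p%:A.
    by apply: rat_fixed; [exact: gen|rewrite rmorphD ssz addrC].
  have [q qE] : exists q : rat, (z - s z) / d = q%:A.
    apply: rat_fixed; first exact: gen.
    by rewrite fmorph_div rmorphB ssz sd invrN mulrN -mulNr opprB.
  (* As [y^2 = (p + q d) / 2], this [N] makes [N y^2], and so the square of [N y], an integral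
     combination of 1 and [d]. *)
  pose N := 2 * denq p * denq q.
  have N0 : N != 0 by rewrite /N !mulf_neq0 ?denq_eq0.
  have zE : (N%:~R * y) ^+ 2 =
      (N * denq q * numq p)%:~R + (N * denq p * numq q)%:~R * d.
    have den (r : rat) : (denq r)%:~R * r%:A = (numq r)%:~R :> K.
      by rewrite rat_algE mulrC divfK // intr_splitting_eq0 denq_eq0.
    have -> : (N%:~R * y) ^+ 2 = N%:~R * ((denq q)%:~R * ((denq p)%:~R * (z + s z)) +
      (denq p)%:~R * ((denq q)%:~R * ((z - s z) / d)) * d).
      transitivity (N%:~R * (denq q)%:~R * (denq p)%:~R *
        ((z + s z) + (z - s z) / d * d)); last by ring.
      by rewrite divfK // /N !rmorphM /= /z; ring.
    by rewrite pE qE !den !rmorphM /=; ring.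
  have NyO : OK (N%:~R * y).
    apply: integers_sqrt; rewrite zE; apply: integersD; first exact: integers_int.
    by apply: integersM => //; exact: integers_int.
  have sNy : s (s (N%:~R * y)) = - (N%:~R * y).
    by rewrite !rmorphM !rmorph_int sy mulrN.
  have [k kE] := nrm_int _ NyO sNy.
  exists `|k|%N, (N%:~R * y), k; split=> //.
  by rewrite mulf_neq0 // intr_splitting_eq0.
pose P n := `[< good n >].
have exP : exists n, P n by exists n0; apply/asboolP.
have [n /asboolP [al [T [alO sal al0 alT nE]]] minn] := ex_minnP exP.
have T0 : T != 0.
  apply: contraNneq al0 => T0; apply/eqP; apply: nrm0 => //.
  by rewrite alT T0.
have T0K : T%:~R != 0 :> K by rewrite intr_splitting_eq0.
have min4 y : OK y -> s (s y) = - y ->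
    exists m n : int, y = m%:~R * al + n%:~R * s al.
  move=> yO sy.
  (* The coordinates [p], [q] of [y] on [al] and [s al], solved from the expressions of [y] and
     [s y]; the determinant of this system is [sqnorm al], equal to [T]. *)
  have [p pE] : exists p : rat, (y * al + s y * s al) / T%:~R = p%:A.
    apply: rat_fixed; first exact: gen.
    by rewrite fmorph_div rmorph_int rmorphD !rmorphM sy sal mulrNN addrC.
  have [q qE] : exists q : rat, (y * s al - s y * al) / T%:~R = q%:A.
    apply: rat_fixed; first exact: gen.
    rewrite fmorph_div rmorph_int rmorphB !rmorphM sy sal mulrN mulNr opprK.
    by rewrite addrC.
  have yE : y = p%:A * al + q%:A * s al.
    rewrite -pE -qE; transitivity (y * (sqnorm al / T%:~R)).
      by rewrite alT divff // mulr1.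
    by rewrite /sqnorm; field.
  have [k pk] := exists_round p; have [l ql] := exists_round q.
  exists k, l; apply/eqP; rewrite -subr_eq0; apply/negP => /negP y'0.
  pose y' := y - (k%:~R * al + l%:~R * s al).
  have salO : OK (s al) := integers_gen s alO.
  have y'O : OK y'.
    by apply: integersB => //; apply: integersD; apply: integersM => //;
      exact: integers_int.
  have sy' : s (s y') = - y'.
    by rewrite /y' !(rmorphB, rmorphD, rmorphM, rmorph_int) sy !(sal, rmorphN) /=; ring.
  have [j jE] := nrm_int _ y'O sy'.
  have : P `|j|%N by apply/asboolP; exists y', j.
  move=> /minn; rewrite -nE => le.
  have jpq : j%:~R = ((p - k%:~R) ^+ 2 + (q - l%:~R) ^+ 2) * T%:~R :> rat.
    apply: (fmorph_inj (in_alg K)).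
    rewrite rmorphM rmorphD !rmorphXn !rmorphB !rmorph_int -jE -alT /sqnorm.
    have -> : y' = (p%:A - k%:~R) * al + (q%:A - l%:~R) * s al.
      by rewrite /y' yE; ring.
    have sA (r : rat) : s r%:A = r%:A.
      by rewrite rat_algE fmorph_div !rmorph_int.
    rewrite rmorphD !rmorphM !rmorphB !rmorph_int !sA sal /=; ring.
  have j2 : `|j|%:~R = ((p - k%:~R) ^+ 2 + (q - l%:~R) ^+ 2) * `|T|%:~R :> rat.
    by rewrite !intr_norm jpq normrM ger0_norm // addr_ge0 ?sqr_ge0.
  have : `|T|%:~R <= `|j|%:~R :> rat by rewrite ler_int; lia.
  have : 0 < `|T|%:~R :> rat by rewrite ltr0z normr_gt0.
  by rewrite j2; move: (_ ^+ 2) (_ ^+ 2) pk ql => t u pk ql; nra.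
have free m k : m%:~R * al + k%:~R * s al = 0 -> m = 0 /\ k = 0.
  move=> e.
  have : ((m ^+ 2 + k ^+ 2) * T)%:~R = 0 :> K.
    rewrite rmorphM rmorphD !rmorphXn /= -alT /sqnorm.
    have e' : m%:~R * s al - k%:~R * al = 0.
      have := congr1 s e; rewrite rmorphD !rmorphM !rmorph_int sal rmorph0 /=.
      by rewrite mulrN.
    transitivity ((m%:~R * al + k%:~R * s al) ^+ 2 +
      (m%:~R * s al - k%:~R * al) ^+ 2); first by ring.
    by rewrite e e' expr0n addr0.
  move/eqP; rewrite intr_splitting_eq0 mulf_eq0 (negPf T0) orbF => /eqP.
  by have := sqr_ge0 m; have := sqr_ge0 k; nia.
(* Multiplication by [d] preserves the condition [s (s y) = - y] since [s (s d) = d]; as it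
   anticommutes with [s], its matrix on [al], [s al] is symmetric of trace 0, with square
   [B^2 + C^2]. *)
have [B [C dal]] : exists B C : int, d * al = B%:~R * al + C%:~R * s al.
  apply: min4; first exact: integersM.
  by rewrite !rmorphM sal sd rmorphN sd opprK mulrN.
have dbe : d * s al = C%:~R * al - B%:~R * s al.
  have := congr1 s dal; rewrite rmorphD !rmorphM !rmorph_int sd sal /= => e.
  by rewrite mulNr in e; rewrite -[LHS]opprK e; ring.
have DE : D = B ^+ 2 + C ^+ 2.
  apply: (@intr_splitting_inj K); apply: (mulIf al0).
  rewrite -dD expr2 -mulrA dal mulrDr !mulrA ![d * _%:~R]mulrC -!mulrA dal dbe.
  by rewrite rmorphD !rmorphXn /=; ring.
(* If [g] divides [B] and [C], then [g^2] divides [D] and [d / g] is integral, against the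
   minimality of [d]. *)
have cop : coprimez B C.
  have BC0 : gcdz B C != 0.
    by apply: contra D0; rewrite gcdz_eq0 DE => /andP[/eqP -> /eqP ->].
  set g := gcdz B C in BC0.
  have gK : g%:~R != 0 :> K by rewrite intr_splitting_eq0.
  have [D' D'E] : exists D', D = D' * g ^+ 2.
    have /dvdzP[b' bE] := dvdz_gcdl B C; have /dvdzP[c' cE] := dvdz_gcdr B C.
    rewrite -/g in bE cE.
    by exists (b' ^+ 2 + c' ^+ 2); rewrite DE bE cE; ring.
  have [||m mE] := dmin (d / g%:~R).
  - apply: integers_sqrt; rewrite expr_div_n dD D'E rmorphM rmorphXn /=.
    by rewrite mulfK ?expf_neq0 //; exact: integers_int.
  - by rewrite fmorph_div rmorph_int sd mulNr.
  have gm : g * m = 1.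
    apply: (@intr_splitting_inj K); apply: (mulIf d0).
    by rewrite mul1r rmorphM /= -mulrA -mE mulrC divfK.
  have : (g %| 1)%Z by apply/dvdzP; exists m; rewrite mulrC; exact: esym.
  by rewrite dvdz1 /g /coprimez /gcdz absz_nat => /eqP ->.
have [b [c [bE cE]]] := rel al alO sal.
have bDE : b * D = B * T.
  apply: (@intr_splitting_inj K); rewrite !rmorphM /= -dD -alT /sqnorm.
  transitivity (d * (al ^+ 2 - s al ^+ 2)); first by rewrite bE; ring.
  transitivity (al * (d * al) - s al * (d * s al)); first by ring.
  by rewrite dal dbe; ring.
have cDE : 2 * c * D = C * T.
  apply: (@intr_splitting_inj K); rewrite !rmorphM /= -dD -alT /sqnorm.
  transitivity (d * (al * s al) * 2); first by rewrite cE; ring.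
  transitivity (al * (d * s al) + s al * (d * al)); first by ring.
  by rewrite dal dbe; ring.
(* Because [B] and [C] are coprime, the relations [b D = B T] and [2 c D = C T] suffice. *)
have /dvdzP[A AE] : (D %| T)%Z.
  have /coprimezP[[u v] /= uv] := cop.
  have -> : T = (u * b + v * (2 * c)) * D.
    by rewrite mulrDl -!mulrA bDE [2 * _]mulrA cDE -[LHS]mul1r -uv; ring.
  exact: dvdz_mull.
exists d, al, D, A, B, C; split=> //.
- by rewrite -AE -alT.
- rewrite bE; congr (_%:~R * d); apply: (mulIf D0); rewrite bDE AE; ring.
- rewrite cE mulrA; congr (_ * d); rewrite -[2]/(2%:~R) -rmorphM; congr (_%:~R).
  by apply: (mulIf D0); rewrite cDE AE; ring.
- by apply: contra T0; rewrite AE => /eqP ->; rewrite mul0r.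
- by rewrite lt_neqAle eq_sym D0 DE addr_ge0 ?sqr_ge0.
Qed.

End QuarticData.

(** * Parity and divisibility of [A], [B], [C], [D] *)

Lemma odd_int (n : int) : ~~ (2 %| n)%Z -> exists k, n = 2 * k + 1.
Proof. by move=> n2; exists (n %/ 2)%Z; lia. Qed.

Lemma even_int (n : int) : (2 %| n)%Z -> exists k, n = 2 * k.
Proof. by move=> /dvdzP[k ->]; exists k; rewrite mulrC. Qed.

Section Parity.
Variables (K : splittingFieldType rat).
Variables (s : {rmorphism K -> K}) (d al : K) (D A B C : int).
Hypothesis qd : quartic_data s d al D A B C.

Local Notation OK := (ring_of_integers {:K}%AS).
Local Notation be := (s al).

Let two0 : 2 != 0 :> K. Proof. exact: natr_splitting_neq0. Qed.

Lemma al_sqr : 2 * al ^+ 2 = A%:~R * (D%:~R + B%:~R * d).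
Proof.
transitivity ((al ^+ 2 + be ^+ 2) + (al ^+ 2 - be ^+ 2)); first by ring.
by rewrite (qd_sum qd) (qd_diff qd) !rmorphM /=; ring.
Qed.

Lemma be_sqr : 2 * be ^+ 2 = A%:~R * (D%:~R - B%:~R * d).
Proof.
transitivity ((al ^+ 2 + be ^+ 2) - (al ^+ 2 - be ^+ 2)); first by ring.
by rewrite (qd_sum qd) (qd_diff qd) !rmorphM /=; ring.
Qed.

Lemma al_be : 2 * (al * be) = A%:~R * C%:~R * d.
Proof. by rewrite (qd_prod qd) rmorphM. Qed.

Lemma lin_sqr (m n : int) : 2 * (m%:~R * al + n%:~R * be) ^+ 2 =
  (A * (m ^+ 2 + n ^+ 2) * D)%:~R +
  (A * ((m ^+ 2 - n ^+ 2) * B + 2 * m * n * C))%:~R * d.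
Proof.
transitivity (m%:~R ^+ 2 * (2 * al ^+ 2) + n%:~R ^+ 2 * (2 * be ^+ 2) +
  2 * m%:~R * n%:~R * (2 * (al * be))); first by ring.
by rewrite al_sqr be_sqr al_be !(rmorphM, rmorphD, rmorphXn, rmorphB) /=; ring.
Qed.

Lemma d_free (u v : int) : u%:~R + v%:~R * d = 0 -> u = 0 /\ v = 0.
Proof.
move=> e; have := congr1 s e.
rewrite rmorphD rmorphM !rmorph_int (qd_sd qd) rmorph0 => e'.
have u0 : (2 * u)%:~R = 0 :> K.
  rewrite rmorphM; transitivity ((u%:~R + v%:~R * d) + (u%:~R + v%:~R * - d)).
    by rewrite /=; ring.
  by rewrite e e' addr0.
move/eqP: u0; rewrite intr_splitting_eq0 mulf_eq0 /= => /eqP u0.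
move/eqP: e; rewrite u0 add0r mulf_eq0 (negPf (qd_d_neq0 qd)) orbF.
by rewrite intr_splitting_eq0 => /eqP.
Qed.

Lemma integers_lin (m n : int) : OK (m%:~R * al + n%:~R * be).
Proof.
have alO := qd_al_int qd.
apply: integersD; apply: integersM; try exact: integers_int; first by [].
exact: integers_gen.
Qed.

(* Integers [k] for which [x / k] has integral square must divide the
   coordinates of [x]. *)
Lemma lin_div (m n k : int) : k != 0 ->
  OK ((m%:~R * al + n%:~R * be) ^+ 2 / k%:~R ^+ 2) -> (k %| m)%Z /\ (k %| n)%Z.
Proof.
move=> k0 H; have k0' : k%:~R != 0 :> K by rewrite intr_splitting_eq0.
have [||m' [n' e]] := qd_min4 qd (y := (m%:~R * al + n%:~R * be) / k%:~R).
- by apply: integers_sqrt; rewrite expr_div_n.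
- rewrite !fmorph_div !rmorphD !rmorphM !rmorph_int !(qd_ssal qd) rmorphN.
  by rewrite /=; field.
have [] := qd_free qd (m := m - k * m') (n := n - k * n').
  move: e => /(congr1 ( *%R k%:~R)); rewrite mulrCA divff // mulr1 => e.
  rewrite !rmorphB !rmorphM /=.
  transitivity ((m%:~R * al + n%:~R * be) - k%:~R * (m'%:~R * al + n'%:~R * be)).
    by ring.
  by rewrite e subrr.
by move=> /subr0_eq -> /subr0_eq ->; rewrite !dvdz_mulr.
Qed.

Lemma D_odd_mod4 : ~~ (2 %| D)%Z -> exists k, D = 4 * k + 1.
Proof.
move=> D2; have DE := qd_DE qd.
have [B2|/odd_int[b bE]] := boolP (2 %| B)%Z; last first.
  have [C2|/odd_int[c cE]] := boolP (2 %| C)%Z; last first.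
    move: D2; rewrite DE bE cE.
    have -> : (2 * b + 1) ^+ 2 + (2 * c + 1) ^+ 2 =
      2 * (2 * b ^+ 2 + 2 * b + 2 * c ^+ 2 + 2 * c + 1) :> int by ring.
    by rewrite dvdz_mulr.
  have [c cE] := even_int C2.
  by exists (b ^+ 2 + b + c ^+ 2); rewrite DE bE cE; ring.
have [b bE] := even_int B2.
have [C2|/odd_int[c cE]] := boolP (2 %| C)%Z; last first.
  by exists (b ^+ 2 + c ^+ 2 + c); rewrite DE bE cE; ring.
have [c cE] := even_int C2.
move: D2; rewrite DE bE cE.
have -> : (2 * b) ^+ 2 + (2 * c) ^+ 2 = 2 * (2 * b ^+ 2 + 2 * c ^+ 2) :> int by ring.
by rewrite dvdz_mulr.
Qed.

(** In the odd case [(D + d) / 2] is used instead of [(1 + d) / 2] because it is a multiple of [d]: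
    in both cases [D] and this element span the ideal generated by [d]. *)
Definition quad_gen : K := if (2 %| D)%Z then d else (D%:~R + d) / 2.

Lemma integers_quad_gen : OK quad_gen.
Proof.
rewrite /quad_gen; case: ifPn => [_|/D_odd_mod4[k kE]]; first exact: qd_d_int qd.
apply: (integers_quadratic_root (b := D%:~R) (c := (D * k)%:~R)).
- exact: integers_int.
- exact: integers_int.
have -> : ((D%:~R + d) / 2) ^+ 2 - D%:~R * ((D%:~R + d) / 2) + (D * k)%:~R =
  (d ^+ 2 - D%:~R * (D%:~R - 4 * k%:~R)) / 4 :> K.
  by rewrite rmorphM /=; field; rewrite !natr_splitting_neq0.
rewrite (qd_dd qd); have -> : D%:~R - 4 * k%:~R = 1 :> K.
  by rewrite kE rmorphD rmorphM /=; ring.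
by rewrite mulr1 subrr mul0r.
Qed.

(** The element [(D + d) / 2 * al] is an integral combination of [al] and [s al], with coordinates
    [(D + B) / 2] and [C / 2]. *)
Lemma parity_odd : ~~ (2 %| D)%Z -> exists b c, B = 2 * b + 1 /\ C = 2 * c.
Proof.
move=> D2; have wO := integers_quad_gen; rewrite /quad_gen (negPf D2) in wO.
have [k kE] := D_odd_mod4 D2.
have [||m [n e]] := qd_min4 qd (y := (D%:~R + d) / 2 * al).
- by apply: integersM => //; exact: qd_al_int qd.
- rewrite !rmorphM !fmorphV !rmorph_nat !rmorphD !rmorph_int (qd_sd qd) rmorphN.
  by rewrite (qd_sd qd) (qd_ssal qd) opprK mulrN.
have [] := qd_free qd (m := D + B - 2 * m) (n := C - 2 * n).
  rewrite !rmorphB !rmorphD !rmorphM /=.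
  transitivity ((D%:~R * al + (B%:~R * al + C%:~R * be)) -
    2 * (m%:~R * al + n%:~R * be)); first by ring.
  rewrite -(qd_dal qd) -e; apply/eqP; rewrite subr_eq0; apply/eqP.
  by field.
by move=> e1 e2; exists (m - 2 * k - 1), n; split; lia.
Qed.

Lemma parity_even : (2 %| D)%Z -> exists b c,
  [/\ B = 2 * b + 1, C = 2 * c + 1 & ~~ (4 %| D)%Z].
Proof.
move=> D2; have DE := qd_DE qd; have cop := qd_coprime qd.
have [B2|/odd_int[b bE]] := boolP (2 %| B)%Z.
  have [b bE] := even_int B2.
  have [C2|/odd_int[c cE]] := boolP (2 %| C)%Z.
    have : (2 %| gcdz B C)%Z by rewrite dvdz_gcd B2.
    by rewrite (eqP cop).
  have : D = 2 * (2 * b ^+ 2 + 2 * c ^+ 2 + 2 * c) + 1.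
    by rewrite DE bE cE; ring.
  by move: (2 * b ^+ 2 + _) => t; lia.
have [C2|/odd_int[c cE]] := boolP (2 %| C)%Z.
  have [c cE] := even_int C2.
  have : D = 2 * (2 * b ^+ 2 + 2 * c ^+ 2 + 2 * b) + 1.
    by rewrite DE bE cE; ring.
  by move: (2 * b ^+ 2 + _) => t; lia.
exists b, c; split=> //.
have : D = 4 * (b ^+ 2 + b + c ^+ 2 + c) + 2 by rewrite DE bE cE; ring.
by move: (b ^+ 2 + _) => t; lia.
Qed.

(** As [2 al^2 = A (D + B d)], this tests the integrality of the square of a multiple of [al] or of
    a quotient of it. *)
Lemma half_integers (a : int) : ~~ (2 %| D)%Z || (2 %| a)%Z ->
  OK (a%:~R * (D%:~R + B%:~R * d) / 2).
Proof.
have dO := qd_d_int qd.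
have [D2 /even_int[a' ->]|D2 _] := boolP (2 %| D)%Z.
  have -> : (2 * a')%:~R * (D%:~R + B%:~R * d) / 2 =
      a'%:~R * (D%:~R + B%:~R * d) by rewrite rmorphM /=; field.
  apply: integersM; first exact: integers_int.
  by apply: integersD; [|apply: integersM => //]; exact: integers_int.
have wO := integers_quad_gen; rewrite /quad_gen (negPf D2) in wO.
have [b [_ [bE _]]] := parity_odd D2.
have -> : a%:~R * (D%:~R + B%:~R * d) / 2 =
    a%:~R * ((D%:~R + d) / 2 + b%:~R * d).
  by rewrite bE rmorphD rmorphM /=; field.
apply: integersM; first exact: integers_int.
by apply: integersD => //; apply: integersM => //; exact: integers_int.
Qed.

(** The integer [al * s al] is a multiple of [d], so [A * C] is even, while [C] is odd. *)
Lemma A_even : (2 %| D)%Z -> (2 %| A)%Z.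
Proof.
move=> /parity_even[b [c [_ cE _]]].
have [||m mE] := qd_min2 qd (y := al * be).
- have alO := qd_al_int qd; apply: integersM => //; exact: integers_gen.
- by rewrite rmorphM (qd_ssal qd) mulrN mulrC.
have [|_] := d_free (u := 0) (v := A * C - 2 * m).
  rewrite add0r rmorphB !rmorphM /= mulrBl -al_be mE; ring.
by move=> e; apply/dvdzP; exists (m - A * c); rewrite cE in e; lia.
Qed.

Lemma dvd_sqr_quotient (m n k a : int) : k != 0 ->
    ~~ (2 %| D)%Z || (2 %| a)%Z ->
    (m%:~R * al + n%:~R * be) ^+ 2 * 2 =
      (k ^+ 2 * a)%:~R * (D%:~R + B%:~R * d) ->
  (k %| m)%Z /\ (k %| n)%Z.
Proof.
move=> k0 a2 e; apply: lin_div => //.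
have k0' : k%:~R != 0 :> K by rewrite intr_splitting_eq0.
suff -> : (m%:~R * al + n%:~R * be) ^+ 2 / k%:~R ^+ 2 =
    a%:~R * (D%:~R + B%:~R * d) / 2 by exact: half_integers.
transitivity ((m%:~R * al + n%:~R * be) ^+ 2 * 2 / (2 * k%:~R ^+ 2)).
  by field; rewrite k0' two0.
by rewrite e rmorphM rmorphXn /=; field; rewrite k0' two0.
Qed.

Lemma A_not_dvd4 : ~~ (2 %| D)%Z -> ~~ (4 %| A)%Z.
Proof.
move=> D2; apply/negP => /dvdzP[a aE].
have [] // := @dvd_sqr_quotient 1 0 2 a.
- by rewrite D2.
- transitivity (2 * al ^+ 2); first by ring.
  by rewrite al_sqr aE; congr (_%:~R * _); ring.
Qed.

Lemma A_half_odd : (2 %| D)%Z -> exists a, A = 2 * (2 * a + 1).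
Proof.
move=> D2; have [a' aE] := even_int (A_even D2).
have [a2|/odd_int[a ?]] := boolP (2 %| a')%Z; last by exists a; lia.
(* If 4 divided [A], the square of [(al + s al) / 2] would be integral, though 2 does not divide the
   coordinates of [al + s al]. *)
have [] // := @lin_div 1 1 2.
have [a a'E] := even_int a2; rewrite a'E in aE.
suff -> : (1%:~R * al + 1%:~R * be) ^+ 2 / 2%:~R ^+ 2 =
    a%:~R * (D%:~R + C%:~R * d).
  apply: integersM; first exact: integers_int.
  apply: integersD; first exact: integers_int.
  by apply: integersM; [exact: integers_int|exact: qd_d_int qd].
have := lin_sqr 1 1 => /(canRL (mulKf two0)) ->.
rewrite aE !rmorphM /= !(rmorphD, rmorphB, rmorphM, rmorphXn) /=; field.
by rewrite !natr_splitting_neq0.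
Qed.

(** If [p^2] divides [A], then [al / p] has integral square. If [p] divides both [A] and [D], so
    does [d al / p], and [p] divides the coordinates [B] and [C] of [d al], which are coprime. *)
Lemma A_prime_odd (p : nat) : prime p -> odd p -> (p%:Z %| A)%Z ->
  ~~ (p%:Z ^+ 2 %| A)%Z /\ ~~ (p%:Z %| D)%Z.
Proof.
move=> pp podd pA.
have p0 : p%:Z != 0 by have := prime_gt0 pp; lia.
have p1 : ~ (p%:Z %| 1)%Z.
  by rewrite dvdz1 absz_nat => /eqP p1; move: pp; rewrite p1.
have p2 (a : int) : (2 %| p%:Z * a)%Z -> (2 %| a)%Z.
  rewrite Gauss_dvdzr // /coprimez /gcdz /= eqz_nat.
  by rewrite -/(coprime 2 p) coprime2n.
have DA : ~~ (2 %| D)%Z || (2 %| A)%Z.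
  by have [/A_even ->|] := boolP (2 %| D)%Z.
split; apply/negP.
  move=> /dvdzP[a aE].
  have [] // := @dvd_sqr_quotient 1 0 p%:Z a.
  - case/orP: DA => [->//|]; rewrite aE mulrC expr2 -mulrA => /p2 /p2 ->.
    by rewrite orbT.
  - transitivity (2 * al ^+ 2); first by ring.
  by rewrite al_sqr aE; congr (_%:~R * _); ring.
move=> /dvdzP[D' D'E]; have /dvdzP[A' A'E] := pA.
have [] := @dvd_sqr_quotient B C p%:Z (D' * A') p0.
- case/orP: DA => [->//|]; rewrite A'E mulrC => /p2 A'2.
  by rewrite dvdz_mull ?orbT.
- rewrite -(qd_dal qd) exprMn (qd_dd qd) -mulrA [_ * 2]mulrC al_sqr.
  by rewrite {1}D'E A'E !rmorphM /= ?rmorphXn /=; ring.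
move=> pB pC; have : (p%:Z %| gcdz B C)%Z by rewrite dvdz_gcd pB pC.
by rewrite (eqP (qd_coprime qd)).
Qed.

End Parity.

(** * Congruences that decide how the two parts of the integers are glued *)

Lemma parityP (n : int) : exists k, n = 2 * k \/ n = 2 * k + 1.
Proof. by exists (n %/ 2)%Z; lia. Qed.

Lemma odd_sqr (n k : int) : n = 2 * k + 1 -> exists p : int, n ^+ 2 = 8 * p + 1.
Proof.
move=> ->; have [l [->|->]] := parityP k.
  by exists (2 * l ^+ 2 + l); ring.
by exists (2 * l ^+ 2 + 3 * l + 1); ring.
Qed.

Section GlueCongruences.
Variables (A B C D m n u v g h : int).

(** The two equations are the coordinates on 1 and [d] of four times the identity [(x + s (s x))^2 -
    (x - s (s x))^2 = 4 x s (s x)], where the difference [x - s (s x)] is [m al + n s al]. If [m]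
    and [n] were both odd, the second would make [u] odd and the first even. *)
Lemma glue_even_disc (a b c k : int) :
    A = 2 * (2 * a + 1) -> B = 2 * b + 1 -> C = 2 * c + 1 -> D = 4 * k + 2 ->
    (2 * u) ^+ 2 + (2 * v) ^+ 2 * D - 2 * A * (m ^+ 2 + n ^+ 2) * D = 16 * g ->
    2 * (2 * u) * (2 * v) - 2 * A * ((m ^+ 2 - n ^+ 2) * B + 2 * m * n * C) =
      16 * h ->
  (2 %| m)%Z /\ (2 %| n)%Z.
Proof.
move=> AE BE CE DE E1 E2.
have {}E1 : u ^+ 2 + v ^+ 2 * D - (2 * a + 1) * (m ^+ 2 + n ^+ 2) * D = 4 * g.
  by rewrite AE in E1; clear -E1; lia.
have {}E2 : 2 * u * v - (2 * a + 1) * ((m ^+ 2 - n ^+ 2) * B + 2 * m * n * C) =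
    4 * h by rewrite AE in E2; clear -E2; lia.
have [m' [mE|mE]] := parityP m; have [n' [nE|nE]] := parityP n.
- by rewrite mE nE !dvdz_mulr.
- by exfalso; rewrite mE nE BE in E2; clear -E2; lia.
- by exfalso; rewrite mE nE BE in E2; clear -E2; lia.
exfalso; have [p pE] := odd_sqr mE; have [q qE] := odd_sqr nE.
rewrite pE qE in E1 E2; rewrite DE in E1; rewrite mE nE BE CE in E2.
have [u' [uE|uE]] := parityP u; first by rewrite uE in E2; clear -E2; lia.
by rewrite uE in E1; clear -E1; lia.
Qed.

Lemma glue_even_sum (a b c k : int) :
    A = 2 * (2 * a + 1) -> B = 2 * b + 1 -> C = 2 * c -> D = 4 * k + 1 ->
    (2 * u + v * D) ^+ 2 + v ^+ 2 * D - 2 * A * (m ^+ 2 + n ^+ 2) * D =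
      16 * g + 8 * h * D ->
    2 * (2 * u + v * D) * v -
      2 * A * ((m ^+ 2 - n ^+ 2) * B + 2 * m * n * C) = 8 * h ->
  (2 %| m)%Z /\ (2 %| n)%Z.
Proof.
move=> AE BE CE DE e1 e2.
(* For odd [v] the left side of the second equation is 2 modulo 4. *)
have [q [vE|vE]] := parityP v; last by exfalso; rewrite AE vE DE in e2; clear -e2; lia.
pose x := u + q * D.
have F1 : x ^+ 2 + q ^+ 2 * D - (2 * a + 1) * (m ^+ 2 + n ^+ 2) * D =
    4 * g + 2 * h * D by rewrite AE vE in e1; clear -e1; rewrite /x; lia.
have F2 : 2 * x * q - (2 * a + 1) * ((m ^+ 2 - n ^+ 2) * B + 2 * m * n * C) = 2 * h.
  by rewrite AE vE in e2; clear -e2; rewrite /x; lia.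
move: (x) F1 F2 => {}x F1 F2.
have [m' [mE|mE]] := parityP m; have [n' [nE|nE]] := parityP n.
- by rewrite mE nE !dvdz_mulr.
- by exfalso; rewrite mE nE BE in F2; clear -F2; lia.
- by exfalso; rewrite mE nE BE in F2; clear -F2; lia.
exfalso; have [p pE] := odd_sqr mE; have [r rE] := odd_sqr nE.
rewrite pE rE in F1 F2; rewrite DE in F1; rewrite mE nE BE CE in F2.
have {}F2 : h = x * q - (2 * a + 1) * (4 * (p - r) * (2 * b + 1) +
  2 * (2 * m' + 1) * (2 * n' + 1) * c) by clear -F2; lia.
(* Modulo 4 the first equation has become [(x - q)^2 = 2], which is impossible. *)
have [x' [xE|xE]] := parityP x; have [q' [qE|qE]] := parityP q;
  rewrite F2 xE qE in F1; clear -F1; lia.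
Qed.

Lemma glue_odd_sum (a b c k m' n' : int) :
    A = 2 * a + 1 -> B = 2 * b + 1 -> C = 2 * c -> D = 4 * k + 1 ->
    m = 2 * m' + 1 -> n = 2 * n' + 1 ->
    (2 * u + v * D) ^+ 2 + v ^+ 2 * D - 2 * A * (m ^+ 2 + n ^+ 2) * D =
      16 * g + 8 * h * D ->
    2 * (2 * u + v * D) * v -
      2 * A * ((m ^+ 2 - n ^+ 2) * B + 2 * m * n * C) = 8 * h ->
  (4 %| A + C - 1)%Z.
Proof.
move=> AE BE CE DE mE nE e1 e2.
have [p pE] := odd_sqr mE; have [r rE] := odd_sqr nE.
have [q [vE|vE]] := parityP v; last first.
  by exfalso; rewrite AE vE pE rE DE in e1; clear -e1; lia.
pose x := u + q * D.
have F1 : x ^+ 2 + q ^+ 2 * D - A * (4 * p + 4 * r + 1) * D = 4 * g + 2 * h * D.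
  by rewrite vE pE rE in e1; clear -e1; rewrite /x; lia.
have F2 : h = x * q - A * (2 * (p - r) * B + m * n * c).
  by rewrite vE pE rE CE in e2; clear -e2; rewrite /x; lia.
move: (x) F1 F2 => {}x F1 F2.
rewrite AE BE mE nE in F2; rewrite AE DE in F1; rewrite AE CE.
(* Modulo 4 the first equation has become [(x - q)^2 = A + C], an odd square, hence 1. *)
by have [x' [xE|xE]] := parityP x; have [q' [qE|qE]] := parityP q;
  rewrite F2 xE qE in F1; clear -F1; lia.
Qed.

End GlueCongruences.

(** * Integral bases and discriminants *)

Section IntegralStructure.
Variables (K : splittingFieldType rat) (K2 : {subfield K}).
Variables (s : {rmorphism K -> K}) (d al : K) (D A B C : int).
Hypothesis gen : quartic_generator K2 s.
Hypothesis qd : quartic_data s d al D A B C.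
Implicit Types x y z : K.

Local Notation OK := (ring_of_integers {:K}%AS).
Local Notation O2 := (ring_of_integers K2).
Local Notation be := (s al).
Local Notation w := (quad_gen d D).

Let two0 : 2 != 0 :> K. Proof. exact: natr_splitting_neq0. Qed.
Let sd := qd_sd qd.
Let ssal := qd_ssal qd.

(* [quad_tr] and [quad_co] are the coordinates of [2 w] on [1] and [d]. *)
Definition quad_tr : int := if (2 %| D)%Z then 0 else D.
Definition quad_co : int := if (2 %| D)%Z then 2 else 1.

Lemma quad_gen2 : 2 * w = quad_tr%:~R + quad_co%:~R * d.
Proof.
rewrite /quad_gen /quad_tr /quad_co; case: ifP => _; first by ring.
by rewrite mulrC divfK // mul1r.
Qed.

Lemma quad_co_neq0 : quad_co != 0.
Proof. by rewrite /quad_co; case: ifP. Qed.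

Lemma ss_d : s (s d) = d. Proof. by rewrite sd rmorphN sd opprK. Qed.

Lemma ss_quad_gen : s (s w) = w.
Proof.
apply: (mulfI two0); rewrite quad_gen2.
transitivity (s (s (2 * w))); first by rewrite !rmorphM !rmorph_nat.
by rewrite quad_gen2 !rmorphD !rmorphM !rmorph_int ss_d.
Qed.

Lemma quad_gen_free (u v : int) : u%:~R + v%:~R * w = 0 -> u = 0 /\ v = 0.
Proof.
move=> e; have [] := d_free qd (u := 2 * u + v * quad_tr) (v := v * quad_co).
  rewrite rmorphD !rmorphM /=.
  transitivity (2 * (u%:~R + v%:~R * w)); last by rewrite e mulr0.
  by rewrite mulrDr [2 * (v%:~R * w)]mulrCA quad_gen2; ring.
move=> e1 /eqP; rewrite mulf_eq0 (negPf quad_co_neq0) orbF => /eqP v0.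
by move: e1; rewrite v0 mul0r addr0 => /eqP; rewrite mulf_eq0 /= => /eqP.
Qed.

Lemma integers_quadP x :
  O2 x <-> exists u v : int, x = u%:~R + v%:~R * w.
Proof.
have wO := integers_quad_gen qd.
split; last first.
  move=> [u [v ->]]; apply/(integers_quadraticP gen); split.
    by apply: integersD; last apply: integersM => //; exact: integers_int.
  by rewrite !rmorphD !rmorphM !rmorph_int ss_quad_gen.
move=> /(integers_quadraticP gen)[xO ssx]; have sxO := integers_gen s xO.
have [u uE] : exists u : int, x + s x = u%:~R.
  by apply: (integers_fixed gen); [exact: integersD|rewrite rmorphD ssx addrC].
have [v vE] : exists v : int, x - s x = v%:~R * d.
  by apply: (qd_min2 qd); [exact: integersB|rewrite rmorphB ssx opprB].
have [n nE] : exists n : int, x * s x = n%:~R.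
  by apply: (integers_fixed gen); [exact: integersM|rewrite rmorphM ssx mulrC].
have x2 : 2 * x = u%:~R + v%:~R * d by rewrite -uE -vE; ring.
have norm : u ^+ 2 - v ^+ 2 * D = 4 * n.
  apply: (@intr_splitting_inj K).
  rewrite !(rmorphXn, rmorphB, rmorphM) /= -(qd_dd qd) -nE -uE -exprMn -vE; ring.
rewrite /quad_gen; case: ifPn => D2.
  have [b [c [_ _ D4]]] := parity_even qd D2.
  have [D' DE] : exists D', D = 4 * D' + 2.
    by exists (D %/ 4)%Z; move: D2 D4; clear; lia.
  have [u' [uE'|uE']] := parityP u; last first.
    by exfalso; rewrite uE' DE in norm; clear -norm; lia.
  have [v' [vE'|vE']] := parityP v; last first.
    by exfalso; rewrite uE' vE' DE in norm; clear -norm; lia.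
  by exists u', v'; apply: (mulfI two0); rewrite x2 uE' vE' !rmorphM /=; ring.
have [k DE] := D_odd_mod4 qd D2.
have [t uvE] : exists t, u - v * D = 2 * t.
  have [u' [uE'|uE']] := parityP u; have [v' [vE'|vE']] := parityP v;
    rewrite uE' vE' DE in norm *.
  - by exists (u' - v' * (4 * k + 1)); ring.
  - by exfalso; clear -norm; lia.
  - by exfalso; clear -norm; lia.
  - by exists (u' - v' * (4 * k + 1) - 2 * k); ring.
exists t, v; apply: (mulfI two0); rewrite x2.
have -> : u = 2 * t + v * D by rewrite -uvE; ring.
by rewrite rmorphD !rmorphM /=; field.
Qed.

(** The trace and norm of [x] over K2 are integers of K2, and [x - s (s x)] is in the lattice of
    [al], [s al]. The equations relate their coordinates through trace^2 - difference^2 = 4 norm. *)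
Lemma integers_split x : OK x -> exists u v m n g h : int,
  [/\ x + s (s x) = u%:~R + v%:~R * w,
      x - s (s x) = m%:~R * al + n%:~R * be,
      (2 * u + v * quad_tr) ^+ 2 + (v * quad_co) ^+ 2 * D -
        2 * A * (m ^+ 2 + n ^+ 2) * D = 16 * g + 8 * h * quad_tr &
      2 * (2 * u + v * quad_tr) * (v * quad_co) -
        2 * A * ((m ^+ 2 - n ^+ 2) * B + 2 * m * n * C) = 8 * h * quad_co].
Proof.
move=> xO; have sxO := integers_gen s (integers_gen s xO).
have sss : s (s (s (s x))) = x := gen_order gen x.
have /integers_quadP[u [v uE]] : O2 (x + s (s x)).
  apply/(integers_quadraticP gen); split; first exact: integersD.
  by rewrite !rmorphD sss addrC.
have [||m [n yE]] := qd_min4 qd (y := x - s (s x)).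
- exact: integersB.
- by rewrite !rmorphB sss opprB.
have /integers_quadP[g [h gE]] : O2 (x * s (s x)).
  apply/(integers_quadraticP gen); split; first exact: integersM.
  by rewrite !rmorphM sss mulrC.
exists u, v, m, n, g, h.
have key : (2 * (u%:~R + v%:~R * w)) ^+ 2 -
    2 * (2 * (m%:~R * al + n%:~R * be) ^+ 2) = 16 * (g%:~R + h%:~R * w).
  by rewrite -uE -yE -gE; ring.
have rhsE : 16 * (g%:~R + h%:~R * w) = (16 * g + 8 * h * quad_tr)%:~R +
    (8 * h * quad_co)%:~R * d :> K.
  transitivity (16 * g%:~R + 8 * h%:~R * (2 * w)); first by ring.
  by rewrite quad_gen2 rmorphD !rmorphM /=; ring.
have lhsE : 2 * (u%:~R + v%:~R * w) = (2 * u + v * quad_tr)%:~R +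
    (v * quad_co)%:~R * d.
  transitivity (2 * u%:~R + v%:~R * (2 * w)); first by ring.
  by rewrite quad_gen2 rmorphD !rmorphM /=; ring.
rewrite rhsE lhsE (lin_sqr qd) in key.
have coords (E F P Q G H : int) :
    (E%:~R + F%:~R * d) ^+ 2 - 2 * (P%:~R + Q%:~R * d) = G%:~R + H%:~R * d ->
    E ^+ 2 + F ^+ 2 * D - 2 * P = G /\ 2 * E * F - 2 * Q = H.
  move=> e; have [] := d_free qd (u := E ^+ 2 + F ^+ 2 * D - 2 * P - G)
    (v := 2 * E * F - 2 * Q - H).
    rewrite !(rmorphXn, rmorphB, rmorphD, rmorphM) /= -(qd_dd qd).
    transitivity ((E%:~R + F%:~R * d) ^+ 2 - 2 * (P%:~R + Q%:~R * d) -
      (G%:~R + H%:~R * d)); first by ring.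
    by rewrite e subrr.
  by move=> /subr0_eq e1 /subr0_eq.
have [e1 e2] := coords _ _ _ _ _ _ key.
by rewrite -e1 -e2; split=> //; ring.
Qed.

(* The condition under which the integers are not just the direct sum of those
   of the quadratic subfield and of [Z al + Z be], but contain [glue_gen]. *)
Definition glue : bool :=
  [&& ~~ (2 %| D)%Z, ~~ (2 %| A)%Z & (4 %| A + C - 1)%Z].

Lemma integers_no_glue x : ~~ glue -> OK x <->
  exists u v m n : int, x = (u%:~R + v%:~R * w) + (m%:~R * al + n%:~R * be).
Proof.
move=> nog; split; last first.
  move=> [u [v [m [n ->]]]]; apply: integersD; last exact: (integers_lin qd).
  apply: integersD; last apply: integersM; try exact: integers_int.
  exact: (integers_quad_gen qd).
move=> xO; have [u [v [m [n [g [h [uE yE E1 E2]]]]]]] := integers_split xO.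
suff [/even_int[m' mE] /even_int[n' nE]] : (2 %| m)%Z /\ (2 %| n)%Z.
  have : O2 (x - (m'%:~R * al + n'%:~R * be)).
    apply/(integers_quadraticP gen); split.
      by apply: integersB => //; exact: (integers_lin qd).
    have -> : x - (m'%:~R * al + n'%:~R * be) = (x + s (s x)) / 2.
      apply: (mulfI two0); rewrite [RHS]mulrC divfK //.
      transitivity (2 * x - (m%:~R * al + n%:~R * be)).
        by rewrite mE nE !rmorphM /=; ring.
      by rewrite -yE; ring.
    rewrite !fmorph_div !rmorph_nat; congr (_ / _).
    by rewrite !rmorphD (gen_order gen) addrC.
  move=> /integers_quadP[u' [v' e]]; exists u', v', m', n'.
  by rewrite -e subrK.
have [D2|D2] := boolP (2 %| D)%Z.
  have [b [c [bE cE D4]]] := parity_even qd D2.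
  have [a aE] := A_half_odd qd D2.
  rewrite /quad_tr /quad_co D2 !mulr0 !addr0 in E1 E2.
  have [D' DE] : exists D', D = 4 * D' + 2.
    by exists (D %/ 4)%Z; move: D2 D4; clear; lia.
  apply: (glue_even_disc aE bE cE DE (u := u) (v := v) (g := g) (h := h)).
    by rewrite -E1; ring.
  by transitivity (8 * h * 2); [rewrite -E2|]; ring.
have [b [c [bE cE]]] := parity_odd qd D2; have [k kE] := D_odd_mod4 qd D2.
have [A2|A2] := boolP (2 %| A)%Z.
  have [a aE] : exists a, A = 2 * (2 * a + 1).
    exists (A %/ 4)%Z; move: A2 (A_not_dvd4 qd D2); clear; lia.
  rewrite /quad_tr /quad_co (negPf D2) !mulr1 in E1 E2.
  exact: (glue_even_sum aE bE cE kE E1 E2).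
have [a aE] := odd_int A2.
have A4 : ~~ (4 %| A + C - 1)%Z by move: nog; rewrite /glue D2 A2.
(* The congruence lemma excludes two odd coordinates for every integer, not just [x]; this is also
   applied to [x + s x]. *)
have not_odd z m1 n1 : OK z ->
    z - s (s z) = (2 * m1 + 1)%:~R * al + (2 * n1 + 1)%:~R * be -> False.
  move=> zO zE.
  have [u' [v' [m2 [n2 [g' [h' [_ yE' E1' E2']]]]]]] := integers_split zO.
  have [|m2E n2E] := qd_free qd (m := m2 - (2 * m1 + 1)) (n := n2 - (2 * n1 + 1)).
    rewrite rmorphB [X in _ + X * _]rmorphB /= !mulrBl addrACA -opprD -yE' -zE.
    by rewrite subrr.
  rewrite /quad_tr /quad_co (negPf D2) !mulr1 in E1' E2'.
  by move/negP: A4; apply; apply: (glue_odd_sum aE bE cE kE (subr0_eq m2E)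
    (subr0_eq n2E) E1' E2').
have [m' [mE|mE]] := parityP m; have [n' [nE|nE]] := parityP n.
- by rewrite mE nE !dvdz_mulr.
(* Passing from [x] to [x + s x] multiplies [m + n i] by [1 + i], which turns unequal parities into
   two odd coordinates. *)
- exfalso; apply: (not_odd (x + s x) (m' - n' - 1) (m' + n')).
    by apply: integersD => //; exact: integers_gen.
  transitivity ((x - s (s x)) + s (x - s (s x))).
    by rewrite !(rmorphD, rmorphN); ring.
  by rewrite yE rmorphD !rmorphM !rmorph_int ssal mE nE
    !(rmorphD, rmorphB, rmorphM) /=; ring.
- exfalso; apply: (not_odd (x + s x) (m' - n') (m' + n')).
    by apply: integersD => //; exact: integers_gen.
  transitivity ((x - s (s x)) + s (x - s (s x))).
    by rewrite !(rmorphD, rmorphN); ring.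
  by rewrite yE rmorphD !rmorphM !rmorph_int ssal mE nE
    !(rmorphD, rmorphB, rmorphM) /=; ring.
- by exfalso; apply: (not_odd x m' n') => //; rewrite yE mE nE.
Qed.

(** A candidate integer with [x - s (s x) = al]. The coefficient [A * B] is the one for which the
    norm over K2 has no component along [d]. *)
Definition glue_gen : K := (1 + (A * B)%:~R * d + 2 * al) / 4.

Lemma integers_glue_gen : glue -> OK glue_gen.
Proof.
move=> /and3P[D2 A2 /dvdzP[q AC]].
have [b [c [bE cE]]] := parity_odd qd D2; have [k kE] := D_odd_mod4 qd D2.
have [a aE] := odd_int A2.
have four0 : 4 != 0 :> K := natr_splitting_neq0 K 3.
have ABd2 : OK ((1 + (A * B)%:~R * d) / 2).
  have wO := integers_quad_gen qd; rewrite /quad_gen (negPf D2) in wO.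
  have -> : (1 + (A * B)%:~R * d) / 2 =
      (A * B)%:~R * ((D%:~R + d) / 2) - (b * A * D + a * D + 2 * k)%:~R.
    rewrite bE aE kE !(rmorphD, rmorphM) /=; field.
    by rewrite two0.
  by apply: integersB; [apply: integersM => //|]; exact: integers_int.
(* The left side is 16 times the norm of [glue_gen] over K2, rewritten with [B^2 = D - C^2]; the
   congruence for [A + C] makes it divisible by 16. *)
have [t tE] : exists t, (A * D - 1) ^+ 2 - C ^+ 2 * (A ^+ 2 * D) = 16 * t.
  have CE : C = 4 * q + 1 - A by clear -AC; lia.
  (* Here [A D - 1 = 2 a + 4 X], [C^2 = 4 a^2 + 16 Y] and [A^2 D = 1 + 4 J]. *)
  pose X := 2 * a * k + k; pose Y := q ^+ 2 - a * q.
  pose J := k * (4 * a ^+ 2 + 4 * a + 1) + a ^+ 2 + a.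
  exists (a * X + X ^+ 2 - Y - J * a ^+ 2 - 4 * Y * J).
  by rewrite CE aE kE /X /Y /J; ring.
apply: (integers_quadratic_root (b := (1 + (A * B)%:~R * d) / 2) (c := t%:~R)).
- exact: ABd2.
- exact: integers_int.
have e : 16 * t%:~R = 1 + A%:~R ^+ 2 * B%:~R ^+ 2 * D%:~R - 2 * A%:~R * D%:~R :> K.
  transitivity ((16 * t)%:~R : K); first by rewrite rmorphM.
  rewrite -tE; have -> : C ^+ 2 = D - B ^+ 2 by rewrite (qd_DE qd); ring.
  by rewrite !(rmorphXn, rmorphD, rmorphB, rmorphM) /=; ring.
apply: (mulfI (natr_splitting_neq0 K 15)); rewrite mulr0 mulrDr e.
transitivity (2 * (2 * al ^+ 2) - (1 + (A * B)%:~R * d) ^+ 2 +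
  (1 + A%:~R ^+ 2 * B%:~R ^+ 2 * D%:~R - 2 * A%:~R * D%:~R)).
  by rewrite /glue_gen; field; rewrite four0 two0.
rewrite (al_sqr qd) -(qd_dd qd) rmorphM /=; ring.
Qed.

Lemma ss_glue_gen : s (s glue_gen) = glue_gen - al.
Proof.
rewrite /glue_gen !fmorph_div !rmorph_nat !rmorphD !rmorphM !rmorph_nat !rmorph_int.
rewrite !rmorph1 ss_d ssal; field; exact: (natr_splitting_neq0 K 3).
Qed.

(** Combinations of [glue_gen] and its conjugate realize every possible value of [x - s (s x)];
    subtracting one leaves an integer of K2. *)
Lemma integers_glue x : glue -> OK x <->
  exists u v m n : int,
    x = (u%:~R + v%:~R * w) + (m%:~R * glue_gen + n%:~R * s glue_gen).
Proof.
move=> gl; have thO := integers_glue_gen gl; have sthO := integers_gen s thO.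
split; last first.
  move=> [u [v [m [n ->]]]]; apply: integersD; apply: integersD.
  - exact: integers_int.
  - by apply: integersM; [exact: integers_int|exact: (integers_quad_gen qd)].
  - by apply: integersM => //; exact: integers_int.
  - by apply: integersM => //; exact: integers_int.
move=> xO; have [||m [n yE]] := qd_min4 qd (y := x - s (s x)).
- by apply: integersB => //; apply: integers_gen; exact: integers_gen.
- by rewrite !rmorphB (gen_order gen) opprB.
have : O2 (x - (m%:~R * glue_gen + n%:~R * s glue_gen)).
  apply/(integers_quadraticP gen); split.
    apply: integersB => //; apply: integersD; apply: integersM => //.
      exact: integers_int.
    exact: integers_int.
  have sth := ss_glue_gen.
  move: glue_gen sth => th sth.
  rewrite !rmorphB !rmorphD !rmorphM !rmorph_int sth rmorphB.
  transitivity (s (s x) + (m%:~R * al + n%:~R * be) -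
    (m%:~R * th + n%:~R * s th)); first by ring.
  by rewrite -yE; ring.
move=> /integers_quadP[u [v e]]; exists u, v, m, n.
by rewrite -e subrK.
Qed.

Local Notation co := quad_co.
Local Notation tr := quad_tr.
Local Notation gl := glue.
Local Notation th := glue_gen.

Lemma quad_gen_tr : w + s w = tr%:~R.
Proof.
apply: (mulfI two0).
transitivity (2 * w + s (2 * w)); first by rewrite rmorphM rmorph_nat; ring.
by rewrite quad_gen2 rmorphD rmorphM !rmorph_int sd; ring.
Qed.

Lemma quad_gen_diff : w - s w = co%:~R * d.
Proof.
apply: (mulfI two0).
transitivity (2 * w - s (2 * w)); first by rewrite rmorphM rmorph_nat; ring.
by rewrite quad_gen2 rmorphD rmorphM !rmorph_int sd; ring.
Qed.

Definition quad_basis : (\dim K2).-tuple K := tcast (esym (gen_dim2 gen)) [tuple 1; w].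

Lemma quad_basis_integral : integral_basis quad_basis.
Proof.
apply: integral_basis2 => [u v|x].
  by rewrite mulr1; exact: quad_gen_free.
rewrite integers_quadP.
by split=> -[u [v ->]]; exists u, v; rewrite mulr1.
Qed.

Lemma det_quad_basis : \det (gram quad_basis) = (co ^+ 2 * D)%:~R.
Proof.
rewrite /quad_basis det_gram_tcast det_mx22 !mxE !(tnth_nth 0) /= !mul1r !mulr1.
have wK : w \in K2 by rewrite (gen_fix2 gen) ss_quad_gen.
rewrite !(gen_trace2 gen) ?rpredM ?rpred1 // rmorph1 rmorphM.
rewrite rmorphM rmorphXn /= -(qd_dd qd) -exprMn -quad_gen_diff; ring.
Qed.

Lemma disc_quad : disc K2 = co ^+ 2 * D.
Proof.
apply: (disc_eq (gen_galois2 gen) quad_basis_integral).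
by rewrite det_quad_basis.
Qed.

Definition split_family : (\dim {:K}%AS).-tuple K :=
  tcast (esym (gen_dim gen)) [tuple 1; w; al; be].

Lemma trace_quad x : s (s x) = x -> galTrace 1%AS {:K}%AS x = 2 * (x + s x).
Proof. by move=> ssx; rewrite (gen_trace gen) ssx; ring. Qed.

Lemma trace_anti x : s (s x) = - x -> galTrace 1%AS {:K}%AS x = 0.
Proof. by move=> ssx; rewrite (gen_trace gen) ssx rmorphN; ring. Qed.

(** The eigenspaces of [s \o s] are orthogonal for the trace form, so the Gram matrix has two
    diagonal blocks. *)
Lemma det_split_family :
  \det (gram split_family) = (16 * co ^+ 2 * A ^+ 2 * D ^+ 3)%:~R.
Proof.
have ssw := ss_quad_gen.
have sswal : s (s (w * al)) = - (w * al) by rewrite !rmorphM ssw ssal mulrN.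
have sswbe : s (s (w * be)) = - (w * be) by rewrite !rmorphM ssw ssal rmorphN mulrN.
have ssbe : s (s be) = - be by rewrite ssal rmorphN.
rewrite /split_family det_gram_tcast det_block_diag; last first.
  apply/matrixP => i j; rewrite !mxE !(tnth_nth 0).
  have [] : (i = 0 \/ i = 1) /\ (j = 0 \/ j = 1).
    by split; [case: i => -[|[|]] // ?; [left|right]
      |case: j => -[|[|]] // ?; [left|right]]; apply/val_inj.
  by move=> [->|->] [->|->] /=; rewrite ?mul1r trace_anti.
rewrite !det_mx22 !mxE !(tnth_nth 0) /= !mul1r !mulr1.
have ssal2 : s (s (al * al)) = al * al by rewrite !rmorphM ssal mulrNN.
have ssbe2 : s (s (be * be)) = be * be by rewrite !rmorphM ssbe mulrNN.
have ssalbe : s (s (al * be)) = al * be.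
  by rewrite !rmorphM ssbe ssal mulrNN.
have ssw2 : s (s (w * w)) = w * w by rewrite !rmorphM ssw.
have ss1 : s (s 1) = 1 by rewrite !rmorph1.
rewrite [be * al]mulrC !trace_quad // rmorph1 ![s (_ * _)]rmorphM ssal.
have -> : (16 * co ^+ 2 * A ^+ 2 * D ^+ 3)%:~R =
    16 * (w - s w) ^+ 2 * (al ^+ 2 + be ^+ 2) ^+ 2 :> K.
  rewrite quad_gen_diff (qd_sum qd) exprMn (qd_dd qd) !(rmorphXn, rmorphM) /=.
  by ring.
ring.
Qed.

Lemma split_free (u v m n : int) :
  u%:~R * 1 + v%:~R * w + m%:~R * al + n%:~R * be = 0 ->
  [/\ u = 0, v = 0, m = 0 & n = 0].
Proof.
move=> e.
have ssw := ss_quad_gen.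
have e' := congr1 s (congr1 s e).
rewrite !rmorphD !rmorphM !rmorph_int !rmorph1 ssw !rmorph0 ssal rmorphN in e'.
have [] := quad_gen_free (u := u) (v := v).
  apply: (mulfI two0); rewrite mulr0 -[RHS]addr0 -{1}e -e'; ring.
have [] := qd_free qd (m := m) (n := n).
  apply: (mulfI two0); rewrite mulr0 -[RHS]subr0 -{1}e -e'; ring.
by [].
Qed.

Lemma glue_gen_eq (e0 : int) : 2 * e0 = 1 - A * B * D -> ~~ (2 %| D)%Z ->
  al = (- e0)%:~R * 1 + (- (A * B))%:~R * w + 2%:~R * th.
Proof.
move=> e0E D2; apply: (mulfI two0).
have -> : 2 * ((- e0)%:~R * 1 + (- (A * B))%:~R * w + 2%:~R * th) =
  - (2 * e0)%:~R - (A * B)%:~R * (2 * w) + 4 * th :> K.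
  by rewrite !(rmorphM, rmorphN) /=; ring.
rewrite e0E quad_gen2 /quad_tr /quad_co (negPf D2) /glue_gen.
rewrite [4 * _]mulrC divfK ?natr_splitting_neq0 // !(rmorphM, rmorphB) /=; ring.
Qed.

Lemma glue_half : gl -> exists e0, 2 * e0 = 1 - A * B * D.
Proof.
move=> /and3P[D2 A2 _]; have [b [c [bE _]]] := parity_odd qd D2.
have [k kE] := D_odd_mod4 qd D2; have [a aE] := odd_int A2.
exists (- ((2 * a * b + a + b) * (4 * k + 1) + 2 * k)).
by rewrite bE aE kE; ring.
Qed.

Lemma glue_gen_conj_eq (e0 : int) : 2 * e0 = 1 - A * B * D -> ~~ (2 %| D)%Z ->
  be = (e0 - 1)%:~R * 1 + (A * B)%:~R * w + 2%:~R * s th.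
Proof.
move=> e0E D2; rewrite [in LHS](glue_gen_eq e0E D2).
have sw : s w = D%:~R - w.
  by have := quad_gen_tr; rewrite /quad_tr (negPf D2) => <-; ring.
have e1 : D%:~R * (A * B)%:~R = 1 - 2 * e0%:~R :> K.
  rewrite -rmorphM /=; have -> : D * (A * B) = 1 - 2 * e0 by rewrite e0E; ring.
  by rewrite rmorphB rmorphM.
move: (th) => t; rewrite !rmorphD !rmorphM !rmorph_int rmorph1 sw.
rewrite !(rmorphN, rmorphB) /= mulrBr !mulNr [_ * D%:~R]mulrC e1; ring.
Qed.

Definition glued_family : (\dim {:K}%AS).-tuple K :=
  tcast (esym (gen_dim gen)) [tuple 1; w; th; s th].

(** The split family spans a sublattice of index 4, expressed by the triangular matrix [N], so its
    determinant is 16 times as large. *)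
Lemma det_glued_family : gl ->
  \det (gram glued_family) = (A ^+ 2 * D ^+ 3)%:~R.
Proof.
move=> gl_true; have [D2 _ _] := and3P gl_true.
have [e0 e0E] := glue_half gl_true.
pose N : 'M[int]_4 := \matrix_(i, j) nth 0 (nth [::] [:: [:: 1; 0; 0; 0];
  [:: 0; 1; 0; 0]; [:: - e0; - (A * B); 2; 0]; [:: e0 - 1; A * B; 0; 2]] i) j.
have detN : \det N = 4.
  rewrite det_trig; last first.
    apply/is_trig_mxP => i j.
    by case: i => -[|[|[|[|]]]] // ?; case: j => -[|[|[|[|]]]] // ?; rewrite mxE.
  by rewrite !big_ord_recl big_ord0 !mxE.
have change n (t t' : n.-tuple K) (e : n = \dim {:K}%AS) (M : 'M[int]_n) :
    (forall i, tnth t' i = \sum_j (M i j)%:~R * tnth t j) ->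
    \det (gram (tcast e t')) = (\det M)%:~R ^+ 2 * \det (gram (tcast e t)).
  by move=> H; subst n; exact: gram_change.
apply: (mulfI (expf_neq0 2 (natr_splitting_neq0 K 3))).
have <- : (\det N)%:~R ^+ 2 = 4 ^+ 2 :> K by rewrite detN.
rewrite /glued_family -(change _ _ [tuple 1; w; al; be]).
  rewrite -/split_family det_split_family detN.
  by rewrite /quad_co (negPf D2) !(rmorphM, rmorphXn) /=; ring.
move=> i; rewrite !big_ord_recl big_ord0 !mxE !(tnth_nth 0) /=.
case: i => -[|[|[|[|]]]] //= ?; rewrite ?mulr0z ?mulr1z ?mul0r ?mul1r ?add0r ?addr0 //.
- by rewrite [in LHS](glue_gen_eq e0E D2) mulr1 !addrA.
- by rewrite [in LHS](glue_gen_conj_eq e0E D2) mulr1 !addrA.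
Qed.

Lemma integral_basis_split : ~~ gl -> integral_basis split_family.
Proof.
move=> nog; apply: integral_basis4 => [u v m n|x]; first exact: split_free.
rewrite integers_no_glue //.
by split=> -[u [v [m [n ->]]]]; exists u, v, m, n; rewrite mulr1 !addrA.
Qed.

Lemma integral_basis_glued : gl -> integral_basis glued_family.
Proof.
move=> gl_true; have [D2 _ _] := and3P gl_true.
apply: integral_basis4 => [u v m n|x]; last first.
  rewrite integers_glue //.
  by split=> -[u [v [m [n ->]]]]; exists u, v, m, n; rewrite mulr1 !addrA.
move=> e.
have sth : s (s th) = th - al := ss_glue_gen.
have ssw := ss_quad_gen.
have [] := qd_free qd (m := m) (n := n).
  have e' := congr1 s (congr1 s e); move: e e'; move: (th) sth => t sth e.
  rewrite !rmorphD !rmorphM !rmorph_int !rmorph1 ssw !rmorph0 sth rmorphB => e'.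
  by rewrite -[RHS]subr0 -{1}e -e'; ring.
move=> m0 n0; rewrite m0 n0 !mul0r !addr0 mulr1 in e.
by have [-> ->] := quad_gen_free e.
Qed.

Lemma disc_quartic : disc {:K}%AS =
  if gl then A ^+ 2 * D ^+ 3 else 16 * co ^+ 2 * A ^+ 2 * D ^+ 3.
Proof.
case: ifPn => g.
  apply: (disc_eq (gen_galois gen) (integral_basis_glued g)).
  by rewrite det_glued_family.
apply: (disc_eq (gen_galois gen) (integral_basis_split g)).
by rewrite det_split_family.
Qed.

(** * Ramified primes *)

Lemma exists_prime_above (E : {subfield K}) (p : nat) : prime p ->
  exists2 Q, prime_ideal E Q & Q p%:R.
Proof.
move=> pp.
have one : ring_of_integers E 1 := integers_int E 1.
pose I := [set x | exists2 y, ring_of_integers E y & x = p%:R * y].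
have HI : is_ideal E I.
  split.
  - by move=> _ [y yE ->]; apply: integersM => //; exact: integers_nat.
  - by exists 0; [exact: (integers_int E 0)|rewrite mulr0].
  - move=> _ _ [y yE ->] [z zE ->].
    by exists (y + z); [exact: integersD|rewrite mulrDr].
  - move=> a _ aE [y yE ->].
    by exists (a * y); [exact: integersM|rewrite mulrCA].
have [|Q HQ IQ] := exists_prime_ideal HI.
  move=> [y [_ yi] e].
  have p0 : p%:R != 0 :> K.
    by rewrite -[p%:R]/(p%:Z%:~R) intr_splitting_eq0 eqz_nat -lt0n prime_gt0.
  have [n nE] : exists n : int, y = n%:~R.
    apply: integers_rat => //.
    have -> : y = p%:R^-1 by rewrite -[RHS]mulr1 [X in _ = _ * X]e mulKf.
    by rewrite rpredV rpred_nat.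
  move: e; rewrite nE -[p%:R]/(p%:Z%:~R) -rmorphM /= -[1]/(1%:~R).
  move=> /intr_splitting_inj e.
  have : (p%:Z %| 1)%Z by apply/dvdzP; exists n; rewrite mulrC.
  by rewrite dvdz1 absz_nat => /eqP p1; move: pp; rewrite p1.
by exists Q => //; apply: IQ; exists 1 => //; rewrite mulr1.
Qed.

(** Used for the square [J] of a prime ideal containing [p]: to put [p] in [J] it suffices to find
    there an integer that [p] divides exactly once. *)
Lemma ideal_prime_mult (E : {subfield K}) (J : set K) (p : nat) (n : int) :
    prime p -> is_ideal E J -> J (p%:Z ^+ 2)%:~R -> J (p%:Z * n)%:~R ->
  ~~ (p%:Z %| n)%Z -> J p%:R.
Proof.
move=> pp HJ Jp2 Jpn pn; have [_ _ JD JM] := HJ.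
have /coprimezP[[u v] /= uv] : coprimez p%:Z n.
  by rewrite /coprimez /gcdz absz_nat eqz_nat -/(coprime _ _) prime_coprime.
have -> : p%:R = u%:~R * (p%:Z ^+ 2)%:~R + v%:~R * (p%:Z * n)%:~R :> K.
  rewrite -!rmorphM -rmorphD /= -[p%:R]/(p%:Z%:~R); congr _%:~R.
  by rewrite -[LHS]mulr1 -uv; ring.
by apply: JD; apply: JM => //; exact: integers_int.
Qed.

Lemma D_sqfree (p : nat) : prime p -> ~~ (p%:Z ^+ 2 %| D)%Z.
Proof.
move=> pp; apply/negP => /dvdzP[q DE].
have p0 : p%:Z%:~R != 0 :> K.
  by rewrite intr_splitting_eq0 eqz_nat -lt0n prime_gt0.
have [||m mE] := qd_min2 qd (y := d / p%:Z%:~R).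
- apply: integers_sqrt; rewrite expr_div_n (qd_dd qd) DE rmorphM rmorphXn /=.
  by rewrite mulfK ?expf_neq0 //; exact: integers_int.
- by rewrite fmorph_div rmorph_int sd mulNr.
have gm : p%:Z * m = 1.
  apply: (@intr_splitting_inj K); apply: (mulIf (qd_d_neq0 qd)).
  by rewrite mul1r rmorphM /= -mulrA -mE mulrC divfK.
have : (p%:Z %| 1)%Z by apply/dvdzP; exists m; rewrite mulrC; exact: esym.
by rewrite dvdz1 absz_nat => /eqP p1; move: pp; rewrite p1.
Qed.

Lemma ramifies_quad_dvd (p : nat) : prime p -> (p%:Z %| D)%Z ->
  ramifies 1%AS K2 p.
Proof.
move=> pp /dvdzP[q DE]; have [Q HQ Qp] := exists_prime_above K2 pp.
have [HQi _ _] := HQ; have HQQ := ideal_mul_ideal HQi HQi.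
have [QE _ _ QM] := HQi.
apply: (square_mem_ramifies pp HQ).
apply: (ideal_prime_mult (n := q) pp HQQ).
- by rewrite rmorphXn expr2; exact: ideal_mul_incl.
- have dO : O2 d.
    by apply/(integers_quadraticP gen); split; [exact: qd_d_int qd|exact: ss_d].
  have Qd : Q d.
    apply: (prime_ideal_pow (n := 2) HQ dO).
    by rewrite (qd_dd qd) DE rmorphM /=; apply: QM => //; exact: integers_int.
  by rewrite mulrC -DE -(qd_dd qd) expr2; exact: ideal_mul_incl.
- apply: contra (D_sqfree pp) => /dvdzP[r rE].
  by apply/dvdzP; exists r; rewrite DE rE; ring.
Qed.

Lemma ramifies_quadP (p : nat) : prime p ->
  ramifies 1%AS K2 p <-> (p%:Z %| D)%Z.
Proof.
move=> pp; split; last exact: ramifies_quad_dvd.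
move=> ram; apply: contrapT => /negP pD.
have [D2|D2] := boolP (p%:Z %| co ^+ 2 * D)%Z; last first.
  apply: (unramified_disc (gen_galois2 gen) quad_basis_integral
    (esym det_quad_basis) pp _ ram).
  by rewrite /coprimez /gcdz absz_nat eqz_nat -/(coprime _ _) prime_coprime.
(* The factor [co] is 2 only when [D] is even, so it brings no prime that does not divide [D]. *)
move: D2 pD; rewrite /quad_co; case: ifPn => D2; last by rewrite expr1n mul1r => ->.
have [p2|p2] := boolP (p%:Z == 2); first by rewrite (eqP p2) D2.
have cop : coprimez p%:Z (2 ^+ 2).
  rewrite /coprimez /gcdz /= eqz_nat -/(coprime p (2 ^ 2)) coprimeXr //.
  by rewrite prime_coprime // dvdn_prime2 //; apply: contra p2 => /eqP ->.
by rewrite Gauss_dvdzr // => ->.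
Qed.

Lemma al_conj_mem (Q : set K) (p : nat) : prime_ideal {:K}%AS Q -> Q p%:R ->
    (exists2 y, OK y & al ^+ 2 = p%:R * y) ->
    (exists2 y, OK y & be ^+ 2 = p%:R * y) ->
  ideal_mul {:K}%AS Q Q (A * D)%:~R.
Proof.
move=> HQ Qp [y yO alE] [z zO beE].
have [HQi _ _] := HQ; have HQQ := ideal_mul_ideal HQi HQi.
have [_ _ QQD _] := HQQ; have [_ _ _ QM] := HQi.
have alO := qd_al_int qd; have beO := integers_gen s alO.
have Qal : Q al.
  by apply: (prime_ideal_pow (n := 2) HQ alO); rewrite alE mulrC; exact: QM.
have Qbe : Q be.
  by apply: (prime_ideal_pow (n := 2) HQ beO); rewrite beE mulrC; exact: QM.
by rewrite -(qd_sum qd) !expr2; apply: QQD; exact: ideal_mul_incl.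
Qed.

(** Since [p] divides [A] once and is prime to [D], it divides [A D = al^2 + (s al)^2] exactly once;
    and it is unramified in K2, so that membership in the square suffices for the relative
    extension. *)
Lemma ramifies_rel_odd (p : nat) : prime p -> odd p -> (p%:Z %| A)%Z ->
  ramifies K2 {:K}%AS p.
Proof.
move=> pp podd pA; have [pA2 pD] := A_prime_odd qd pp podd pA.
have [Q HQ Qp] := exists_prime_above {:K}%AS pp.
have [HQi _ _] := HQ; have HQQ := ideal_mul_ideal HQi HQi.
have /dvdzP[q AE] := pA.
have cop2 : coprimez p%:Z 2.
  by rewrite /coprimez /gcdz /= eqz_nat -/(coprime p 2) coprimen2.
apply: (square_mem_ramifies_rel (subvf K2) (gen_galois2 gen)
  quad_basis_integral (esym det_quad_basis) pp _ HQ).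
  rewrite coprimezMr; apply/andP; split.
    rewrite coprimezXr // /quad_co; case: ifP => // _.
    by rewrite /coprimez /gcdz /= gcdn1.
  by rewrite /coprimez /gcdz absz_nat eqz_nat -/(coprime _ _) prime_coprime.
apply: (ideal_prime_mult (n := q * D) pp HQQ).
- by rewrite rmorphXn expr2; exact: ideal_mul_incl.
- have -> : p%:Z * (q * D) = A * D by rewrite AE; ring.
  (* Cancels the factor 2 by writing [p = 2 k + 1]: then [x^2 = p x^2 - k p y]. *)
  have half (x : K) (y : K) : OK x -> OK y -> 2 * x ^+ 2 = p%:R * y ->
      exists2 y, OK y & x ^+ 2 = p%:R * y.
    have [k kE] : exists k : int, 2 * k + 1 = p%:Z.
      by exists (p./2%:Z); rewrite -[in RHS](odd_double_half p) podd -muln2; lia.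
    move=> xO yO e; exists (x ^+ 2 - k%:~R * y).
      apply: integersB; first exact: integersX.
      by apply: integersM => //; exact: integers_int.
    rewrite mulrBr [p%:R * (_ * y)]mulrCA -e -[p%:R]/(p%:Z%:~R) -kE.
    by rewrite rmorphD rmorphM /=; ring.
  have dO := qd_d_int qd; have alO := qd_al_int qd.
  have BdO : OK (B%:~R * d) by apply: integersM => //; exact: integers_int.
  apply: (al_conj_mem HQ Qp).
    apply: (half al (q%:~R * (D%:~R + B%:~R * d))) => //.
      apply: integersM; first exact: integers_int.
      by apply: integersD => //; exact: integers_int.
    by rewrite (al_sqr qd) AE rmorphM /= mulrA; congr (_ * _); rewrite mulrC.
  apply: (half be (q%:~R * (D%:~R - B%:~R * d))) => //.
  + exact: integers_gen.
  + apply: integersM; first exact: integers_int.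
    by apply: integersB => //; exact: integers_int.
  by rewrite (be_sqr qd) AE rmorphM /= mulrA; congr (_ * _); rewrite mulrC.
- have pq : ~~ (p%:Z %| q)%Z.
    apply: contra pA2 => /dvdzP[r rE]; apply/dvdzP; exists r.
    by rewrite AE rE; ring.
  apply: contra pq; rewrite mulrC Gauss_dvdzr //.
  by rewrite /coprimez /gcdz absz_nat eqz_nat -/(coprime _ _) prime_coprime.
Qed.

Lemma ramifies2_glue : gl -> ~ ramifies 1%AS {:K}%AS 2.
Proof.
move=> g; have /and3P[D2 A2 _] := g.
apply: (unramified_disc (gen_galois gen) (integral_basis_glued g)
  (esym (det_glued_family g))) => //.
have odd2 (n : int) : ~~ (2 %| n)%Z -> coprimez 2 n.
  by rewrite /coprimez /gcdz eqz_nat -/(coprime _ _) prime_coprime.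
by rewrite coprimezMr; apply/andP; split; rewrite coprimezXr //; exact: odd2.
Qed.

(** An integer divisible by 2 but not by 4 is found in the square of [Q]. For even [D] it is
    [D = d^2], and for odd [D] and even [A] it is [A D]. If both are odd, [al + s al - 1] lies in
    [Q] and serves instead. *)
Lemma ramifies2_no_glue : ~~ gl -> ramifies 1%AS {:K}%AS 2.
Proof.
move=> nog; have p2 : prime 2 by [].
have [Q HQ Q2] := exists_prime_above {:K}%AS p2.
have [HQi _ _] := HQ; have HQQ := ideal_mul_ideal HQi HQi.
have [_ _ QQD QQM] := HQQ; have [_ _ QD QM] := HQi.
apply: (square_mem_ramifies p2 HQ).
have QQ4 : ideal_mul {:K}%AS Q Q (2%:Z ^+ 2)%:~R.
  by rewrite rmorphXn expr2; exact: ideal_mul_incl.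
have QQ4M y : OK y -> ideal_mul {:K}%AS Q Q (4 * y).
  by move=> yO; rewrite mulrC; apply: QQM.
have Q2M y : OK y -> Q (2 * y) by move=> yO; rewrite mulrC; exact: QM.
have dO := qd_d_int qd; have alO := qd_al_int qd; have beO := integers_gen s alO.
have intO (n : int) : OK n%:~R := integers_int _ n.
have [D2|D2] := boolP (2 %| D)%Z.
  have [_ [_ [_ _ D4]]] := parity_even qd D2.
  have [D' D'E] := even_int D2.
  have Qd : Q d.
    apply: (prime_ideal_pow (n := 2) HQ dO).
    by rewrite (qd_dd qd) D'E rmorphM; exact: Q2M (intO _).
  apply: (ideal_prime_mult (n := D') p2 HQQ QQ4).
    by rewrite -[_ * D']D'E -(qd_dd qd) expr2; exact: ideal_mul_incl.
  by apply: contra D4 => /even_int[r rE]; apply/dvdzP; exists r; rewrite D'E rE; ring.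
have [k kE] := D_odd_mod4 qd D2; have [b [c [bE cE]]] := parity_odd qd D2.
have [A2|A2] := boolP (2 %| A)%Z.
  have [a aE] := even_int A2.
  apply: (ideal_prime_mult (n := a * D) p2 HQQ QQ4); last first.
    have a2 : ~~ (2 %| a)%Z.
      apply: contra (A_not_dvd4 qd D2) => /even_int[r rE]; apply/dvdzP.
      by exists r; rewrite aE rE; ring.
    apply: contra D2; rewrite Gauss_dvdzr //.
    by rewrite /coprimez /gcdz absz_nat eqz_nat -/(coprime _ _) prime_coprime.
  have -> : 2%:Z * (a * D) = A * D by rewrite aE; ring.
  have hO : OK ((D%:~R + B%:~R * d) / 2).
    have := half_integers qd (a := 1); rewrite D2 mul1r; exact.
  apply: (al_conj_mem HQ Q2).
    exists (a%:~R * ((D%:~R + B%:~R * d) / 2)); first exact: integersM.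
    by apply: (mulfI two0); rewrite (al_sqr qd) aE rmorphM /=; field.
  exists (a%:~R * (D%:~R - (D%:~R + B%:~R * d) / 2)).
    by apply: integersM => //; exact: integersB.
  by apply: (mulfI two0); rewrite (be_sqr qd) aE rmorphM /=; field.
have [a aE] := odd_int A2.
have ac : ~~ (2 %| a + c)%Z.
  move: nog; rewrite /glue D2 A2 /= aE cE; apply: contra => /even_int[r rE].
  by apply/dvdzP; exists r; clear -rE; lia.
pose z := al + be.
have zO : OK z by exact: integersD.
have zz : z ^+ 2 = A%:~R * D%:~R + A%:~R * C%:~R * d.
  transitivity ((al ^+ 2 + be ^+ 2) + 2 * (al * be)); first by rewrite /z; ring.
  by rewrite (qd_sum qd) (al_be qd) rmorphM.
have e1 : (z - 1) ^+ 2 = 2 * (a%:~R * D%:~R + 2 * k%:~R + 1 + A%:~R * c%:~R * d - z).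
  transitivity (z ^+ 2 + 1 - 2 * z); first by ring.
  by rewrite zz aE cE kE !(rmorphD, rmorphM) /=; ring.
have AcdO : OK (A%:~R * c%:~R * d) by do 2!apply: integersM => //.
have z1O : OK (z - 1) by apply: integersB => //; exact: (intO 1).
have Qz : Q (z - 1).
  apply: (prime_ideal_pow (n := 2) HQ z1O); rewrite e1; apply: Q2M.
  apply: integersB => //; apply: integersD => //; apply: integersD; last exact: (intO 1).
  by apply: integersD; apply: integersM => //; exact: (intO 2).
(* The element [z^2 - 1 = (z - 1)^2 + 2 (z - 1)] is in the square of [Q] and is congruent to
   [2 (a + c d)] modulo 4. *)
have QQ2ac : ideal_mul {:K}%AS Q Q (2 * (a%:~R + c%:~R * d)).
  have -> : 2 * (a%:~R + c%:~R * d) = (z - 1) * (z - 1) + 2 * (z - 1) -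
      4 * (A%:~R * k%:~R + a%:~R * c%:~R * d).
    transitivity ((z - 1) ^+ 2 + 2 * (z - 1) -
      4 * (A%:~R * k%:~R + a%:~R * c%:~R * d)); last by ring.
    by rewrite e1 aE kE !(rmorphD, rmorphM) /=; ring.
  apply: (idealB HQQ).
    by apply: QQD; exact: ideal_mul_incl.
  apply: QQ4M; apply: integersD; first exact: integersM.
  by do 2!apply: integersM => //.
(* Exactly one of [a] and [c] is odd. If it is [c], multiplying by [d] makes the odd coefficient
   rational, since [d^2 = D]. *)
have [c2|c2] := boolP (2 %| c)%Z.
  have [c' c'E] := even_int c2.
  apply: (ideal_prime_mult (n := a) p2 HQQ QQ4); last first.
    by apply: contra ac => /even_int[r ->]; rewrite c'E -mulrDr dvdz_mulr.
  have -> : (2%:Z * a)%:~R = 2 * (a%:~R + c%:~R * d) - 4 * (c'%:~R * d).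
    by rewrite c'E !rmorphM /=; ring.
  by apply: (idealB HQQ) => //; apply: QQ4M; exact: integersM.
have [a2|a2] := boolP (2 %| a)%Z; last first.
  have [a' a'E] := odd_int a2; have [c' c'E] := odd_int c2.
  by case/negP: ac; apply/dvdzP; exists (a' + c' + 1); rewrite a'E c'E; ring.
have [a' a'E] := even_int a2.
apply: (ideal_prime_mult (n := c * D) p2 HQQ QQ4); last first.
  apply: contra D2; rewrite Gauss_dvdzr //.
  by rewrite /coprimez /gcdz absz_nat eqz_nat -/(coprime _ _) prime_coprime.
have -> : (2%:Z * (c * D))%:~R = d * (2 * (a%:~R + c%:~R * d)) - 4 * (a'%:~R * d).
  by rewrite a'E !rmorphM /= -(qd_dd qd); ring.
by apply: (idealB HQQ); [exact: QQM|apply: QQ4M; exact: integersM].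
Qed.

Lemma ramifies_quartic_dvd (p : nat) : prime p -> ramifies 1%AS {:K}%AS p ->
  (p%:Z %| disc {:K}%AS)%Z.
Proof.
move=> pp ram; apply: contrapT => /negP np.
have cop : coprimez p%:Z (disc {:K}%AS).
  by rewrite /coprimez /gcdz absz_nat eqz_nat -/(coprime _ _) prime_coprime.
have [g|g] := boolP gl.
  apply: (unramified_disc (gen_galois gen) (integral_basis_glued g)
    (esym (det_glued_family g)) pp _ ram).
  by move: cop; rewrite disc_quartic g.
apply: (unramified_disc (gen_galois gen) (integral_basis_split g)
    (esym det_split_family) pp _ ram).
by move: cop; rewrite disc_quartic (negPf g).
Qed.

(** * The relative discriminant and its norm *)

Lemma det_mx2 n (e : n = 2%N) (b : 'I_n -> K) (g : K -> K -> K) :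
  (forall x y, g x y = g y x) -> exists i0 i1 : 'I_n,
  \det (\matrix_(i, j) g (b i) (b j)) =
    g (b i0) (b i0) * g (b i1) (b i1) - g (b i0) (b i1) ^+ 2.
Proof.
move=> gC; subst n; exists 0, 1.
by rewrite det_mx22 !mxE [g (b 1) (b 0)]gC expr2.
Qed.

Let dim_rel : (\dim_K2 {:K})%N = 2%N.
Proof. by rewrite (gen_dim gen) (gen_dim2 gen). Qed.

(** The discriminant of the pair [x], [y] over K2, as the square of the determinant of their
    conjugates. *)
Definition rel_det x y : K := (x * s (s y) - y * s (s x)) ^+ 2.

Lemma rel_disc_sub I : is_ideal K2 I ->
  (forall x y, OK x -> OK y -> I (rel_det x y)) -> rel_disc K2 {:K}%AS `<=` I.
Proof.
move=> HI H; apply: (ideal_gen_sub HI) => _ [b bO ->].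
have [|i0 [i1 ->]] := det_mx2 dim_rel b (g := fun x y => galTrace K2 {:K}%AS (x * y)).
  by move=> x y; rewrite mulrC.
rewrite !(gen_trace_rel gen) !rmorphM.
have <- : rel_det (b i0) (b i1) =
    (b i0 * b i0 + s (s (b i0)) * s (s (b i0))) *
    (b i1 * b i1 + s (s (b i1)) * s (s (b i1))) -
    (b i0 * b i1 + s (s (b i0)) * s (s (b i1))) ^+ 2 by rewrite /rel_det; ring.
exact: H.
Qed.

Lemma rel_disc_incl x y : OK x -> OK y -> rel_disc K2 {:K}%AS (rel_det x y).
Proof.
move=> xO yO; apply: ideal_gen_incl.
exists (fun i => if (i : nat) == 0%N then x else y) => [i|].
  by case: ifP.
have : forall n (e : n = 2%N), rel_det x y = \det (\matrix_(i < n, j < n)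
    galTrace K2 {:K}%AS ((if (i : nat) == 0%N then x else y) *
      (if (j : nat) == 0%N then x else y))).
  move=> n e; subst n; rewrite det_mx22 !mxE /= !(gen_trace_rel gen) !rmorphM.
  by rewrite /rel_det; ring.
by move=> /(_ _ dim_rel).
Qed.

(** Because [D = d^2], the relation for [al] reads [2 al^2 = A d (d + B)], and the other products
    likewise contain [A d]. For odd [D] the remaining factor is itself twice an integer of K2. *)
Lemma lin_sqr_factor (m n : int) : exists g h : int,
  (m%:~R * al + n%:~R * be) ^+ 2 * quad_co%:~R =
  A%:~R * d * (g%:~R + h%:~R * w).
Proof.
have e : 2 * (m%:~R * al + n%:~R * be) ^+ 2 = A%:~R * d *
    (((m ^+ 2 - n ^+ 2) * B + 2 * m * n * C)%:~R + (m ^+ 2 + n ^+ 2)%:~R * d).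
  by rewrite (lin_sqr qd) !(rmorphD, rmorphB, rmorphM, rmorphXn) /= -(qd_dd qd); ring.
rewrite /quad_co /quad_gen; case: ifPn => D2.
  exists ((m ^+ 2 - n ^+ 2) * B + 2 * m * n * C), (m ^+ 2 + n ^+ 2).
  by rewrite -e mulrC.
have [b [c [bE cE]]] := parity_odd qd D2; have [k kE] := D_odd_mod4 qd D2.
(* Obtained by substituting [d = 2 w - D] and halving. *)
exists (m ^+ 2 * (b - 2 * k) - n ^+ 2 * (b + 2 * k + 1) + m * n * C),
  (m ^+ 2 + n ^+ 2).
apply: (mulfI two0); rewrite mulr1 e mulrCA; congr (_ * _).
by rewrite bE kE !(rmorphD, rmorphB, rmorphM, rmorphXn) /=; field; exact: two0.
Qed.

(* The relative discriminant is generated by [disc_mult * d]. *)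
Definition disc_mult : int := if gl then A else if (2 %| D)%Z then 2 * A else 4 * A.

Lemma disc_mult_ideal :
  is_ideal K2 [set x | exists2 y, O2 y & x = disc_mult%:~R * d * y].
Proof.
have dO : O2 d.
  by apply/(integers_quadraticP gen); split; [exact: qd_d_int qd|exact: ss_d].
split.
- move=> _ [y yO ->]; do 2!apply: integersM => //; exact: integers_int.
- by exists 0; [exact: (integers_int K2 0)|rewrite mulr0].
- move=> _ _ [y yO ->] [z zO ->]; exists (y + z); last by rewrite mulrDr.
  exact: integersD.
- move=> a _ aO [y yO ->]; exists (a * y); last by rewrite mulrCA.
  exact: integersM.
Qed.

(** The element under the square changes sign under [s \o s], so its square contains [A d]. Without
    gluing it is moreover twice an integer, [2 (x1 y0 - x0 y1)] in terms of the two parts of [x] and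
    [y]. *)
Lemma rel_det_mem x y : OK x -> OK y ->
  exists2 z, O2 z & rel_det x y = disc_mult%:~R * d * z.
Proof.
move=> xO yO.
have ssO z : OK z -> OK (s (s z)) by move=> zO; do 2!apply: integers_gen.
have lin z : OK z -> s (s z) = - z -> exists2 t, O2 t &
    z ^+ 2 * co%:~R = A%:~R * d * t.
  move=> zO ssz; have [m [n ->]] := qd_min4 qd zO ssz.
  have [g [h e]] := lin_sqr_factor m n.
  exists (g%:~R + h%:~R * w) => //.
  by apply/integers_quadP; exists g, h.
rewrite /disc_mult; case: ifPn => g.
  have [||t tO tE] := lin (x * s (s y) - y * s (s x)).
  - by apply: integersB; apply: integersM => //; exact: ssO.
  - by rewrite !rmorphB !rmorphM !(gen_order gen); ring.
  exists t => //; rewrite -tE /quad_co.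
  by have /and3P[/negPf -> _ _] := g; rewrite mulr1.
have [u [v [m [n xE]]]] := proj1 (integers_no_glue x g) xO.
have [u' [v' [m' [n' yE]]]] := proj1 (integers_no_glue y g) yO.
have ssw := ss_quad_gen.
have [wO linO] := (integers_quad_gen qd, integers_lin qd).
pose x0 := u%:~R + v%:~R * w; pose x1 := m%:~R * al + n%:~R * be.
pose y0 := u'%:~R + v'%:~R * w; pose y1 := m'%:~R * al + n'%:~R * be.
have ssx0 : s (s x0) = x0 by rewrite !rmorphD !rmorphM !rmorph_int ssw.
have ssy0 : s (s y0) = y0 by rewrite !rmorphD !rmorphM !rmorph_int ssw.
have ssx1 : s (s x1) = - x1.
  by rewrite /x1 !rmorphD !rmorphM !rmorph_int ssal rmorphN; ring.
have ssy1 : s (s y1) = - y1.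
  by rewrite /y1 !rmorphD !rmorphM !rmorph_int ssal rmorphN; ring.
have [||t tO tE] := lin (x1 * y0 - x0 * y1).
- have x0O : OK x0 by apply: integersD; [|apply: integersM => //]; exact: integers_int.
  have y0O : OK y0 by apply: integersD; [|apply: integersM => //]; exact: integers_int.
  by apply: integersB; apply: integersM => //; exact: linO.
- by rewrite !rmorphB !rmorphM ssx0 ssx1 ssy0 ssy1; ring.
exists t => //.
have -> : rel_det x y = 4 * (x1 * y0 - x0 * y1) ^+ 2.
  rewrite /rel_det xE yE -/x0 -/x1 -/y0 -/y1.
  rewrite [s (x0 + x1)]rmorphD [s (y0 + y1)]rmorphD.
  by rewrite [s (s x0 + s x1)]rmorphD [s (s y0 + s y1)]rmorphD ssx0 ssx1 ssy0 ssy1; ring.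
move: tE; move: (_ ^+ 2) => q; rewrite /quad_co; case: ifP => _ tE.
  transitivity (2 * (q * 2%:~R)); first by ring.
  by rewrite tE rmorphM /=; ring.
transitivity (4 * (q * 1%:~R)); first by ring.
by rewrite tE rmorphM /=; ring.
Qed.

Lemma rel_discP x : rel_disc K2 {:K}%AS x <->
  exists2 y, O2 y & x = disc_mult%:~R * d * y.
Proof.
split.
  move: x; apply: (rel_disc_sub disc_mult_ideal) => x y xO yO.
  exact: rel_det_mem.
have HI : is_ideal K2 (rel_disc K2 {:K}%AS).
  apply: is_ideal_gen => _ [b bO ->].
  have [|i0 [i1 ->]] := det_mx2 dim_rel b (g := fun x y => galTrace K2 {:K}%AS (x * y)).
    by move=> z t; rewrite mulrC.
  apply/(integers_quadraticP gen); split.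
    have ssO z : OK z -> OK (s (s z)) by move=> zO; do 2!apply: integers_gen.
    have trO i j : OK (galTrace K2 {:K}%AS (b i * b j)).
      rewrite (gen_trace_rel gen); apply: integersD; first exact: integersM.
      by apply: ssO; exact: integersM.
    by apply: integersB; [exact: integersM|exact: integersX].
  rewrite !(gen_trace_rel gen); move: (b i0) (b i1) => z t.
  rewrite !rmorphB !rmorphXn !rmorphM !rmorphD !rmorphM !(gen_order gen); ring.
have [_ _ ID IM] := HI.
move=> [y yO ->]; rewrite mulrC; apply: (IM) => //.
(* Pairs containing 1 have discriminant [(y - s (s y))^2], which gives the squares of all
   [m al + n s al], up to the factor 4 that only gluing removes. *)
pose kap : int := if gl then 1 else 4.
have sq m n : rel_disc K2 {:K}%AS (kap%:~R * (m%:~R * al + n%:~R * be) ^+ 2).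
  rewrite /kap; case: ifPn => g.
    have thO := integers_glue_gen g; have sthO := integers_gen s thO.
    have -> : 1%:~R * (m%:~R * al + n%:~R * be) ^+ 2 =
        rel_det 1 (m%:~R * th + n%:~R * s th).
      have sth := ss_glue_gen; move: (th) sth => t sth.
      rewrite /rel_det !rmorph1 !rmorphD !rmorphM !rmorph_int sth rmorphB; ring.
    apply: rel_disc_incl; first exact: (integers_int _ 1).
    by apply: integersD; apply: integersM => //; exact: integers_int.
  have -> : 4%:~R * (m%:~R * al + n%:~R * be) ^+ 2 =
      rel_det 1 (m%:~R * al + n%:~R * be).
    rewrite /rel_det !rmorph1 !rmorphD !rmorphM !rmorph_int ssal rmorphN; ring.
  apply: rel_disc_incl; first exact: (integers_int _ 1).
  exact: (integers_lin qd).
have intO (n : int) : O2 n%:~R := integers_int _ n.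
have IAB : rel_disc K2 {:K}%AS ((kap * A)%:~R * d * B%:~R).
  have -> : (kap * A)%:~R * d * B%:~R = kap%:~R * (1%:~R * al + 0%:~R * be) ^+ 2 -
      kap%:~R * (0%:~R * al + 1%:~R * be) ^+ 2.
    transitivity (kap%:~R * ((A * B)%:~R * d)); first by rewrite !rmorphM /=; ring.
    by rewrite -(qd_diff qd); ring.
  exact: (idealB HI).
have IAC : rel_disc K2 {:K}%AS ((kap * A)%:~R * d * C%:~R).
  have -> : (kap * A)%:~R * d * C%:~R = kap%:~R * (1%:~R * al + 1%:~R * be) ^+ 2 -
      kap%:~R * (1%:~R * al + 0%:~R * be) ^+ 2 -
      kap%:~R * (0%:~R * al + 1%:~R * be) ^+ 2.
    transitivity (kap%:~R * (A%:~R * C%:~R * d)); first by rewrite !rmorphM /=; ring.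
    by rewrite -(al_be qd); ring.
  by do 2!apply: (idealB HI) => //.
have IA : rel_disc K2 {:K}%AS ((kap * A)%:~R * d).
  (* Differences of such squares produced [kap A d B] and [kap A d C]; coprimality of [B] and [C]
     leaves [kap A d]. *)
  have /coprimezP[[u v] /= uv] := qd_coprime qd.
  have -> : (kap * A)%:~R * d = u%:~R * ((kap * A)%:~R * d * B%:~R) +
      v%:~R * ((kap * A)%:~R * d * C%:~R).
    transitivity ((kap * A)%:~R * d * (u * B + v * C)%:~R).
      by rewrite uv mulr1.
    by rewrite rmorphD !rmorphM /=; ring.
  by apply: ID; exact: IM.
rewrite /disc_mult; move: IA; rewrite /kap; case: ifPn => g IA.
  by rewrite mul1r in IA.
case: ifPn => D2 //.
have [b [c [bE cE _]]] := parity_even qd D2.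
have dO : O2 d.
  by apply/(integers_quadraticP gen); split; [exact: qd_d_int qd|exact: ss_d].
(* For even [D] a factor 2 is gained from [(d - B) 4 al^2 = 2 A d C^2]: as [C^2] is 1 modulo 4,
   subtracting a multiple of [4 A d] leaves [2 A d]. *)
have -> : (2 * A)%:~R * d = (d - B%:~R) * (kap%:~R * (1%:~R * al + 0%:~R * be) ^+ 2) -
    (2 * c ^+ 2 + 2 * c)%:~R * ((4 * A)%:~R * d).
  rewrite /kap (negPf g).
  transitivity ((d - B%:~R) * (2 * (2 * al ^+ 2)) -
    (2 * c ^+ 2 + 2 * c)%:~R * ((4 * A)%:~R * d)); last by ring.
  have Dd : D%:~R = d ^+ 2 by rewrite (qd_dd qd).
  have CC : d ^+ 2 - B%:~R ^+ 2 = (4 * c ^+ 2 + 4 * c + 1)%:~R.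
    rewrite (qd_dd qd) -rmorphXn -rmorphB /= (qd_DE qd) cE; congr _%:~R; ring.
  rewrite (al_sqr qd) Dd.
  transitivity (2 * A%:~R * d * (d ^+ 2 - B%:~R ^+ 2) -
    (2 * c ^+ 2 + 2 * c)%:~R * ((4 * A)%:~R * d)); last by ring.
  by rewrite CC !(rmorphD, rmorphM, rmorphXn) /=; ring.
apply: (idealB HI); apply: IM => //.
by apply: integersB.
Qed.

Lemma absnorm_rel_disc :
  absnorm K2 (rel_disc K2 {:K}%AS) = (`|disc_mult| ^ 2 * `|D|)%N.
Proof.
have M0 : disc_mult != 0.
  have A0 := qd_A_neq0 qd.
  by rewrite /disc_mult; case: ifP => // _; case: ifP => _; rewrite mulf_neq0.
have D0 := qd_D_gt0 qd.
rewrite (absnorm_lattice (w := w) (M := (`|disc_mult| * `|D|)%N)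
  (m := `|disc_mult|%N)); first by rewrite -mulnn; lia.
- by rewrite muln_gt0 !absz_gt0 M0 gt_eqF.
- by rewrite absz_gt0.
- exact: integers_quadP.
- exact: quad_gen_free.
move=> x; rewrite rel_discP.
(* Uses that [D] and [w] span the ideal generated by [d], so the index is [disc_mult^2 |D|]. *)
have main : (exists2 y, O2 y & x = disc_mult%:~R * d * y) <->
    exists u v : int, x = (disc_mult * D * u)%:~R + (disc_mult * v)%:~R * w.
  have [D2|D2] := boolP (2 %| D)%Z.
    have wE : w = d by rewrite /quad_gen D2.
    split=> [[y /integers_quadP[u [v ->]] ->]|[u [v ->]]].
      exists v, u; rewrite wE !rmorphM /= -(qd_dd qd); ring.
    exists (v%:~R + u%:~R * w); first by apply/integers_quadP; exists v, u.
    by rewrite wE !rmorphM /= -(qd_dd qd); ring.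
  have [k kE] := D_odd_mod4 qd D2.
  have wE : d = 2 * w - D%:~R by rewrite /quad_gen (negPf D2); field.
  have ww : w ^+ 2 = D%:~R * w - (D * k)%:~R.
    rewrite /quad_gen (negPf D2).
    transitivity ((d ^+ 2 + 2 * D%:~R * d + D%:~R ^+ 2) / 4).
      by field; rewrite !natr_splitting_neq0.
    rewrite (qd_dd qd) [in RHS]rmorphM /=.
    have -> : k%:~R = (D%:~R - 1) / 4 :> K.
      by rewrite kE rmorphD rmorphM /=; field; rewrite natr_splitting_neq0.
    by field; rewrite !natr_splitting_neq0.
  have [W WE] : exists W, W = w by exists w.
  rewrite -WE in wE ww.
  split=> [[y /integers_quadP[u [v ->]] ->]|[u [v ->]]].
    exists (- u - 2 * k * v), (2 * u + D * v).
    transitivity (disc_mult%:~R * (2 * u%:~R * w + 2 * v%:~R * w ^+ 2 -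
      D%:~R * u%:~R - D%:~R * v%:~R * w)); first by rewrite -WE wE; ring.
    by rewrite -WE ww !(rmorphD, rmorphB, rmorphN, rmorphM) /=; ring.
  exists ((- u - 2 * k * (v + 2 * u))%:~R + (v + 2 * u)%:~R * w).
    by apply/integers_quadP; exists (- u - 2 * k * (v + 2 * u)), (v + 2 * u).
  have Dk : D%:~R = 4 * k%:~R + 1 :> K by rewrite kE rmorphD rmorphM.
  apply/esym; transitivity (disc_mult%:~R *
      (2 * (- u - 2 * k * (v + 2 * u))%:~R * w + 2 * (v + 2 * u)%:~R * w ^+ 2 -
      D%:~R * (- u - 2 * k * (v + 2 * u))%:~R - D%:~R * (v + 2 * u)%:~R * w)).
    by rewrite -WE wE; ring.
  by rewrite -WE ww !(rmorphD, rmorphB, rmorphN, rmorphM) /= Dk; ring.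
rewrite main PoszM !abszE (ger0_norm (ltW D0)).
have [p|p] := ger0P disc_mult.
  by [].
split=> -[u [v ->]]; exists (- u), (- v); congr (_%:~R + _%:~R * w); ring.
Qed.

End IntegralStructure.

(** * The shape *)

Section HermitianForm.
Variables (R : realType) (n : nat).
Implicit Types x y z : Cn R n.

Lemma hdotD x y z : hdot (x + y) z = hdot x z + hdot y z.
Proof.
rewrite /hdot -raddfD -big_split /=; congr complex.Re.
by apply: eq_bigr => i _; rewrite ffunE mulrDl.
Qed.

Lemma hdotZ (a : R) x z : hdot (a *: x) z = a * hdot x z.
Proof.
rewrite /hdot !raddf_sum /= mulr_sumr; apply: eq_bigr => i _; rewrite ffunE.
by case: (x i) => p q; case: (z i) => u v /=; ring.
Qed.

Lemma hdotC x y : hdot x y = hdot y x.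
Proof.
rewrite /hdot !raddf_sum /=; apply: eq_bigr => i _.
by case: (x i) => p q; case: (y i) => u v /=; ring.
Qed.

Lemma hdot_ge0 x : 0 <= hdot x x.
Proof.
rewrite /hdot raddf_sum /=; apply: sumr_ge0 => i _.
case: (x i) => p q /=; rewrite mulrN opprK -!expr2.
by rewrite addr_ge0 ?sqr_ge0.
Qed.

Section Frame.
Variables (v1 v2 v3 : Cn R n) (N1 N3 : R).
Hypotheses (N1_gt0 : 0 < N1) (N3_gt0 : 0 < N3).
Hypotheses (v11 : hdot v1 v1 = N1) (v22 : hdot v2 v2 = N1) (v33 : hdot v3 v3 = N3).
Hypotheses (v12 : hdot v1 v2 = 0) (v13 : hdot v1 v3 = 0) (v23 : hdot v2 v3 = 0).

Let r1 := Num.sqrt N1.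
Let r3 := Num.sqrt N3.

Definition frame_coord (x : Cn R n) : 'rV[R]_3 :=
  row3 (hdot x v1 / Num.sqrt N1) (hdot x v2 / Num.sqrt N1) (hdot x v3 / Num.sqrt N3).

Definition frame_comb (v : 'rV[R]_3) : Cn R n :=
  (v 0 0 / Num.sqrt N1) *: v1 + (v 0 1 / Num.sqrt N1) *: v2 +
  (v 0 2%:R / Num.sqrt N3) *: v3.

Fact frame_coord_is_linear : linear frame_coord.
Proof.
by move=> a x y; apply: row3P; rewrite !mxE /= !hdotD !hdotZ; ring.
Qed.

HB.instance Definition _ := GRing.isLinear.Build R (Cn R n) 'rV[R]_3 _
  frame_coord frame_coord_is_linear.

Fact frame_comb_is_linear : linear frame_comb.
Proof.
move=> a x y; rewrite /frame_comb !mxE !mulrDl !scalerDl !scalerDr !scalerA.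
by rewrite !mulrA [RHS]addrACA [X in _ = X + _]addrACA.
Qed.

HB.instance Definition _ := GRing.isLinear.Build R 'rV[R]_3 (Cn R n) _
  frame_comb frame_comb_is_linear.

Lemma frame_combK : cancel frame_comb frame_coord.
Proof.
have e1 : N1 = r1 ^+ 2 by rewrite sqr_sqrtr ?ltW.
have e3 : N3 = r3 ^+ 2 by rewrite sqr_sqrtr ?ltW.
have r1n0 : r1 != 0 by rewrite gt_eqF // sqrtr_gt0.
have r3n0 : r3 != 0 by rewrite gt_eqF // sqrtr_gt0.
have [v21 v31 v32] : [/\ hdot v2 v1 = 0, hdot v3 v1 = 0 & hdot v3 v2 = 0].
  by split; rewrite hdotC.
move=> v; apply: row3P; rewrite row3E /frame_comb !hdotD !hdotZ -/r1 -/r3.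
- by rewrite v11 v21 v31 e1; field; rewrite r1n0 r3n0.
- by rewrite v12 v22 v32 e1; field; rewrite r1n0 r3n0.
- by rewrite v13 v23 v33 e3; field; rewrite r1n0 r3n0.
Qed.

Lemma hdot_frame_comb v w : hdot (frame_comb v) (frame_comb w) = dot3 v w.
Proof.
have e1 : N1 = r1 ^+ 2 by rewrite sqr_sqrtr ?ltW.
have e3 : N3 = r3 ^+ 2 by rewrite sqr_sqrtr ?ltW.
have r1n0 : r1 != 0 by rewrite gt_eqF // sqrtr_gt0.
have r3n0 : r3 != 0 by rewrite gt_eqF // sqrtr_gt0.
rewrite dot3E {1}/frame_comb !hdotD !hdotZ.
have := frame_combK w => /rowP H.
have := H 0; have := H 1; have := H 2%:R; rewrite !row3E -/r1 -/r3.
rewrite ![hdot (frame_comb w) _]hdotC => <- <- <-.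
by rewrite -/r1 -/r3; ring.
Qed.

End Frame.
End HermitianForm.

(** * Embeddings and the lattice orthogonal to 1 *)

Section Embeddings.
Variables (K : splittingFieldType rat) (K2 : {subfield K}).
Variables (s : {rmorphism K -> K}) (d al : K) (D A B C : int).
Hypothesis gen : quartic_generator K2 s.
Hypothesis qd : quartic_data s d al D A B C.
Implicit Types x y z : K.

Local Notation be := (s al).
Local Notation w := (quad_gen d D).
Local Notation co := (quad_co D).
Local Notation gl := (glue D A C).
Local Notation th := (glue_gen d al A B).

Let sd := qd_sd qd.
Let ssal := qd_ssal qd.

Variable R : realType.
Variable sigma : 'I_(\dim {:K}) -> {rmorphism K -> R[i]}.
Hypothesis hsigma : enumerates_embeddings sigma.

Definition gen_pow (k : nat) : {rmorphism K -> K} :=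
  nth (idfun : {rmorphism K -> K})
    [:: idfun : {rmorphism K -> K}; s; s \o s : {rmorphism K -> K};
        s \o (s \o s) : {rmorphism K -> K}] k.

Let i0 : 'I_(\dim {:K}) := cast_ord (esym (gen_dim gen)) 0.

Lemma al_conj_uniq : uniq [:: al; be; - al; - be].
Proof.
have ne (m n : int) : (m != 0) || (n != 0) -> m%:~R * al + n%:~R * be != 0.
  move=> mn; apply/negP => /eqP /(qd_free qd)[m0 n0].
  by move: mn; rewrite m0 n0.
have E (m n : int) x y : (m != 0) || (n != 0) ->
    x - y = m%:~R * al + n%:~R * be -> (x == y) = false.
  by move=> /ne mn e; rewrite -subr_eq0 e; apply/negbTE.
rewrite /= !inE !negb_or.
rewrite (@E 1 (- 1) al be) ?(@E 2 0 al (- al)) ?(@E 1 1 al (- be)) //; try by ring.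
by rewrite (@E 1 1 be (- al)) ?(@E 0 2 be (- be)) ?(@E (- 1) 1 (- al) (- be)) //; ring.
Qed.

(** The compositions of one embedding with the powers of [s] are distinct, since they differ at
    [al]; being four, they exhaust the list. *)
Lemma embedding_index : exists2 f : 'I_4 -> 'I_(\dim {:K}), bijective f &
  forall k, sigma (f k) =1 sigma i0 \o gen_pow k.
Proof.
have [hinj hsurj] := hsigma.
have /choice[f Hf] : forall k : 'I_4, exists i, sigma i0 \o gen_pow k =1 sigma i.
  by move=> k; exact: (hsurj (sigma i0 \o gen_pow k : {rmorphism K -> R[i]})).
exists f; last by move=> k x; rewrite Hf.
apply: inj_card_bij; last by rewrite !card_ord (gen_dim gen).
move=> k l fkl; apply/val_inj.
have e : gen_pow k al = gen_pow l al.
  apply: (fmorph_inj (sigma i0)).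
  by have := Hf k al; have := Hf l al; rewrite fkl /= => <- <-.
have powE (i : 'I_4) : gen_pow i al = nth 0 [:: al; be; - al; - be] i.
  by case: i => -[|[|[|[|]]]] //= ?; rewrite ssal ?rmorphN.
by apply/eqP; rewrite -(nth_uniq 0 _ _ al_conj_uniq) ?ltn_ord // -!powE e.
Qed.

Lemma sum_embeddings x :
  \sum_i sigma i x = sigma i0 (galTrace 1%AS {:K}%AS x).
Proof.
have [f fbij Hf] := embedding_index.
rewrite (reindex f) /=; last exact: onW_bij.
rewrite !big_ord_recl big_ord0 addr0 !Hf /= (gen_trace gen) !rmorphD !addrA.
by [].
Qed.

(** Complex conjugation acts as a power of [s] of order at most 2: the identity if K is totally
    real, [s \o s] otherwise. It is the same power for every embedding because the powers of [s]
    commute. *)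
Lemma conj_embedding : exists c : {rmorphism K -> K},
  (c =1 idfun \/ c =1 s \o s) /\ forall i x, (sigma i x)^*%C = sigma i (c x).
Proof.
have [_ hsurj] := hsigma; have [f [g fK gK] Hf] := embedding_index.
have [i Hi] := hsurj (conjc \o sigma i0 : {rmorphism K -> R[i]}).
pose k := g i; exists (gen_pow k).
have conj0 x : (sigma i0 x)^*%C = sigma i0 (gen_pow k x).
  by have := Hi x; rewrite /= => ->; rewrite -(gK i) Hf.
have invol x : gen_pow k (gen_pow k x) = x.
  apply: (fmorph_inj (sigma i0)).
  by rewrite -conj0 -conj0 conjcK.
have powE : gen_pow k =1 idfun \/ gen_pow k =1 s \o s.
  have u := al_conj_uniq; move: u; rewrite /= !inE !negb_or => /and4P[/and3P[_ n2 _] /andP[_ n5] _ _].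
  move: (invol al); case: (k : 'I_4) => -[|[|[|[|]]]] //= ?.
  - by left.
  - by rewrite ssal => e; rewrite e eqxx in n2.
  - by right.
  - by rewrite !(ssal, rmorphN) opprK => e; rewrite e eqxx in n2.
split=> // j x.
rewrite -(gK j) !Hf /= conj0; congr (sigma i0 _).
have comm : forall (l m : 'I_4) y, gen_pow l (gen_pow m y) = gen_pow m (gen_pow l y).
  by move=> [[|[|[|[|]]]] // ?] [[|[|[|[|]]]] // ?] y.
exact: comm.
Qed.

Lemma hdot_minkowski : exists c : {rmorphism K -> K},
  (c =1 idfun \/ c =1 s \o s) /\ forall x y (q : rat),
    galTrace 1%AS {:K}%AS (x * c y) = q%:A ->
    hdot (Defs.minkowski sigma x) (Defs.minkowski sigma y) = ratr q.
Proof.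
have [c [cE Hc]] := conj_embedding; exists c; split=> // x y q e.
rewrite /hdot.
under eq_bigr => i _ do rewrite /Defs.minkowski !ffunE Hc -rmorphM.
rewrite sum_embeddings e rat_algE fmorph_div !rmorph_int /ratr.
rewrite -!(rmorph_int (real_complex R)) -fmorph_div /=.
by [].
Qed.

Local Notation j := (Defs.minkowski sigma).
Local Notation ip := (@hdot R (\dim {:K})).
Local Notation aD := (`|A| * D).

Lemma minkowskiD x y : j (x + y) = j x + j y.
Proof. by apply/ffunP => i; rewrite !ffunE rmorphD. Qed.

Lemma minkowskiZ (m : int) x : j (m%:~R * x) = (m%:~R : R) *: j x.
Proof.
apply/ffunP => i; rewrite !ffunE rmorphM rmorph_int.
rewrite -(rmorph_int (real_complex R)); case: (sigma i x) => u v /=.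
by rewrite /GRing.mul /= !mul0r subr0 addr0.
Qed.

Lemma minkowski_gram :
  [/\ ip (j d) (j d) = (4 * D)%:~R, ip (j al) (j al) = (2 * aD)%:~R,
      ip (j be) (j be) = (2 * aD)%:~R &
      [/\ ip (j al) (j be) = 0, ip (j al) (j d) = 0 & ip (j be) (j d) = 0]].
Proof.
have [c [cE Hc]] := hdot_minkowski.
have ssd : s (s d) = d by exact: (ss_d qd).
have ssbe : s (s be) = - be by rewrite ssal rmorphN.
have cd : c d = d by case: cE => ->.
have [e [cal cbe]] : exists e : int, c al = e%:~R * al /\ c be = e%:~R * be.
  by case: cE => cE; [exists 1|exists (- 1)]; rewrite !cE /= ?mul1r // ssal ?rmorphN !mulN1r.
have int_val x y (n : int) : galTrace 1%AS {:K}%AS (x * c y) = n%:~R ->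
    ip (j x) (j y) = n%:~R.
  by move=> e'; rewrite (Hc _ _ n%:~R) ?ratr_int // e' intr_algE.
have D0 := qd_D_gt0 qd.
(* The sign [e] by which conjugation acts on [al] is not known; positivity of the Hermitian form
   makes [e n] equal to [|n|]. *)
have pos x (n : int) : galTrace 1%AS {:K}%AS (x * c x) = (e * n)%:~R ->
    (e = 1 \/ e = -1) -> ip (j x) (j x) = `|n|%:~R.
  move=> e' e1; have H := int_val _ _ _ e'.
  have := hdot_ge0 (j x); rewrite H ler0z => en; congr _%:~R.
  by case: e1 en => ->; rewrite ?mul1r ?mulN1r; lia.
have e1 : e = 1 \/ e = -1.
  case: cE => cE; [left|right]; have := cal; rewrite cE /= ?ssal => e'.
    apply: (@intr_splitting_inj K); apply: (mulIf (qd_al_neq0 qd)).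
    by rewrite -e' mul1r.
  apply: (@intr_splitting_inj K); apply: (mulIf (qd_al_neq0 qd)).
  by rewrite -e' mulN1r.
have ssal2 : s (s (al * al)) = al * al by rewrite !rmorphM ssal mulrNN.
have ssbe2 : s (s (be * be)) = be * be by rewrite !rmorphM ssbe mulrNN.
have ssalbe : s (s (al * be)) = al * be by rewrite !rmorphM ssbe ssal mulrNN.
have normE : `|2 * (A * D)| = 2 * aD :> int.
  by rewrite !normrM (ger0_norm (ltW D0)) //; ring.
split.
- apply: int_val; rewrite cd -expr2 (qd_dd qd) (gen_trace gen) !rmorph_int.
  by rewrite rmorphM /=; ring.
- rewrite -normE; apply: (pos) => //; rewrite cal mulrCA galTrace_lin_int.
  rewrite (trace_quad gen) // [s (al * al)]rmorphM -!expr2 (qd_sum qd).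
  by rewrite !rmorphM /=; ring.
- rewrite -normE; apply: (pos) => //; rewrite cbe mulrCA galTrace_lin_int.
  rewrite (trace_quad gen) // [s (be * be)]rmorphM ssal mulrNN -!expr2 addrC (qd_sum qd).
  by rewrite !rmorphM /=; ring.
- split; apply: (int_val _ _ 0).
  + rewrite cbe mulrCA galTrace_lin_int (trace_quad gen) //.
    by rewrite [s (al * be)]rmorphM ssal; ring.
  + by rewrite cd (trace_anti gen) // !rmorphM ssd ssal mulNr.
  + by rewrite cd (trace_anti gen) // !rmorphM ssd ssbe mulNr.
Qed.

Lemma perp_quad (u v : int) :
  (u%:~R + v%:~R * w) *+ 4 - galTrace 1%AS {:K}%AS (u%:~R + v%:~R * w) =
  (2 * v * co)%:~R * d.
Proof.
rewrite (trace_quad gen); last first.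
  by rewrite !rmorphD !rmorphM !rmorph_int (ss_quad_gen qd).
rewrite rmorphD rmorphM !rmorph_int.
transitivity ((2 * v)%:~R * (w - s w)); first by rewrite rmorphM /= -mulr_natr; ring.
by rewrite (quad_gen_diff qd) !rmorphM /=; ring.
Qed.

Lemma trace_lin (m n : int) : galTrace 1%AS {:K}%AS (m%:~R * al + n%:~R * be) = 0.
Proof.
apply: (trace_anti gen).
by rewrite !rmorphD !rmorphM !rmorph_int ssal rmorphN; ring.
Qed.

Lemma perp_lattice_no_glue : ~~ gl -> forall v, perp_lattice sigma v <->
  exists m n k : int, v = (4 * m%:~R : R) *: j al + (4 * n%:~R : R) *: j be +
    (2 * co%:~R * k%:~R : R) *: j d.
Proof.
move=> nog v.
have E (u k m n : int) : j ((u%:~R + k%:~R * w + (m%:~R * al + n%:~R * be)) *+ 4 -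
      galTrace 1%AS {:K}%AS (u%:~R + k%:~R * w + (m%:~R * al + n%:~R * be))) =
    (4 * m%:~R : R) *: j al + (4 * n%:~R : R) *: j be +
    (2 * co%:~R * k%:~R : R) *: j d.
  rewrite raddfD /= trace_lin addr0 mulrnDl addrAC perp_quad.
  have -> : (m%:~R * al + n%:~R * be) *+ 4 = (4 * m)%:~R * al + (4 * n)%:~R * be.
    by rewrite !rmorphM /= -mulr_natr; ring.
  rewrite !minkowskiD !minkowskiZ addrC !rmorphM /=; congr (_ + _ *: _).
  by rewrite mulrAC.
have dimE x : x *+ \dim {:K} = x *+ 4 by rewrite (gen_dim gen).
split=> [[x xO <-]|[m [n [k ->]]]].
  have [u [k [m [n xE]]]] := proj1 (integers_no_glue gen qd x nog) xO.
  by exists m, n, k; rewrite dimE xE E.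
exists (0%:~R + k%:~R * w + (m%:~R * al + n%:~R * be)).
  by apply/(integers_no_glue gen qd) => //; exists 0, k, m, n.
by rewrite dimE E.
Qed.

(** The projection of [glue_gen] is [2 al + A B d], with the odd coordinates 1, 1, [A B] on
    [al + s al], [al - s al], [d]. The body-centered frame is thus turned by 45 degrees against
    [al], [s al]. *)
Lemma perp_lattice_glue : gl -> forall v, perp_lattice sigma v <->
  exists m n l k : int, v =
    ((2 * m + k)%:~R : R) *: (j al + j be) +
    ((2 * n + k)%:~R : R) *: (j al - j be) + ((2 * l + k)%:~R : R) *: j d.
Proof.
move=> g v; have [D2 A2 _] := and3P g.
have [b [c [bE _]]] := parity_odd qd D2; have [a aE] := odd_int A2.
pose ab := 2 * a * b + a + b.
have ABE : A * B = 2 * ab + 1 by rewrite aE bE /ab; ring.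
have four0 : 4 != 0 :> K := natr_splitting_neq0 K 3.
have perp_th : th *+ 4 - galTrace 1%AS {:K}%AS th = (A * B)%:~R * d + 2 * al.
  have ssth := ss_glue_gen qd.
  have trth : galTrace 1%AS {:K}%AS th = 1.
    rewrite (gen_trace gen) ssth rmorphB.
    transitivity (2 * (th + s th) - al - be); first by ring.
    rewrite /glue_gen fmorph_div rmorph_nat !rmorphD !rmorphM rmorph_nat rmorph1.
    by rewrite rmorph_int sd; field; rewrite four0.
  rewrite trth -[_ *+ 4]mulr_natr /glue_gen divfK //; ring.
have perp_sth : s th *+ 4 - galTrace 1%AS {:K}%AS (s th) =
    (- (A * B))%:~R * d + 2 * be.
  have trs : galTrace 1%AS {:K}%AS (s th) = s (galTrace 1%AS {:K}%AS th).
    by rewrite !(gen_trace gen) !rmorphD.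
  rewrite trs -rmorphMn -rmorphB perp_th rmorphD [s (_ * d)]rmorphM.
  by rewrite [s (2 * al)]rmorphM rmorph_int rmorph_nat sd rmorphN mulrN mulNr.
have E (u l m n : int) : j ((u%:~R + l%:~R * w + (m%:~R * th + n%:~R * s th)) *+ 4 -
      galTrace 1%AS {:K}%AS (u%:~R + l%:~R * w + (m%:~R * th + n%:~R * s th))) =
    ((m + n)%:~R : R) *: (j al + j be) + ((m - n)%:~R : R) *: (j al - j be) +
    ((2 * l + A * B * (m - n))%:~R : R) *: j d.
  rewrite raddfD /= mulrnDl opprD addrACA perp_quad.
  have -> : (m%:~R * th + n%:~R * s th) *+ 4 -
      galTrace 1%AS {:K}%AS (m%:~R * th + n%:~R * s th) =
      m%:~R * (th *+ 4 - galTrace 1%AS {:K}%AS th) +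
      n%:~R * (s th *+ 4 - galTrace 1%AS {:K}%AS (s th)).
    rewrite raddfD /= !galTrace_lin_int.
    by move: (th) (galTrace _ _ _) (galTrace _ _ _) => t p q; ring.
  rewrite perp_th perp_sth /quad_co (negPf D2).
  transitivity (j ((m + n)%:~R * al + (m + n)%:~R * be +
    ((m - n)%:~R * al - (m - n)%:~R * be) + (2 * l + A * B * (m - n))%:~R * d)).
    by congr j; rewrite !(rmorphD, rmorphB, rmorphN, rmorphM) /=; ring.
  rewrite -[- ((m - n)%:~R * be)]mulNr -rmorphN !minkowskiD !minkowskiZ.
  by rewrite rmorphN scaleNr !scalerDr scalerN.
have dimE x : x *+ \dim {:K} = x *+ 4 by rewrite (gen_dim gen).
split=> [[x xO <-]|[m [n [l [k ->]]]]].
  have [u [l [m [n xE]]]] := proj1 (integers_glue gen qd x g) xO.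
  exists n, 0, (l + ab * (m - n)), (m - n); rewrite dimE xE E ABE.
  by congr (_%:~R *: _ + _%:~R *: _ + _%:~R *: _); ring.
exists (0%:~R + (l - n - ab * (2 * n + k))%:~R * w +
  ((m + n + k)%:~R * th + (m - n)%:~R * s th)).
  by apply/(integers_glue gen qd) => //; exists 0, (l - n - ab * (2 * n + k)), (m + n + k), (m - n).
rewrite dimE E ABE.
by congr (_%:~R *: _ + _%:~R *: _ + _%:~R *: _); ring.
Qed.

Lemma shape_no_glue : ~~ gl ->
  let a : R := 4 * Num.sqrt (2 * aD)%:~R in
  let c : R := 2 * co%:~R * Num.sqrt (4 * D)%:~R in
  shape_is sigma (primitive_tetragonal a c) /\
  shape_combinatorial_type sigma (@cuboid R).
Proof.
move=> nog a c; have [dd aa bb [ab ad bd]] := minkowski_gram.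
have D0 := qd_D_gt0 qd; have A0 := qd_A_neq0 qd.
have N1 : 0 < (2 * aD)%:~R :> R by rewrite ltr0z !mulr_gt0 ?normr_gt0.
have N3 : 0 < (4 * D)%:~R :> R by rewrite ltr0z !mulr_gt0.
have co0 : 0 < co%:~R :> R by rewrite ltr0z /quad_co; case: ifP.
have a0 : 0 < a by rewrite mulr_gt0 ?sqrtr_gt0.
have c0 : 0 < c by rewrite !mulr_gt0 ?sqrtr_gt0.
pose f := frame_coord (j al) (j be) (j d) (2 * aD)%:~R (4 * D)%:~R.
pose g := frame_comb (j al) (j be) (j d) (2 * aD)%:~R (4 * D)%:~R.
have gK : cancel g f := frame_combK N1 N3 aa bb dd ab ad bd.
have ipg := hdot_frame_comb N1 N3 aa bb dd ab ad bd.
have LE : perp_lattice sigma = g @` primitive_tetragonal a c.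
  have gE (m n k : int) : g (row3 (m%:~R * a) (n%:~R * a) (k%:~R * c)) =
      (4 * m%:~R : R) *: j al + (4 * n%:~R : R) *: j be +
      (2 * co%:~R * k%:~R : R) *: j d.
    rewrite /g /frame_comb !row3E /a /c.
    by congr (_ *: _ + _ *: _ + _ *: _); field; rewrite gt_eqF ?sqrtr_gt0.
  apply/seteqP; split=> [v|_ [v + <-]].
    move=> /(perp_lattice_no_glue nog)[m [n [k vE]]]; rewrite vE.
    exists (row3 (m%:~R * a) (n%:~R * a) (k%:~R * c)); last exact: gE.
    by apply/primitive_tetragonalP; exists m, n, k.
  move=> /primitive_tetragonalP[m [n [k ->]]].
  by apply/(perp_lattice_no_glue nog); exists m, n, k; rewrite gE.
rewrite /shape_is /shape_combinatorial_type LE; split.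
  exact: (same_shape_image (f := f) (g := g) gK ipg).
exact: (primitive_tetragonal_cell (f := f) (g := g) gK ipg a0 c0).
Qed.

Lemma shape_glue : gl ->
  let a : R := 2 * Num.sqrt (4 * aD)%:~R in
  let c : R := 2 * Num.sqrt (4 * D)%:~R in
  shape_is sigma (body_centered_tetragonal a c) /\
  shape_combinatorial_type sigma (@truncated_octahedron R).
Proof.
move=> gl_true a c; have [dd aa bb [ab ad bd]] := minkowski_gram.
have D0 := qd_D_gt0 qd; have A0 := qd_A_neq0 qd.
have N1 : 0 < (4 * aD)%:~R :> R by rewrite ltr0z !mulr_gt0 ?normr_gt0.
have N3 : 0 < (4 * D)%:~R :> R by rewrite ltr0z !mulr_gt0.
have c0 : 0 < c by rewrite !mulr_gt0 ?sqrtr_gt0.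
have ca : c <= a.
  rewrite /a /c ler_pM2l // ler_wsqrtr // ler_int.
  have : 1 <= `|A| by rewrite -gtz0_ge1 normr_gt0.
  by move: D0; clear; nia.
pose v1 := j al + j be; pose v2 := j al - j be.
have ipDr (x y z : Cn R (\dim {:K})) : ip z (x + y) = ip z x + ip z y.
  by rewrite hdotC hdotD !(hdotC z).
have ipN (x z : Cn R (\dim {:K})) : ip (- x) z = - ip x z by rewrite -scaleN1r hdotZ mulN1r.
have ipNr (x z : Cn R (\dim {:K})) : ip z (- x) = - ip z x by rewrite hdotC ipN hdotC.
have ba : ip (j be) (j al) = 0 by rewrite hdotC.
have [aa' bb' ab'] : [/\ ip v1 v1 = (4 * aD)%:~R, ip v2 v2 = (4 * aD)%:~R &
    ip v1 v2 = 0].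
  have -> : (4 * aD)%:~R = (2 * aD)%:~R + (2 * aD)%:~R :> R.
    by rewrite -rmorphD; congr _%:~R; ring.
  rewrite /v1 /v2; split; rewrite !(hdotD, ipDr, ipN, ipNr) aa bb ab ba; ring.
have [ad' bd'] : ip v1 (j d) = 0 /\ ip v2 (j d) = 0.
  by rewrite /v1 /v2 !(hdotD, ipN) ad bd; split; ring.
pose f := frame_coord v1 v2 (j d) (4 * aD)%:~R (4 * D)%:~R.
pose g := frame_comb v1 v2 (j d) (4 * aD)%:~R (4 * D)%:~R.
have gK : cancel g f := frame_combK N1 N3 aa' bb' dd ab' ad' bd'.
have ipg := hdot_frame_comb N1 N3 aa' bb' dd ab' ad' bd'.
have LE : perp_lattice sigma = g @` body_centered_tetragonal a c.
  have gE (m n k : int) : g (row3 (m%:~R * (a / 2)) (n%:~R * (a / 2))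
      (k%:~R * (c / 2))) = (m%:~R : R) *: v1 + (n%:~R : R) *: v2 +
      (k%:~R : R) *: j d.
    rewrite /g /frame_comb !row3E /a /c.
    by congr (_ *: _ + _ *: _ + _ *: _); field; rewrite gt_eqF ?sqrtr_gt0.
  apply/seteqP; split=> [v|_ [v + <-]].
    move=> /(perp_lattice_glue gl_true)[m [n [l [k vE]]]]; rewrite vE.
    exists (row3 ((2 * m + k)%:~R * (a / 2)) ((2 * n + k)%:~R * (a / 2))
      ((2 * l + k)%:~R * (c / 2))); last exact: gE.
    by apply/body_centered_tetragonalP; exists m, n, l, k.
  move=> /body_centered_tetragonalP[m [n [l [k ->]]]].
  by apply/(perp_lattice_glue gl_true); exists m, n, l, k; rewrite gE.
rewrite /shape_is /shape_combinatorial_type LE; split.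
  exact: (same_shape_image (f := f) (g := g) gK ipg).
exact: (body_centered_tetragonal_cell (f := f) (g := g) gK ipg c0 ca).
Qed.

End Embeddings.

(** * Side ratios, cubes, and the two cases of the theorem *)

Lemma powR_quarter (R : realType) (x y : R) : 0 <= x -> y = x ^+ 4 ->
  powR y (1 / 4) = x.
Proof.
move=> x0 ->; rewrite -powR_mulrn // -powRrM.
by rewrite mul1r divff ?powRr1.
Qed.

Lemma exists_prime_divisor (a : int) : a != 0 -> `|a|%N != 1%N ->
  exists2 p : nat, prime p & (p%:Z %| a)%Z.
Proof.
move=> a0 a1; exists (pdiv `|a|); last by rewrite dvdzE absz_nat; exact: pdiv_dvd.
by apply: pdiv_prime; rewrite ltn_neqAle eq_sym a1 absz_gt0.
Qed.

(** A prime dividing [a] would occur in [a^2 e^3] with exponent exactly 2, which is not a multiple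
    of 3. *)
Lemma cube_squarefree_part (a e m : int) : a != 0 ->
    (forall p : nat, prime p -> (p%:Z %| a)%Z ->
      ~~ (p%:Z ^+ 2 %| a)%Z /\ ~~ (p%:Z %| e)%Z) ->
  a ^+ 2 * e ^+ 3 = m ^+ 3 -> `|a|%N = 1%N.
Proof.
move=> a0 H E; apply/eqP; apply: contrapT => /negP a1.
have [p pp pa] := exists_prime_divisor a0 a1; have [pa2 pe] := H p pp pa.
have cop (z : int) : ~~ (p%:Z %| z)%Z -> coprimez p%:Z z.
  by rewrite /coprimez /gcdz absz_nat eqz_nat -/(coprime _ _) prime_coprime.
have /dvdzP[b bE] := pa.
have pb : ~~ (p%:Z %| b)%Z.
  apply: contra pa2 => /dvdzP[q qE]; apply/dvdzP; exists q.
  by rewrite bE qE; ring.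
have p0 : p%:Z != 0 by have := prime_gt0 pp; lia.
have [mp|mp] := boolP (p%:Z %| m)%Z; last first.
  have : coprimez p%:Z (m ^+ 3) by rewrite coprimezXr // cop.
  rewrite -E; have -> : a ^+ 2 * e ^+ 3 = p%:Z * (b * a * e ^+ 3) by rewrite [in LHS]expr2 {1}bE; ring.
  rewrite /coprimez /gcdz abszM absz_nat gcdnMr eqz_nat => /eqP p1.
  by move: pp; rewrite p1.
have /dvdzP[q qE] := mp.
have : (p%:Z %| b ^+ 2 * e ^+ 3)%Z.
  apply/dvdzP; exists (q ^+ 3).
  apply: (mulfI (expf_neq0 2 p0)); transitivity (a ^+ 2 * e ^+ 3).
    by rewrite bE; ring.
  by rewrite E qE; ring.
rewrite Gauss_dvdzl; last by rewrite coprimezXr // cop.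
rewrite expr2 Gauss_dvdzr; last exact: cop.
by move=> pb'; rewrite pb' in pb.
Qed.

Section Conclusion.
Variables (K : splittingFieldType rat) (K2 : {subfield K}).
Variables (s : {rmorphism K -> K}) (d al : K) (D A B C : int).
Hypothesis gen : quartic_generator K2 s.
Hypothesis qd : quartic_data s d al D A B C.
Implicit Types x y z : K.

Local Notation w := (quad_gen d D).
Local Notation co := (quad_co D).
Local Notation gl := (glue D A C).

Local Notation dm := (disc_mult D A C).

(** Isolates the square-free part of [A] prime to [D], on which both the cube condition and new
    ramification depend. The two alternatives are the ones in which a cubic shape can occur. *)
Lemma odd_part : gl \/ (2 %| D)%Z -> exists a : int,
  [/\ a != 0, ~~ (2 %| a)%Z, A = (if (2 %| D)%Z then 2 else 1) * a &
   forall p : nat, prime p -> (p%:Z %| a)%Z ->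
     [/\ odd p, ~~ (p%:Z ^+ 2 %| a)%Z & ~~ (p%:Z %| D)%Z]].
Proof.
have odd_prime (a : int) (p : nat) : ~~ (2 %| a)%Z -> prime p -> (p%:Z %| a)%Z -> odd p.
  move=> a2 pp pa; have [p2|//] := even_prime pp.
  by move: a2; rewrite -[2]/(2%N%:Z) -p2 pa.
have A0 := qd_A_neq0 qd; move=> [g|D2].
  have /and3P[D2 A2 _] := g; exists A; rewrite (negPf D2) mul1r; split=> // p pp pA.
  have podd := odd_prime _ _ A2 pp pA.
  by have [? ?] := A_prime_odd qd pp podd pA.
have [a' aE] := A_half_odd qd D2; exists (2 * a' + 1); rewrite D2.
have a2 : ~~ (2 %| 2 * a' + 1)%Z by lia.
split=> //; first by apply: contraNneq a2 => ->.
move=> p pp pa; have podd := odd_prime _ _ a2 pp pa.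
have pA : (p%:Z %| A)%Z by rewrite aE dvdz_mull.
have [pA2 pD] := A_prime_odd qd pp podd pA; split=> //.
by apply: contra pA2 => pa2; rewrite aE dvdz_mull.
Qed.

Lemma disc_odd_part (a : int) : gl \/ (2 %| D)%Z ->
    A = (if (2 %| D)%Z then 2 else 1) * a ->
  exists e, D = (if (2 %| D)%Z then 2 else 1) * e /\
    disc {:K}%AS = (if (2 %| D)%Z then 2 ^+ 11 else 1) * (a ^+ 2 * e ^+ 3).
Proof.
move=> gD; rewrite (disc_quartic gen qd) /quad_co; case: gD => [g|D2].
  have /and3P[D2 _ _] := g; rewrite g (negPf D2) mul1r => <-.
  by exists D; rewrite !mul1r.
have -> : gl = false by rewrite /glue D2.
(* With [co = 2], [A = 2 a] and [D = 2 e], the powers of 2 in [16 co^2 A^2 D^3] multiply to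
   [2^(4 + 2 + 2 + 3)]. *)
have [e eE] := even_int D2; rewrite D2 => ->; exists e; split=> //.
by rewrite [in LHS]eE; ring.
Qed.

(** A prime dividing [a] ramifies in K/K2 but not in K2. If [a] is a unit, every ramified prime
    divides the discriminant, and therefore [D]. *)
Lemma no_new_ramificationP (a : int) : gl \/ (2 %| D)%Z ->
    a != 0 -> ~~ (2 %| a)%Z -> A = (if (2 %| D)%Z then 2 else 1) * a ->
    (forall p : nat, prime p -> (p%:Z %| a)%Z ->
     [/\ odd p, ~~ (p%:Z ^+ 2 %| a)%Z & ~~ (p%:Z %| D)%Z]) ->
  (forall p : nat, prime p -> ramifies K2 {:K}%AS p -> ramifies 1%AS K2 p) <->
  `|a|%N = 1%N.
Proof.
move=> gD a0 a2 AE H; split.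
  move=> no_new; apply/eqP; apply: contrapT => /negP a1.
  have [p pp pa] := exists_prime_divisor a0 a1.
  have [podd _ /negP pD] := H _ pp pa; apply: pD.
  apply/(ramifies_quadP gen qd) => //; apply: no_new => //.
  by apply: (ramifies_rel_odd gen qd) => //; rewrite AE dvdz_mull.
move=> a1 p pp /(ramifies_trans pp) /(ramifies_quartic_dvd gen qd pp) pK.
apply/(ramifies_quadP gen qd) => //.
have [e [eE dE]] := disc_odd_part gD AE.
have a21 : a ^+ 2 = 1.
  by have [->|->] : a = 1 \/ a = - 1 by clear -a1; lia.
rewrite dE a21 mul1r in pK; rewrite eE.
have dvdX (x : int) k : (p%:Z %| x ^+ k)%Z -> (p%:Z %| x)%Z.
  by rewrite !dvdzE abszX !absz_nat Euclid_dvdX // => /andP[].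
have : (p%:Z %| (if (2 %| D)%Z then 2 ^+ 11 else 1) * e ^+ 3)%Z by [].
have euclid (x y : int) : (p%:Z %| x * y)%Z = (p%:Z %| x)%Z || (p%:Z %| y)%Z.
  by rewrite !dvdzE abszM !absz_nat Euclid_dvdM.
rewrite euclid [in X in _ -> X]euclid => /orP[|/dvdX pe]; last by rewrite pe orbT.
by case: ifP => _ => [/dvdX pe|pe]; rewrite pe.
Qed.

Variable R : realType.
Variable sigma : 'I_(\dim {:K}) -> {rmorphism K -> R[i]}.
Hypothesis hsigma : enumerates_embeddings sigma.

Let sqrt4 (x : int) : 0 <= x -> Num.sqrt (x%:~R : R) ^+ 4 = x%:~R ^+ 2.
Proof. by move=> x0; rewrite (exprM _ 2 2) sqr_sqrtr // ler0z. Qed.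

Let le_sqrt_int (x y : int) : 0 <= x -> 0 <= y ->
  (Num.sqrt (x%:~R : R) <= Num.sqrt (y%:~R : R)) = (x <= y).
Proof. by move=> x0 y0; rewrite ler_sqrt ?ler_int // ler0z. Qed.

Let ratio_eq1 (a c : R) : 0 < a -> c <= a -> (c / a = 1 <-> a <= c).
Proof.
move=> a0 ca; split=> [e|ac].
  by rewrite -[c](divfK (lt0r_neq0 a0)) e mul1r.
by have -> : c = a; [apply/eqP; rewrite eq_le ca|rewrite divff ?lt0r_neq0].
Qed.

Let absnorm_real :
  (absnorm K2 (rel_disc K2 {:K}%AS))%:R = dm%:~R ^+ 2 * D%:~R :> R.
Proof.
rewrite (absnorm_rel_disc gen qd) natrM natrX !natr_absz.
rewrite (ger0_norm (ltW (qd_D_gt0 qd))); congr (_ * _).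
by rewrite intr_norm real_normK // num_real.
Qed.

Let disc_quad_real : `|disc K2|%N%:R = co%:~R ^+ 2 * D%:~R :> R.
Proof.
rewrite (disc_quad gen qd) natr_absz ger0_norm ?rmorphM ?rmorphXn //.
by rewrite mulr_ge0 ?sqr_ge0 // ltW // (qd_D_gt0 qd).
Qed.

(** Here [(a / c)^2 = |A|], and every equality condition is reduced to [|A| = 1]. *)
Lemma unramified_case : gl ->
  let D2 : R := `|disc K2|%N%:R in
  let N : R := (absnorm K2 (rel_disc K2 {:K}%AS))%:R in
  let no_new_ramification := forall p : nat, prime p ->
    ramifies K2 {:K}%AS p -> ramifies 1%AS K2 p in
  let r := powR (D2 / N) (1 / 4) in
  [/\ shape_combinatorial_type sigma (@truncated_octahedron R),
      shape_is_body_centered_tetragonal sigma r,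
      r <= 1,
      (r = 1 <-> shape_is_body_centered_cubic sigma) &
      (r = 1 <-> exists m : int, disc {:K}%AS = m ^+ 3) /\
      ((exists m : int, disc {:K}%AS = m ^+ 3) <-> no_new_ramification)].
Proof.
move=> g D2 N no_new r; have /and3P[Dodd A2 _] := g.
have [shape cell] := shape_glue gen qd hsigma g.
have D0 := qd_D_gt0 qd; have A0 := qd_A_neq0 qd.
have aA0 : 0 < `|A| by rewrite normr_gt0.
have aA1 : 1 <= `|A| by rewrite -gtz0_ge1.
set a : R := 2 * _ in shape; set c : R := 2 * _ in shape.
have N1 : 0 < 4 * (`|A| * D) by rewrite !mulr_gt0.
have N3 : 0 < 4 * D by rewrite !mulr_gt0.
have a0 : 0 < a by rewrite mulr_gt0 ?sqrtr_gt0 ?ltr0z.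
have c0 : 0 < c by rewrite mulr_gt0 ?sqrtr_gt0 ?ltr0z.
have ca : c <= a.
  rewrite /a /c ler_pM2l // (le_sqrt_int (ltW N3) (ltW N1)) ler_pM2l //.
  by rewrite -[X in X <= _]mul1r ler_pM2r.
have ac : (a <= c) = (`|A| <= 1).
  rewrite /a /c ler_pM2l // (le_sqrt_int (ltW N1) (ltW N3)) ler_pM2l //.
  by rewrite -[X in _ <= X]mul1r ler_pM2r.
have D0R : D%:~R != 0 :> R by rewrite intr_eq0 gt_eqF.
have A0R : `|A|%:~R != 0 :> R by rewrite intr_eq0 gt_eqF.
have rE : r = c / a.
  apply: powR_quarter; first by rewrite divr_ge0 // ltW.
  rewrite /D2 /N disc_quad_real absnorm_real /disc_mult g.
  rewrite /quad_co (negPf Dodd) expr1n mul1r expr_div_n !exprMn.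
  rewrite (sqrt4 (ltW N1)) (sqrt4 (ltW N3)).
  have -> : A%:~R ^+ 2 = `|A|%:~R ^+ 2 :> R.
    by rewrite intr_norm real_normK // num_real.
  by rewrite !rmorphM /=; field; rewrite D0R A0R.
have r1 : r = 1 <-> `|A|%N = 1%N.
  rewrite rE (ratio_eq1 a0 ca) ac; clear -aA1; split; lia.
have [w [w0 w2 wE H]] := odd_part (or_introl g).
have AE := wE; rewrite (negPf Dodd) mul1r in wE.
have noP := no_new_ramificationP (or_introl g) w0 w2 AE H.
have cubeP : `|A|%N = 1%N <-> exists m : int, disc {:K}%AS = m ^+ 3.
  rewrite (disc_quartic gen qd) g; split=> [A1|[m mE]].
    exists D; have -> : A ^+ 2 = 1.
      by have [->|->] : A = 1 \/ A = - 1 by clear -A1; lia.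
    by rewrite mul1r.
  apply: (cube_squarefree_part A0 _ mE) => p pp; rewrite wE => po.
  by have [] := H p pp po.
split=> //.
- by exists a, c; split=> //; rewrite rE.
- by rewrite rE ler_pdivrMr // mul1r.
- split=> [e|[b b0 shape']].
    have e' : a = c.
      by apply/eqP; rewrite eq_le ca andbT; apply/(ratio_eq1 a0 ca); rewrite -rE.
    by exists a => //; rewrite {2}e'.
  rewrite rE (body_centered_cubic_ratio a0 c0 ca b0 shape shape').
  by rewrite divff ?lt0r_neq0.
- rewrite r1 -cubeP; split=> //.
  by split=> [A1|H2]; [apply/noP|]; [rewrite -wE|rewrite wE; apply/noP].
Qed.

(** Here [(c / a)^2 = co^2 / (2 |A|)]. For odd [D] this is at most 1/2; for even [D] it is [2 / |A|]
    with [A] even. So the cubic case means that [D] is even and [|A| = 2]. *)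
Lemma ramified_case : ~~ gl ->
  let D2 : R := `|disc K2|%N%:R in
  let N : R := (absnorm K2 (rel_disc K2 {:K}%AS))%:R in
  let no_new_ramification := forall p : nat, prime p ->
    ramifies K2 {:K}%AS p -> ramifies 1%AS K2 p in
  let r := powR (4 * D2 / N) (1 / 4) in
  let DK_is_2p11_odd_cube := exists delta : int,
    [/\ disc {:K}%AS = 2 ^+ 11 * delta, odd `|delta|%N &
        exists m : int, delta = m ^+ 3] in
  [/\ shape_combinatorial_type sigma (@cuboid R),
      shape_is_primitive_tetragonal sigma r,
      r <= 1,
      (shape_is_primitive_cubic sigma <-> DK_is_2p11_odd_cube) &
      (DK_is_2p11_odd_cube <->
       ramifies 1%AS K2 2 /\ no_new_ramification)].
Proof.
move=> nog D2 N no_new r DKform.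
have [shape cell] := shape_no_glue gen qd hsigma nog.
have D0 := qd_D_gt0 qd; have A0 := qd_A_neq0 qd.
have aA0 : 0 < `|A| by rewrite normr_gt0.
set a : R := 4 * _ in shape; set c : R := 2 * _ * _ in shape.
have co0 : 0 < co by rewrite /quad_co; case: ifP.
have N1 : 0 < 2 * (`|A| * D) by rewrite !mulr_gt0.
have N3 : 0 < 4 * D by rewrite !mulr_gt0.
have a0 : 0 < a by rewrite mulr_gt0 ?sqrtr_gt0 ?ltr0z.
have c0 : 0 < c by rewrite !mulr_gt0 ?sqrtr_gt0 ?ltr0z.
have aE : a = Num.sqrt (16 * (2 * (`|A| * D)))%:~R.
  rewrite rmorphM sqrtrM ?ler0z // /a; congr (_ * _).
  rewrite /=; have -> : (16 : int)%:~R = 4 ^+ 2 :> R by rewrite -natrX.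
  by rewrite sqrtr_sqr ger0_norm.
have cE : c = Num.sqrt ((2 * co) ^+ 2 * (4 * D))%:~R.
  rewrite rmorphM sqrtrM ?ler0z ?sqr_ge0 // /c; congr (_ * _).
  rewrite rmorphXn sqrtr_sqr rmorphM ger0_norm //.
  by rewrite mulr_ge0 // ler0z ltW.
have M1 : 0 <= 16 * (2 * (`|A| * D)) by apply/ltW/mulr_gt0.
have M2 : 0 <= (2 * co) ^+ 2 * (4 * D) by rewrite mulr_ge0 ?sqr_ge0 // ltW.
have M1E : 16 * (2 * (`|A| * D)) = 16 * D * (2 * `|A|) by ring.
have M2E : (2 * co) ^+ 2 * (4 * D) = 16 * D * co ^+ 2 by ring.
have D16 : 0 < 16 * D by rewrite mulr_gt0.
have le_ca : (c <= a) = (co ^+ 2 <= 2 * `|A|).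
  by rewrite aE cE (le_sqrt_int M2 M1) M1E M2E ler_pM2l.
have le_ac : (a <= c) = (2 * `|A| <= co ^+ 2).
  by rewrite aE cE (le_sqrt_int M1 M2) M1E M2E ler_pM2l.
have D0R : D%:~R != 0 :> R by rewrite intr_eq0 gt_eqF.
have A0R : `|A|%:~R != 0 :> R by rewrite intr_eq0 gt_eqF.
have ca : c <= a.
  rewrite le_ca /quad_co; case: ifP => D2'; last by move: aA0; clear; lia.
  by have /even_int[q qE] := A_even qd D2'; move: A0 qE; clear; lia.
have eq_ca : a <= c <-> (2 %| D)%Z /\ `|A|%N = 2%N.
  rewrite le_ac /quad_co; case: ifP => D2'.
    have /even_int[q qE] := A_even qd D2'.
    by move: A0 qE; clear; split; [split=> //; lia|case=> _; lia].
  by split=> [|[]] //; move: aA0; clear; lia.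
have rE : r = c / a.
  apply: powR_quarter; first by rewrite divr_ge0 // ltW.
  rewrite /D2 /N disc_quad_real absnorm_real /disc_mult (negPf nog).
  have AA : A%:~R ^+ 2 = `|A|%:~R ^+ 2 :> R.
    by rewrite intr_norm real_normK // num_real.
  rewrite /c /a /quad_co expr_div_n !exprMn.
  rewrite (sqrt4 (ltW N1)) (sqrt4 (ltW N3)).
  case: ifP => _; rewrite !rmorphM /= !exprMn AA; field; by rewrite D0R A0R.
have formP : DKform <-> (2 %| D)%Z /\ `|A|%N = 2%N.
  split=> [[delta [DKE odelta [m mE]]]|[D2' A2]].
    have [D2'|D2'] := boolP (2 %| D)%Z.
      have [w [w0 w2 wE H]] := odd_part (or_intror D2').
      have [e [eE dE]] := disc_odd_part (or_intror D2') wE.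
      rewrite D2' in wE eE dE; split=> //.
      have e1 : w ^+ 2 * e ^+ 3 = m ^+ 3.
        by rewrite -mE; apply: (mulfI (_ : 2 ^+ 11 != 0 :> int)); rewrite -?dE.
      have w1 : `|w|%N = 1%N.
        apply: (cube_squarefree_part w0 _ e1) => p pp po.
        have [_ ? pD] := H p pp po; split=> //; apply: contra pD => pe.
        by rewrite eE dvdz_mull.
      by rewrite wE abszM w1.
    (* For odd [D] the discriminant is [16 A^2 D^3] with 4 not dividing [A], so 2 has exponent 4 or
       6 in it, never 11. *)
    exfalso; move: DKE; rewrite (disc_quartic gen qd) (negPf nog) /quad_co (negPf D2').
    have [k kE] := D_odd_mod4 qd D2'.
    have [dd ddE] : exists dd, D ^+ 3 = 2 * dd + 1.
      by exists (32 * k ^+ 3 + 24 * k ^+ 2 + 6 * k); rewrite kE; ring.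
    have [A2|A2] := boolP (2 %| A)%Z; last first.
      have [q qE] := odd_int A2; rewrite ddE qE.
      have -> : (2 : int) ^+ 11 = 2048 by [].
      by clear; nia.
    have [q qE] := even_int A2; have := A_not_dvd4 qd D2'; rewrite ddE qE => q2.
    have /odd_int[u ->] : ~~ (2 %| q)%Z by move: q2; clear; lia.
    have -> : (2 : int) ^+ 11 = 2048 by [].
    by clear; nia.
  have [w [w0 w2 wE H]] := odd_part (or_intror D2').
  have [e [eE dE]] := disc_odd_part (or_intror D2') wE.
  rewrite D2' in wE eE dE.
  have w1 : w ^+ 2 = 1.
    by have [->|->] : w = 1 \/ w = - 1 by move: A2; rewrite wE; clear; lia.
  exists (e ^+ 3); split; [by rewrite dE w1 mul1r| |by exists e].
  rewrite abszX oddX; have [_ [_ [_ _ D4]]] := parity_even qd D2'.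
  by move: D4; rewrite eE; clear; lia.
have ram2 : ramifies 1%AS K2 2 <-> (2 %| D)%Z by apply: (ramifies_quadP gen qd).
split=> //.
- by exists a, c; split=> //; rewrite rE.
- by rewrite rE ler_pdivrMr // mul1r.
- rewrite formP -eq_ca; split=> [[b b0 shape']|ac].
    by rewrite (primitive_cubic_ratio a0 c0 ca b0 shape shape').
  have e : a = c by apply/eqP; rewrite eq_le ca ac.
  by exists a => //; rewrite {2}e.
- rewrite formP ram2; split=> -[D2' H2]; split=> //.
    have [w [w0 w2 wE H]] := odd_part (or_intror D2').
    apply/(no_new_ramificationP (or_intror D2') w0 w2 wE H).
    by rewrite D2' in wE; move: H2; rewrite wE; clear; lia.
  have [w [w0 w2 wE H]] := odd_part (or_intror D2').
  have := proj1 (no_new_ramificationP (or_intror D2') w0 w2 wE H) H2.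
  by rewrite D2' in wE; rewrite wE; clear; lia.
Qed.

End Conclusion.

Local Close Scope classical_set_scope.

Theorem theorem6p1 (R : realType) (K : splittingFieldType rat)
    (hK : C4_quartic K)
    (K2 : {subfield K}) (hK2 : \dim K2 = 2%N)
    (sigma : 'I_(\dim {:K}) -> {rmorphism K -> R[i]})
    (hsigma : enumerates_embeddings sigma) :
  let DK : int := disc {:K}%AS in
  let D2 : R := `|disc K2|%N%:R in
  let N : R := (absnorm K2 (rel_disc K2 {:K}%AS))%:R in
  let no_new_ramification := forall p : nat, prime p ->
    ramifies K2 {:K}%AS p -> ramifies 1%AS K2 p in
  (~ ramifies 1%AS {:K}%AS 2 ->
    let r := powR (D2 / N) (1 / 4) in
    [/\ shape_combinatorial_type sigma (@truncated_octahedron R),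
        shape_is_body_centered_tetragonal sigma r,
        r <= 1,
        (r = 1 <-> shape_is_body_centered_cubic sigma) &
        (r = 1 <-> exists m : int, DK = m ^+ 3) /\
        ((exists m : int, DK = m ^+ 3) <-> no_new_ramification)])
  /\
  (ramifies 1%AS {:K}%AS 2 ->
    let r := powR (4 * D2 / N) (1 / 4) in
    let DK_is_2p11_odd_cube := exists delta : int,
      [/\ DK = 2 ^+ 11 * delta, odd `|delta|%N &
          exists m : int, delta = m ^+ 3] in
    [/\ shape_combinatorial_type sigma (@cuboid R),
        shape_is_primitive_tetragonal sigma r,
        r <= 1,
        (shape_is_primitive_cubic sigma <-> DK_is_2p11_odd_cube) &
        (DK_is_2p11_odd_cube <->
         ramifies 1%AS K2 2 /\ no_new_ramification)]).
Proof.
move=> DK D2 N no_new; have [s gen] := exists_quartic_generator hK hK2.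
have [d [al [D [A [B [C qd]]]]]] := exists_quartic_data gen.
split=> [nram|ram].
  have g : glue D A C by apply: contrapT => /negP /(ramifies2_no_glue qd).
  exact: (unramified_case gen qd hsigma g).
have nog : ~~ glue D A C by apply/negP => /(ramifies2_glue gen qd).
exact: (ramified_case gen qd hsigma nog).
Qed.
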